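(* There is a constant $c\geq 0$ such that for all constant positive integers $s$ and $t$ with $t$ divisible by $3$ there exists an algorithm that takes as input a family $\mathcal{F}$ of $s$-element subsets of an $n$-element set (together with $t$) and counts the number of $t$-tuples of pairwise disjoint subsets from $\mathcal{F}$ in time $$O\bigl(n^{(\frac12-\tau)st+c}\bigr),$$ where $c$ is independent of the constants $s,t,\tau$, and $$\tau=\begin{cases}\dfrac{(3-\omega)(1-\alpha)}{36-6(1+\omega)(1+\alpha)} & \text{if }\alpha\leq 1/2,\\[2mm] \dfrac{1}{18} & \text{if }\alpha\geq 1/2.\end{cases}$$
   Context: A $t$-tuple of pairwise disjoint subsets from $\mathcal{F}$ is a tuple $(S_1,\ldots,S_t)\in\mathcal{F}^t$ with $S_i\cap S_j=\emptyset$ for all $1\leq i<j\leq t$. The numbers $s,t$ are constants independent of $n$ (the constant hidden in $O(\cdot)$ may depend on them). $\omega$ is the limiting exponent of square matrix multiplication, $2\leq\omega<2.3728639$. $\alpha$ is the limiting exponent such that multiplying an $N\times N^\alpha$ matrix with an $N^\alpha\times N$ matrix takes $N^{2+o(1)}$ arithmetic operations, $0.3<\alpha\leq 3-\omega$; one has $\alpha=1$ if and only if $\omega=2$. Convention used in all running times: the product of an $N\times M$ matrix and an $M\times N$ matrix can be computed using (M1) $O(N^{2-\alpha\beta}M^\beta+N^2)$ arithmetic operations when $M\leq N$, where $\beta=(\omega-2)/(1-\alpha)$ (read $\beta=0$ if $\alpha=1$), and (M2) $O(N^{\omega-1}M)$ arithmetic operations when $M\geq N$. *)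

(* Defs.v *)
From HB Require Import structures.
From mathcomp Require Import all_boot all_order all_algebra.
From mathcomp Require Import all_classical all_reals all_analysis.

Set Implicit Arguments.
Unset Strict Implicit.
Unset Printing Implicit Defensive.

Import Order.TTheory GRing.Theory Num.Theory.
Local Open Scope ring_scope.

(** * A word RAM

    Running times are unit-cost times on a word RAM, presented as a structured
    language.  The memory is divided into arrays named by natural numbers, a
    scalar being an array used at index 0 only.  All quantities (constants,
    cell contents, intermediate results, addresses) must be of absolute value
    at most the word bound [W]; a program leaving this range is stuck, i.e. it
    has no execution.  The word bound is always taken polynomial in the size
    parameters of the problem, which is the usual convention of words of
    logarithmically many bits. *)

Inductive binop := Add | Sub | Mul | Div | Mod | Leq.

Inductive expr :=
| Cst of int
| Get of nat & expr           (* [Get a e]: cell number [e] of array [a] *)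
| Bin of binop & expr & expr.

Inductive cmd :=
| Skip
| Set_ of nat & expr & expr   (* [Set_ a e1 e2]: a[e1] := e2 *)
| Seq of cmd & cmd
| If of expr & cmd & cmd      (* nonzero means true *)
| While of expr & cmd
| Call of seq nat & cmd.

Definition memory := nat -> nat -> int.

Definition binop_sem (o : binop) (x y : int) : int :=
  match o with
  | Add => x + y
  | Sub => x - y
  | Mul => x * y
  | Div => (x %/ y)%Z
  | Mod => (x %% y)%Z
  | Leq => (x <= y)%R%:Z
  end.

Definition word (W : nat) (x : int) : option int :=
  if (absz x <= W)%N then Some x else None.

Fixpoint eval (W : nat) (m : memory) (e : expr) : option int :=
  match e with
  | Cst x => word W x
  | Get a e1 => if eval W m e1 is Some (Posz i) then word W (m a i) else None
  | Bin o e1 e2 =>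
      if eval W m e1 is Some x then
        if eval W m e2 is Some y then word W (binop_sem o x y) else None
      else None
  end.

Fixpoint ecost (e : expr) : nat :=
  match e with
  | Cst _ => 1
  | Get _ e1 => (ecost e1).+1
  | Bin _ e1 e2 => (ecost e1 + ecost e2).+1
  end.

Definition update (m : memory) (a i : nat) (x : int) : memory :=
  fun b j => if (b == a) && (j == i) then x else m b j.

(** A procedure call [Call ps c] passes the arrays [ps] by reference: inside
    [c] they are named 0, 1, ..., [size ps - 1], every other array of [c] is
    local and initially zero, and the other arrays of the caller are
    untouched.  Since [ps] has to be duplicate-free, no array is copied. *)

Definition call_enter (ps : seq nat) (m : memory) : memory :=
  fun b => if (b < size ps)%N then m (nth 0%N ps b) else fun=> 0.

Definition call_leave (ps : seq nat) (m m1 : memory) : memory :=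
  fun a => if a \in ps then m1 (index a ps) else m a.

(** [exec W c m m' k]: on words bounded by [W], the command [c] started in [m]
    halts in [m'] after [k] steps. *)
Inductive exec (W : nat) : cmd -> memory -> memory -> nat -> Prop :=
| ExecSkip m : exec W Skip m m 1
| ExecSet a e1 e2 m (i : nat) (x : int) :
    eval W m e1 = Some (Posz i) -> eval W m e2 = Some x ->
    exec W (Set_ a e1 e2) m (update m a i x) (ecost e1 + ecost e2).+1
| ExecSeq c1 c2 m m1 m2 k1 k2 :
    exec W c1 m m1 k1 -> exec W c2 m1 m2 k2 ->
    exec W (Seq c1 c2) m m2 (k1 + k2)
| ExecIfTrue e c1 c2 m m' (x : int) k :
    eval W m e = Some x -> x != 0 -> exec W c1 m m' k ->
    exec W (If e c1 c2) m m' (ecost e + k).+1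
| ExecIfFalse e c1 c2 m m' k :
    eval W m e = Some 0 -> exec W c2 m m' k ->
    exec W (If e c1 c2) m m' (ecost e + k).+1
| ExecWhileTrue e c m m1 m2 (x : int) k1 k2 :
    eval W m e = Some x -> x != 0 ->
    exec W c m m1 k1 -> exec W (While e c) m1 m2 k2 ->
    exec W (While e c) m m2 (ecost e + k1 + k2).+1
| ExecWhileFalse e c m :
    eval W m e = Some 0 -> exec W (While e c) m m (ecost e).+1
| ExecCall ps c m m1 k :
    uniq ps -> exec W c (call_enter ps m) m1 k ->
    exec W (Call ps c) m (call_leave ps m m1) (size ps + k).+1.

(** Inputs fill the arrays 0, 1, ... one after the other, all other cells being
    zero; outputs are read from array 0. *)
Definition load (ss : seq (seq int)) : memory :=
  fun a i => nth 0 (nth [::] ss a) i.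

(** * Matrix multiplication *)

Definition row_major (p q : nat) (A : 'M[int]_(p, q)) : seq int :=
  [seq A i j | i <- enum 'I_p, j <- enum 'I_q].

(** [mulmx_time shape T]: some program multiplies integer matrices of sizes
    N x M and M x N, for all N, M such that [shape N M], in O(T N M)
    arithmetic operations.  The operations are on words of
    O(log (N + M + H)) bits, where H bounds the entries, and their number
    does not depend on H. *)
Definition mulmx_time (R : realType) (shape : nat -> nat -> Prop)
    (T : nat -> nat -> R) : Prop :=
  exists (P : cmd) (K : nat) (C : R),
  forall (N M H : nat) (A : 'M[int]_(N, M)) (B : 'M[int]_(M, N)),
    (0 < N)%N -> (0 < M)%N -> shape N M ->
    (forall i j, (absz (A i j) <= H)%N) ->
    (forall i j, (absz (B i j) <= H)%N) ->
    exists (m' : memory) (k : nat),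
      [/\ exec (K * (N + M + H) ^ K)
            P (load [:: [:: N%:Z; M%:Z]; row_major A; row_major B]) m' k,
          forall i j : 'I_N, m' 0%N (i * N + j)%N = (A *m B) i j
        & k%:R <= C * T N M].

Definition limit_omega (R : realType) : R :=
  inf [set e : R | mulmx_time (fun N M => M = N) (fun N _ => N%:R `^ e)]%classic.

Definition limit_alpha (R : realType) : R :=
  sup [set a : R | 0 <= a /\
    forall eps : R, 0 < eps ->
      mulmx_time (fun N M => M = Num.truncn (N%:R `^ a : R))
        (fun N _ => N%:R `^ (2 + eps))]%classic.

Definition beta (R : realType) (omega alpha : R) : R :=
  if alpha == 1 then 0 else (omega - 2) / (1 - alpha).

Definition rect_mulmx_thin (R : realType) (omega alpha : R) : Prop :=
  mulmx_time (fun N M => M <= N)%N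
    (fun N M => N%:R `^ (2 - alpha * beta omega alpha)
                  * M%:R `^ (beta omega alpha) + N%:R ^+ 2).

Definition rect_mulmx_fat (R : realType) (omega : R) : Prop :=
  mulmx_time (fun N M => N <= M)%N
    (fun N M => N%:R `^ (omega - 1) * M%:R).

(** * Counting tuples of pairwise disjoint sets *)

Definition disjoint_tuples (n t : nat) (F : {set {set 'I_n}}) :
    {set t.-tuple {set 'I_n}} :=
  [set S : t.-tuple {set 'I_n} |
     [forall i, tnth S i \in F] &&
     [forall i : 'I_t, forall j : 'I_t,
        (i < j)%N ==> [disjoint tnth S i & tnth S j]]]%SET.

(** [L] lists each member of [F] exactly once, each as a list of its elements,
    both in arbitrary order. *)
Definition lists_family (n : nat) (L : seq (seq 'I_n))
    (F : {set {set 'I_n}}) : Prop :=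
  all uniq L /\ perm_eq [seq [set x in l]%SET | l <- L] (enum F).

Definition family_input (n s t : nat) (L : seq (seq 'I_n)) : memory :=
  load [:: [:: n%:Z; s%:Z; t%:Z; (size L)%:Z];
           [seq (nat_of_ord x)%:Z | x <- flatten L]].

(** [counting_time s t T]: some algorithm counts the [t]-tuples of pairwise
    disjoint members of families of [s]-subsets of an [n]-set in time O(T n),
    on words of O(log n) bits. *)
Definition counting_time (R : realType) (s t : nat) (T : nat -> R) : Prop :=
  exists (P : cmd) (K : nat) (C : R),
  forall (n : nat) (F : {set {set 'I_n}}) (L : seq (seq 'I_n)),
    (0 < n)%N -> (forall S, S \in F -> #|S| = s) -> lists_family L F ->
    exists (m' : memory) (k : nat),
      [/\ exec (K * n ^ K) P (family_input s t L) m' k,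
          m' 0%N 0%N = #|disjoint_tuples t F|%:Z
        & k%:R <= C * T n].

Definition tau (R : realType) (omega alpha : R) : R :=
  if alpha <= 1 / 2 then
    ((3 - omega) * (1 - alpha)) / (36 - 6 * (1 + omega) * (1 + alpha))
  else 1 / 18.

(* Main.v *)
(** A member of the family is a word of length s, and a packing of t/3 members is
    a repetition-free word of length q = st/3; let f be the indicator function of
    the packings.  The answer is the sum of f(a) f(b) f(c) over the triples of
    words with pairwise disjoint supports A, B, C.  With
    w = |A /\ B| + |C /\ (A + B)|, where + is the symmetric difference, one has
    |A + B + C| = 3q - 2w, and the triple is disjoint if and only if w = 0.

    Let Phi be the polynomial of degree q + l in w with roots 1, ..., q + l.  The
    sum of f(a) f(b) f(c) Phi(w) over all triples is a combination of the cubes of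
    the sums of f(a) (-1)^|A /\ Z| for the words Z of length q + l, because
    (-1)^|(A + B + C) /\ Z| is the product of the three signs.  As
    w <= |A /\ B| + q, every triple with |A /\ B| <= l that is not disjoint
    contributes 0, so only the triples with |A /\ B| > l have to be subtracted.
    For these, A and B share a subword i of length l, and the pairs (A, B) with
    A = x i and B = i y are counted by multiplying a matrix of size
    n^(q - l) x n^l with one of size n^l x n^(q - l); the sum over c depends on
    x and y only, and is read off a table of marginals of f in constant time.
    All costs are balanced by taking l close to (1/2 - 3 tau) q. *)

Require Import Defs.
From mathcomp Require Import all_boot all_order all_algebra.
From mathcomp Require Import all_classical all_reals all_analysis.
From mathcomp Require Import zify ring lra.
Import Order.TTheory GRing.Theory Num.Theory.
Local Open Scope ring_scope.
Set Implicit Arguments.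
Unset Strict Implicit.
Unset Printing Implicit Defensive.
Local Notation eval := Defs.eval.

(** * Words and their numbering *)

(** Every word Z and every pair (x, y) may cost constant time only. This rests on the table of
    marginals of f: it is filled by q passes over the words of length q, each summing out one
    coordinate, and both the signs against Z and the count of letters of c in x + y expand into a
    bounded number of its entries. The added element n is the wildcard of that table; as a letter of
    Z it also supplies the constant term of a linear factor of Phi, so that words of length deg Phi
    suffice. Removing the common subword i from A and B leaves A + B = x + y, and this is why the
    sum over c depends on x and y only. Words have an order and the common elements may sit
    anywhere, so f is first symmetrized. A pair with |A /\ B| = w is then met r! r! times for each
    of the w!/(w - l)! words i, where r = q - l; the weights are divided by w!/(w - l)!, after
    scaling by q! to stay in the integers. Three exponents compete: q + l for the words Z, 2 (q - l)
    for the pairs (x, y), and that of the matrix product. The value of tau equates the first and the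
    third if alpha <= 1/2, and the first two if alpha >= 1/2. *)

Fixpoint lists (X : Type) (A : seq X) (m : nat) : seq (seq X) :=
  if m is m'.+1 then [seq x :: w | x <- A, w <- lists A m'] else [:: [::]].

Lemma mem_lists (X : eqType) (A : seq X) m w :
  (w \in lists A m) = (size w == m) && all (mem A) w.
Proof.
elim: m w => [|m IH] [|x w] //=.
  by apply/negbTE/allpairsP => -[[y v] []].
rewrite eqSS andbCA -IH; apply/allpairsP/andP => [[[y v] /= [yA vL [-> ->]]] //|[xA wL]].
by exists (x, w).
Qed.

Lemma uniq_lists (X : eqType) (A : seq X) m : uniq A -> uniq (lists A m).
Proof.
move=> uA; elim: m => //= m IH.
by apply: allpairs_uniq => // -[x v] [y w] _ _ /= [-> ->].
Qed.

Lemma map_lists (X Y : Type) (g : X -> Y) (A : seq X) m :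
  lists (map g A) m = map (map g) (lists A m).
Proof.
elim: m => //= m ->; rewrite map_allpairs.
by rewrite allpairs_mapl allpairs_mapr.
Qed.

Lemma big_lists0 (X : Type) (V : nmodType) (A : seq X) (f : seq X -> V) :
  \sum_(w <- lists A 0) f w = f [::].
Proof. by rewrite big_seq1. Qed.

Lemma big_listsS (X : Type) (V : nmodType) (A : seq X) m (f : seq X -> V) :
  \sum_(w <- lists A m.+1) f w = \sum_(x <- A) \sum_(w <- lists A m) f (x :: w).
Proof. by rewrite /= big_allpairs_dep. Qed.

Lemma big_lists_cat (X : Type) (V : nmodType) (A : seq X) m1 m2 (f : seq X -> V) :
  \sum_(w <- lists A (m1 + m2)) f w =
  \sum_(u <- lists A m1) \sum_(v <- lists A m2) f (u ++ v).
Proof.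
elim: m1 f => [|m1 IH] f; first by rewrite big_lists0.
rewrite addSn !big_listsS; apply: eq_bigr => x _; exact: IH.
Qed.

Definition words (b m : nat) : seq (seq nat) := lists (iota 0 b) m.

Lemma mem_words b m w :
  (w \in words b m) = (size w == m) && all (fun x => x < b)%N w.
Proof.
rewrite mem_lists; congr andb; apply: eq_all => x /=.
by rewrite mem_iota add0n.
Qed.

Lemma uniq_words b m : uniq (words b m).
Proof. exact/uniq_lists/iota_uniq. Qed.

(** The first letter is the most significant digit, so the number of [u ++ v] is the row-major
    address of row [u], column [v]: a table can be read as a matrix for any splitting of its
    words. *)
Definition num (b : nat) (w : seq nat) : nat :=
  foldl (fun acc x => acc * b + x)%N 0%N w.

Lemma num_foldl b acc w :
  foldl (fun acc x => acc * b + x)%N acc w = (acc * b ^ size w + num b w)%N.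
Proof.
rewrite /num; elim: w acc => [|x w IH] acc /=; first by rewrite muln1 addn0.
by rewrite IH [in RHS]IH expnS; nia.
Qed.

Lemma num_cat b u v : num b (u ++ v) = (num b u * b ^ size v + num b v)%N.
Proof. by rewrite {1}/num foldl_cat num_foldl. Qed.

Lemma num_cons b x w : num b (x :: w) = (x * b ^ size w + num b w)%N.
Proof. by rewrite -cat1s num_cat. Qed.

(** The words starting with [x] form the block of [b ^ m] consecutive numbers from [x * b ^ m] on.
    Range, injectivity, surjectivity and reindexing of sums all follow from this one equation. *)
Lemma map_num b m : [seq num b w | w <- words b m] = iota 0 (b ^ m).
Proof.
elim: m => //= m IH; rewrite map_allpairs.
have E x : [seq num b (x :: w) | w <- words b m] = iota (x * b ^ m) (b ^ m).
  rewrite -[X in iota X _]addn0 iotaDl -IH -map_comp; apply/eq_in_map => w.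
  by rewrite mem_words => /andP[/eqP sw _] /=; rewrite num_cons sw.
rewrite (eq_map E) expnS.
elim: b {IH E} (b ^ m)%N => // b IH k.
by rewrite -[in LHS]addn1 iotaD map_cat flatten_cat IH /= cats0 add0n mulSn addnC iotaD.
Qed.

Lemma num_lt b m w : w \in words b m -> (num b w < b ^ m)%N.
Proof. by move=> /(map_f (num b)); rewrite map_num mem_iota. Qed.

Lemma inj_in_uniq_map (X Y : eqType) (g : X -> Y) (s : seq X) :
  uniq (map g s) -> {in s &, injective g}.
Proof.
elim: s => //= x s IH /andP[gxs /IH{}IH] y z; rewrite !inE.
move=> /predU1P[->|ys] /predU1P[->|zs] // gE; last exact: IH.
- by rewrite gE map_f in gxs.
- by rewrite -gE map_f in gxs.
Qed.

Lemma num_inj b m : {in words b m &, injective (num b)}.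
Proof. by apply: inj_in_uniq_map; rewrite map_num iota_uniq. Qed.

Lemma num_surj b m i : (i < b ^ m)%N -> exists2 w, w \in words b m & i = num b w.
Proof.
move=> lti; have : i \in [seq num b w | w <- words b m] by rewrite map_num mem_iota.
by move=> /mapP[w ? ->]; exists w.
Qed.

Lemma sum_num (V : nmodType) b m (f : nat -> V) :
  \sum_(w <- words b m) f (num b w) = \sum_(i < b ^ m) f i.
Proof. by rewrite -(big_mkord xpredT f) /index_iota subn0 -(big_map (num b) predT f) map_num. Qed.

(** * Running times of commands *)

Lemma word_some W x : (absz x <= W)%N -> word W x = Some x.
Proof. by rewrite /word => ->. Qed.

Lemma word_le W W' x y : (W <= W')%N -> word W x = Some y -> word W' x = Some y.
Proof. by rewrite /word => leW; case: ifP => // xW [<-]; rewrite (leq_trans xW). Qed.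

Lemma eval_le W W' m e x : (W <= W')%N -> eval W m e = Some x -> eval W' m e = Some x.
Proof.
move=> leW; elim: e x => [c|a e IH|o e1 IH1 e2 IH2] x /=.
- exact: word_le.
- case: (eval W m e) IH => // y /(_ _ erefl) ->.
  by case: y => // i; apply: word_le.
- case: (eval W m e1) IH1 => // y1 /(_ _ erefl) ->.
  case: (eval W m e2) IH2 => // y2 /(_ _ erefl) ->.
  exact: word_le.
Qed.

(** Needed to run the given multiplication program, whose word bound depends on its own input,
    inside a computation with larger words. *)
Lemma exec_le W W' c m m' k : (W <= W')%N -> exec W c m m' k -> exec W' c m m' k.
Proof.
move=> leW; elim=> {c m m' k}.
- by constructor.
- by move=> *; apply: ExecSet; apply: eval_le; eassumption.
- by move=> *; apply: ExecSeq; eassumption.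
- move=> e c1 c2 m m' x k H1 H2 _ H3; exact: ExecIfTrue (eval_le leW H1) H2 H3.
- move=> e c1 c2 m m' k H1 _ H3; exact: ExecIfFalse (eval_le leW H1) H3.
- move=> e c m m1 m2 x k1 k2 H1 H2 _ H3 _ H4; exact: ExecWhileTrue (eval_le leW H1) H2 H3 H4.
- move=> e c m H1; exact: ExecWhileFalse (eval_le leW H1).
- by move=> *; apply: ExecCall.
Qed.

(** [exec] counts steps exactly; an upper bound can be weakened and hence passed through sequences
    and loops. *)
Definition runs (W : nat) (c : cmd) (m : memory) (k : nat) (Q : memory -> Prop) : Prop :=
  exists m' k', [/\ exec W c m m' k', (k' <= k)%N & Q m'].

Lemma runs_conseq W c m k k' (Q Q' : memory -> Prop) :
  (k <= k')%N -> (forall m', Q m' -> Q' m') -> runs W c m k Q -> runs W c m k' Q'.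
Proof.
move=> lek QQ' [m' [k1 [H1 H2 H3]]]; exists m', k1; split=> //.
  exact: leq_trans H2 lek.
exact: QQ'.
Qed.

Lemma runs_seq W c1 c2 m k1 k2 (Q1 Q2 : memory -> Prop) :
  runs W c1 m k1 Q1 -> (forall m', Q1 m' -> runs W c2 m' k2 Q2) ->
  runs W (Seq c1 c2) m (k1 + k2) Q2.
Proof.
move=> [m1 [k1' [H1 H2 H3]]] /(_ _ H3) [m2 [k2' [H4 H5 H6]]].
exists m2, (k1' + k2')%N; split=> //; first exact: ExecSeq H1 H4.
exact: leq_add.
Qed.

Lemma runs_set W a e1 e2 m i x (Q : memory -> Prop) :
  eval W m e1 = Some (Posz i) -> eval W m e2 = Some x -> Q (update m a i x) ->
  runs W (Set_ a e1 e2) m (ecost e1 + ecost e2).+1 Q.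
Proof.
by move=> H1 H2 H3; exists (update m a i x), (ecost e1 + ecost e2).+1; split=> //; apply: ExecSet.
Qed.

Definition for_ (a : nat) (ub : expr) (c : cmd) : cmd :=
  Seq (Set_ a (Cst 0) (Cst 0))
    (While (Bin Leq (Bin Add (Get a (Cst 0)) (Cst 1)) ub)
       (Seq c (Set_ a (Cst 0) (Bin Add (Get a (Cst 0)) (Cst 1))))).

Lemma update_eq m a i x : update m a i x a i = x.
Proof. by rewrite /update !eqxx. Qed.

Lemma update_neq m a i x b j : b != a -> update m a i x b j = m b j.
Proof. by rewrite /update => /negbTE ->. Qed.

Lemma update_arr m a i x j : update m a i x a j = if j == i then x else m a j.
Proof. by rewrite /update eqxx. Qed.

Section For.
Variables (W a : nat) (ub : expr) (c : cmd) (N k : nat) (I : nat -> memory -> Prop).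
Hypothesis NW : (N < W)%N.
Hypothesis I_update : forall x m y, (x <= N)%N -> I x m -> I x (update m a 0 y).
Hypothesis I_ub : forall x m, (x <= N)%N -> I x m -> eval W m ub = Some N%:Z.
Hypothesis I_step : forall x m, (x < N)%N -> I x m -> m a 0%N = x%:Z ->
  runs W c m k (fun m' => m' a 0%N = x%:Z /\ I x.+1 m').

(** The invariant has to ignore the counter, which the loop itself writes, and to fix the value of
    [ub], which is evaluated again at each test. The last test computes N + 1, whence [N < W]. One
    round costs [ecost ub + 12] besides the body, for test and increment. *)
Lemma runs_for m :
  I 0 m -> runs W (for_ a ub c) m (N * (k + ecost ub + 12) + ecost ub + 10) (I N).
Proof.
have eval_a x m1 : (x <= N)%N -> m1 a 0%N = x%:Z -> eval W m1 (Get a (Cst 0)) = Some x%:Z.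
  move=> xN m1a; rewrite /= /word /= m1a /= ifT //; exact: leq_trans xN (ltnW NW).
have eval_a1 x m1 : (x <= N)%N -> m1 a 0%N = x%:Z ->
    eval W m1 (Bin Add (Get a (Cst 0)) (Cst 1)) = Some x.+1%:Z.
  move=> xN m1a; have -> : eval W m1 (Bin Add (Get a (Cst 0)) (Cst 1)) =
      if eval W m1 (Get a (Cst 0)) is Some z then if word W 1 is Some y then word W (z + y) else None
      else None by [].
  rewrite (eval_a x) // word_some; last by apply: leq_trans NW.
  have -> : x%:Z + 1 = x.+1%:Z by lia.
  by rewrite word_some //; apply: leq_trans NW.
have eval_c x m1 : (x <= N)%N -> m1 a 0%N = x%:Z -> I x m1 ->
    eval W m1 (Bin Leq (Bin Add (Get a (Cst 0)) (Cst 1)) ub) = Some ((x.+1 <= N)%N%:Z).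
  move=> xN m1a I1.
  have -> : eval W m1 (Bin Leq (Bin Add (Get a (Cst 0)) (Cst 1)) ub) =
      if eval W m1 (Bin Add (Get a (Cst 0)) (Cst 1)) is Some z
      then if eval W m1 ub is Some y then word W (binop_sem Leq z y) else None
      else None by [].
  rewrite (eval_a1 x) // (I_ub xN I1) /= lez_nat word_some //.
  by case: (x < N)%N => //=; apply: leq_ltn_trans NW.
have loop d x m1 : (x + d = N)%N -> m1 a 0%N = x%:Z -> I x m1 ->
  runs W (While (Bin Leq (Bin Add (Get a (Cst 0)) (Cst 1)) ub)
       (Seq c (Set_ a (Cst 0) (Bin Add (Get a (Cst 0)) (Cst 1))))) m1
    (d * (k + ecost ub + 12) + ecost ub + 7) (I N).
  elim: d x m1 => [|d IH] x m1 xd m1a I1.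
    rewrite addn0 in xd; rewrite xd in m1a I1.
    exists m1, (ecost (Bin Leq (Bin Add (Get a (Cst 0)) (Cst 1)) ub)).+1; split=> //.
      by apply: ExecWhileFalse; rewrite (eval_c N) // ltnn.
    by rewrite /=; lia.
  have xN : (x < N)%N by lia.
  have [m2 [k2 [E2 k2k [m2a I2]]]] := I_step xN I1 m1a.
  have [] := IH x.+1 (update m2 a 0 x.+1%:Z); first lia.
  - exact: update_eq.
  - exact: I_update.
  move=> m3 [k3 [E3 k3k I3]].
  exists m3; eexists; split; last by [].
    apply: (ExecWhileTrue (x := 1)) => //; last exact: E3.
      by rewrite (eval_c x) ?xN // ltnW.
    apply: ExecSeq E2 _; apply: ExecSet; first by rewrite /= word_some.
    by apply: eval_a1 => //; apply: ltnW.
  by rewrite /=; move: k2k k3k; rewrite mulSn; lia.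
move=> I0; rewrite [X in runs _ _ _ X](_ : _ = (3 + (N * (k + ecost ub + 12) + ecost ub + 7)))%N; last lia.
apply: (@runs_seq _ _ _ _ _ _ (fun m' => m' a 0%N = 0 /\ I 0 m')).
  apply: runs_set => //=; rewrite ?word_some //.
  by rewrite update_eq; split=> //; apply: I_update.
by move=> m1 [m1a I1]; apply: (loop N 0%N m1).
Qed.
End For.

(** * Tables and arithmetic expressions over them *)

(* In an index, [Some i] is the i-th variable and [None] the value [n].  Indices run
   over 0, ..., n: the value [n], which is not an element of the ground set, is a
   dummy element or marks a coordinate that is summed out. *)
Inductive tex :=
| TC of int
| TN
| TV of nat
| TT of nat & seq (option nat)
| TB of binop & tex & tex.

Definition table : Type := nat * (seq nat -> int).

Definition table0 : table := (0%N, fun=> 0).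

Definition aval (n : nat) (env : seq nat) (o : option nat) : nat :=
  if o is Some i then nth 0%N env i else n.

Fixpoint sem (n : nat) (ts : seq table) (env : seq nat) (E : tex) : int :=
  match E with
  | TC c => c
  | TN => n%:Z
  | TV i => (nth 0%N env i)%:Z
  | TT j o => (nth table0 ts j).2 (map (aval n env) o)
  | TB o E1 E2 => binop_sem o (sem n ts env E1) (sem n ts env E2)
  end.

Definition wf_atom (nv : nat) (o : option nat) : bool :=
  if o is Some i then (i < nv)%N else true.

Fixpoint wf (ar : seq nat) (nv : nat) (E : tex) : bool :=
  match E with
  | TC _ | TN => true
  | TV i => (i < nv)%N
  | TT j o => [&& (j < size ar)%N, size o == nth 0%N ar j & all (wf_atom nv) o]
  | TB _ E1 E2 => wf ar nv E1 && wf ar nv E2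
  end.

(** Measures values as exponents of n + 1: an operation at worst multiplies its arguments, so sizes
    add, and a constant c is at most (n + 1)^(|c| + 1). *)
Fixpoint tsize (E : tex) : nat :=
  match E with
  | TC c => (absz c).+1
  | TB _ E1 E2 => tsize E1 + tsize E2
  | _ => 1
  end.

(* Arrays 0 and 1 hold the input, arrays 2 and 3 the factors of the matrix product. *)
Definition var (i : nat) : nat := (2 * i + 4)%N.
Definition tbl (j : nat) : nat := (2 * j + 5)%N.

Definition exp_n : expr := Get 0 (Cst 0).
Definition exp_b : expr := Bin Add exp_n (Cst 1).

Definition comp_atom (o : option nat) : expr :=
  if o is Some i then Get (var i) (Cst 0) else exp_n.

Definition horner_exp (es : seq expr) : expr :=
  foldl (fun e a => Bin Add (Bin Mul e exp_b) a) (Cst 0) es.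

Definition comp_index (o : seq (option nat)) : expr := horner_exp (map comp_atom o).

Fixpoint comp (E : tex) : expr :=
  match E with
  | TC c => Cst c
  | TN => exp_n
  | TV i => Get (var i) (Cst 0)
  | TT j o => Get (tbl j) (comp_index o)
  | TB o E1 E2 => Bin o (comp E1) (comp E2)
  end.

Definition holds (n : nat) (ts : seq table) (m : memory) : Prop :=
  m 0%N 0%N = n%:Z /\
  forall j y, (j < size ts)%N -> y \in words n.+1 (nth table0 ts j).1 ->
    m (tbl j) (num n.+1 y) = (nth table0 ts j).2 y.

Definition bounded (n K : nat) (ts : seq table) : Prop :=
  forall j, (j < size ts)%N -> ((nth table0 ts j).1 <= K)%N /\
    forall y, y \in words n.+1 (nth table0 ts j).1 ->
      (absz ((nth table0 ts j).2 y) <= n.+1 ^ K)%N.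

Definition env_in (env : seq nat) (m : memory) : Prop :=
  forall i, (i < size env)%N -> m (var i) 0%N = (nth 0%N env i)%:Z.

Lemma tsize_gt0 E : (0 < tsize E)%N.
Proof. by elim: E => //= o E1 H1 E2 H2; rewrite addn_gt0 H1. Qed.

Lemma absz_divz (x y : int) : (absz (x %/ y)%Z <= absz x)%N.
Proof.
have [->|y0] := eqVneq y 0; first by rewrite divz0.
wlog: x y y0 / 0 < y => [H|yp].
  have [yp|] := ltP 0 y; first exact: H.
  rewrite le_eqVlt (negbTE y0) /= => yn.
  by rewrite -[y]opprK divzN abszN; apply: H; rewrite ?oppr_eq0 // oppr_gt0.
have := divz_eq x y; have := modz_ge0 x y0; have := ltz_pmod x yp.
move: (x %/ y)%Z (x %% y)%Z => d r; nia.
Qed.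

(** Positive exponents make both bounds p, q at least 2, and then p + q <= p q covers sums and
    differences as well. *)
Lemma absz_binop_sem (B i j : nat) o x y :
  (1 < B)%N -> (0 < i)%N -> (0 < j)%N ->
  (absz x <= B ^ i)%N -> (absz y <= B ^ j)%N ->
  (absz (binop_sem o x y) <= B ^ (i + j))%N.
Proof.
move=> B1 i0 j0 xi yj; rewrite expnD.
have Bi : (1 < B ^ i)%N by rewrite -(exp1n i) ltn_exp2r.
have Bj : (1 < B ^ j)%N by rewrite -(exp1n j) ltn_exp2r.
move: (B ^ i)%N (B ^ j)%N Bi Bj xi yj => p q p1 q1 xp yq.
have pq1 : (p <= p * q)%N by nia.
have pq2 : (q <= p * q)%N by nia.
have pq3 : (p + q <= p * q)%N by nia.
case: o => /=.
- lia.
- lia.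
- by rewrite abszM; apply: leq_mul.
- by apply: leq_trans (absz_divz x y) _; apply: leq_trans xp pq1.
- have [->|y0] := eqVneq y 0; first by rewrite modz0 (leq_trans xp).
  have := modz_ge0 x y0; have := ltz_mod x y0; lia.
- by case: (_ <= _); lia.
Qed.

Section Eval.
Variables (W n : nat) (m : memory).
Hypothesis n_gt0 : (0 < n)%N.
Hypothesis bW : (n.+1 <= W)%N.
Hypothesis m_n : m 0%N 0%N = n%:Z.

Lemma eval_n : eval W m exp_n = Some n%:Z.
Proof. by rewrite /= /word /= m_n /= ltnW. Qed.

Lemma eval_b : eval W m exp_b = Some n.+1%:Z.
Proof.
rewrite [LHS](_ : _ = if eval W m exp_n is Some x then
  if word W 1 is Some y then word W (x + y) else None else None) //.
rewrite eval_n word_some; last by apply: leq_trans bW.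
have -> : n%:Z + 1 = n.+1%:Z by lia.
by rewrite word_some.
Qed.

Lemma eval_horner k es w : [seq eval W m e | e <- es] = [seq Some x%:Z | x <- w] ->
  w \in words n.+1 k -> (n.+1 ^ k <= W)%N ->
  eval W m (horner_exp es) = Some (num n.+1 w)%:Z.
Proof.
elim/last_ind: es w k => [|es e IH] w k.
  by case: w => // _ _ _; rewrite /= word_some.
case/lastP: w => [|w x]; first by rewrite map_rcons; case: (map _ es).
rewrite !map_rcons => /eqP; rewrite eqseq_rcons => /andP[/eqP esw /eqP ex].
rewrite mem_words size_rcons all_rcons => /and3P[/eqP <- ltx ltw] kW.
have ww : w \in words n.+1 (size w) by rewrite mem_words eqxx.
have ltN := num_lt ww.
rewrite /horner_exp foldl_rcons -/(horner_exp es) /num foldl_rcons -/(num _ _).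
move: kW; rewrite expnS; move: (IH w _ esw ww) ltN.
set N := num _ _; set p := (_ ^ _)%N => {}IH ltN pW.
rewrite [LHS](_ : _ = if (if eval W m (horner_exp es) is Some x then
  if eval W m exp_b is Some y then word W (x * y) else None else None) is Some x then
  if eval W m e is Some y then word W (x + y) else None else None) //.
rewrite IH ?eval_b ?ex; last nia.
rewrite word_some; last by rewrite -PoszM absz_nat; nia.
by rewrite -PoszM -PoszD word_some // absz_nat; nia.
Qed.

Variable env : seq nat.
Hypothesis env_m : env_in env m.
Hypothesis env_b : all (fun x => x < n.+1)%N env.

Lemma aval_lt o : wf_atom (size env) o -> (aval n env o < n.+1)%N.
Proof. by case: o => [i|] //= /(mem_nth 0%N); apply: (allP env_b). Qed.

Lemma eval_atom o : wf_atom (size env) o ->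
  eval W m (comp_atom o) = Some (aval n env o)%:Z.
Proof.
move=> wo; have := aval_lt wo; case: o wo => [i|] wi; last by rewrite eval_n.
rewrite /= /word /= env_m //= => lti.
by rewrite ifT //; apply: leq_trans (ltnW lti) bW.
Qed.

Lemma words_aval o : all (wf_atom (size env)) o ->
  map (aval n env) o \in words n.+1 (size o).
Proof.
move=> wo; rewrite mem_words size_map eqxx /= all_map.
by apply/allP => a /(allP wo) /aval_lt.
Qed.

Lemma eval_index o : all (wf_atom (size env)) o -> (n.+1 ^ size o <= W)%N ->
  eval W m (comp_index o) = Some (num n.+1 (map (aval n env) o))%:Z.
Proof.
move=> wo oW; apply: (eval_horner _ (words_aval wo)) => //.
by rewrite -!map_comp; apply/eq_in_map => a /(allP wo) /eval_atom.
Qed.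

Variables (K : nat) (ts : seq table).
Hypothesis K_gt0 : (0 < K)%N.
Hypothesis ts_K : bounded n K ts.
Hypothesis ts_m : holds n ts m.

Lemma absz_sem E : wf (unzip1 ts) (size env) E ->
  (absz (sem n ts env E) <= n.+1 ^ (K * tsize E))%N.
Proof.
have b1 : (1 < n.+1)%N by [].
elim: E => [c||i|j o|o E1 IH1 E2 IH2] /=.
- move=> _; apply: leq_trans (_ : absz c <= n.+1 ^ (absz c).+1)%N _.
    by apply: ltnW; apply: ltn_trans (ltnSn _) (ltn_expl _ b1).
  by rewrite leq_exp2l // leq_pmull.
- by move=> _; rewrite muln1; apply: leq_trans (leqnSn n) _; rewrite -[X in (X <= _)%N]expn1 leq_exp2l.
- move=> iN; have := @aval_lt (Some i) iN => /= /ltnW h.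
  by rewrite muln1; apply: leq_trans h _; rewrite -[X in (X <= _)%N]expn1 leq_exp2l.
- rewrite size_map => /and3P[jts /eqP so wo]; rewrite muln1.
  have [_] := ts_K jts; apply; have := words_aval wo.
  by rewrite so (nth_map table0).
- move=> /andP[/IH1 h1 /IH2 h2]; rewrite mulnDr; apply: absz_binop_sem => //.
    by rewrite muln_gt0 K_gt0 tsize_gt0.
  by rewrite muln_gt0 K_gt0 tsize_gt0.
Qed.

(** One bound for the whole expression suffices, because [tsize] does not increase on passing to a
    subexpression. *)
Lemma eval_comp E : wf (unzip1 ts) (size env) E -> (n.+1 ^ (K * tsize E) <= W)%N ->
  eval W m (comp E) = Some (sem n ts env E).
Proof.
have b1 : (1 < n.+1)%N by [].
move=> wE EW; have sW := leq_trans (absz_sem wE) EW.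
elim: E wE EW sW => [c||i|j o|o E1 IH1 E2 IH2] wE EW sW.
- by rewrite /= word_some.
- exact: eval_n.
- exact: (@eval_atom (Some i)).
- case/and3P: (wE); rewrite size_map => jts /eqP so wo.
  have [aK _] := ts_K jts.
  rewrite (nth_map table0) // in so.
  rewrite /= eval_index //; last first.
    apply: leq_trans EW; rewrite /= muln1 so leq_exp2l //.
  have h := words_aval wo; rewrite so in h.
  by have [_ ->] := ts_m; rewrite ?word_some.
- case/andP: (wE) => wE1 wE2.
  have le1 : (n.+1 ^ (K * tsize E1) <= W)%N.
    by apply: leq_trans EW; rewrite leq_exp2l //= leq_mul2l leq_addr orbT.
  have le2 : (n.+1 ^ (K * tsize E2) <= W)%N.
    by apply: leq_trans EW; rewrite leq_exp2l //= leq_mul2l leq_addl orbT.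
  rewrite /= IH1 //; last exact: leq_trans (absz_sem wE1) le1.
  rewrite IH2 //; last exact: leq_trans (absz_sem wE2) le2.
  by rewrite word_some.
Qed.
End Eval.

(** * Computing a table by nested loops *)

(** A table given by a sum, with the free coordinates before the summed ones. Every table between
    the input and the answer has this form, except the matrix product. *)
Record stmt := Stmt { out_ar : nat; sum_ar : nat; rhs : tex }.

Definition sem_stmt (n : nat) (ts : seq table) (s : stmt) : table :=
  (out_ar s, fun y => \sum_(x <- words n.+1 (sum_ar s)) sem n ts (y ++ x) (rhs s)).

Fixpoint nest (i r : nat) (c : cmd) : cmd :=
  if r is r'.+1 then for_ (var i) exp_b (nest i.+1 r' c) else c.

Definition out_index (k : nat) : expr := comp_index [seq Some i | i <- iota 0 k].

(* Tables are accumulated in place, which relies on unused arrays being zero. *)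
Definition accum (j k : nat) (E : tex) : cmd :=
  Set_ (tbl j) (out_index k) (Bin Add (Get (tbl j) (out_index k)) (comp E)).

Definition comp_stmt (j : nat) (s : stmt) : cmd :=
  nest 0 (out_ar s + sum_ar s) (accum j (out_ar s) (rhs s)).

Definition accum_cost (k : nat) (E : tex) : nat :=
  (ecost (out_index k) + ecost (Bin Add (Get 0 (out_index k)) (comp E))).+1.

Lemma absz_sum_le (X : eqType) (s : seq X) (f : X -> int) B :
  (forall x, x \in s -> absz (f x) <= B)%N ->
  (absz (\sum_(x <- s) f x)%R <= size s * B)%N.
Proof.
elim: s => [|x s IH] H; first by rewrite big_nil.
rewrite big_cons [size _]/= mulSn; have := H x (mem_head _ _).
have := IH (fun y ys => H y (mem_behead (s := x :: s) ys)).
move: (size s * B)%N (\sum_(y <- s) _) (f x) => p q r; lia.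
Qed.

Lemma size_words b r : size (words b r) = (b ^ r)%N.
Proof. by rewrite -(size_map (num b)) map_num size_iota. Qed.

Lemma words_cat b k1 k2 w1 w2 :
  w1 \in words b k1 -> w2 \in words b k2 -> w1 ++ w2 \in words b (k1 + k2).
Proof.
by rewrite !mem_words size_cat all_cat => /andP[/eqP-> ->] /andP[/eqP-> ->]; rewrite eqxx.
Qed.

Lemma words_cons b k x w : (x < b)%N -> w \in words b k -> x :: w \in words b k.+1.
Proof. by rewrite !mem_words /= eqSS => -> /andP[-> ->]. Qed.

Lemma map_aval_iota n (env : seq nat) k : (k <= size env)%N ->
  [seq aval n env o | o <- [seq Some i | i <- iota 0 k]] = take k env.
Proof.
move=> kE; rewrite -map_comp; apply: (@eq_from_nth _ 0%N).
  by rewrite size_map size_iota size_takel.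
rewrite size_map size_iota => i ik.
by rewrite (nth_map 0%N) ?size_iota // nth_iota //= add0n nth_take.
Qed.

Definition frame (j i0 : nat) (m m' : memory) : Prop :=
  forall a x, a != tbl j -> (forall i, (i0 <= i)%N -> a != var i) -> m' a x = m a x.

Lemma frame_holds n ts j i0 m m' :
  (size ts <= j)%N -> frame j i0 m m' -> holds n ts m -> holds n ts m'.
Proof.
move=> tsj fr [m0 mt]; split.
  by rewrite fr // => [|i _]; rewrite /tbl /var; lia.
move=> j' y jts yw; rewrite fr ?mt // => [|i _]; rewrite /tbl /var; lia.
Qed.

Section Nest.
Variables (W n K : nat) (ts : seq table) (k r0 : nat) (E : tex).
Hypothesis n_gt0 : (0 < n)%N.
Hypothesis bW : (n.+1 < W)%N.
Hypothesis kW : (n.+1 ^ k <= W)%N.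
Hypothesis K_gt0 : (0 < K)%N.
Hypothesis ts_K : bounded n K ts.
Hypothesis wfE : wf (unzip1 ts) (k + r0) E.
Let X := (n.+1 ^ (K * tsize E))%N.
Hypothesis XW : (X <= W)%N.
Let j := size ts.
Let term w i := if num n.+1 (take k w) == i then sem n ts w E else 0.

Lemma absz_term w i : w \in words n.+1 (k + r0) -> (absz (term w i) <= X)%N.
Proof.
rewrite mem_words => /andP[/eqP sw ltw].
rewrite /term; case: ifP => // _; apply: absz_sem => //.
by rewrite sw.
Qed.

Lemma runs_accum w m : w \in words n.+1 (k + r0) -> holds n ts m -> env_in w m ->
  (forall i, absz (m (tbl j) i) + X <= W)%N ->
  runs W (accum j k E) m (accum_cost k E) (fun m' =>
    (forall i, m' (tbl j) i = m (tbl j) i + term w i) /\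
    (forall a x, a != tbl j -> m' a x = m a x)).
Proof.
move=> ww hm em mW; have := ww; rewrite mem_words => /andP[/eqP sw ltw].
have m_n : m 0%N 0%N = n%:Z by case: hm.
have bW' := ltnW bW.
have kw : (k <= size w)%N by rewrite sw leq_addr.
have ev_i : eval W m (out_index k) = Some (num n.+1 (take k w))%:Z.
  rewrite (eval_index n_gt0 bW' m_n em ltw) ?map_aval_iota // ?size_map ?size_iota //.
  by rewrite all_map; apply/allP => i; rewrite mem_iota /= sw; lia.
have ev_E := eval_comp n_gt0 bW' m_n em ltw K_gt0 ts_K hm (E := E).
rewrite sw in ev_E; have {}ev_E := ev_E wfE XW.
have sE : (absz (sem n ts w E) <= X)%N by apply: absz_sem; rewrite ?sw.
apply: (@runs_set _ _ _ _ _ (num n.+1 (take k w)) (m (tbl j) (num n.+1 (take k w)) + sem n ts w E)) => //.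
  have := mW (num n.+1 (take k w)) => mWi.
  rewrite [LHS](_ : _ = if (if eval W m (out_index k) is Some (Posz i) then
    word W (m (tbl j) i) else None) is Some x then
    if eval W m (comp E) is Some y then word W (x + y) else None else None) //.
  by rewrite ev_i ev_E word_some ?word_some //; lia.
split=> [i|a x aj]; last by rewrite update_neq.
rewrite update_arr /term eq_sym; case: eqP => [->//|_]; by rewrite addr0.
Qed.

(** The subtracted 60 makes the time bound inductive: each of the n + 1 >= 2 rounds saves 60 steps,
    which pay for the loop and leave 60 again. The hypothesis on cells reserves room for all (n +
    1)^r additions still to come. *)
Lemma runs_nest r pre m : (size pre + r = k + r0)%N ->
  all (fun x => x < n.+1)%N pre -> holds n ts m -> env_in pre m ->
  (forall i, absz (m (tbl j) i) + n.+1 ^ r * X <= W)%N ->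
  runs W (nest (size pre) r (accum j k E)) m
    ((accum_cost k E + 60) * n.+1 ^ r - 60) (fun m' =>
    (forall i, m' (tbl j) i = m (tbl j) i + \sum_(w <- words n.+1 r) term (pre ++ w) i) /\
    frame j (size pre) m m').
Proof.
elim: r pre m => [|r IH] pre m spr ltp hm em mW.
  have ww : pre \in words n.+1 (k + r0) by rewrite mem_words ltp -spr addn0 eqxx.
  apply: (runs_conseq _ _ (runs_accum ww hm em _)) => [|m' [H1 H2]|i]; first lia.
    split=> [i|a x aj _]; last exact: H2.
    by rewrite H1 big_lists0 cats0.
  by have := mW i; rewrite mul1n.
have m_n : m 0%N 0%N = n%:Z by case: hm.
pose I x (m' : memory) :=
  (forall i, m' (tbl j) i = m (tbl j) i +
    \sum_(y <- iota 0 x) \sum_(w <- words n.+1 r) term (pre ++ y :: w) i) /\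
  frame j (size pre) m m'.
have nvar a : (forall i, (size pre <= i)%N -> a != var i) -> a != var (size pre).
  by apply.
have := @runs_for W (var (size pre)) exp_b (nest (size pre).+1 r (accum j k E)) n.+1
  ((accum_cost k E + 60) * n.+1 ^ r - 60) I bW.
move=> H; apply: (runs_conseq _ _ (H _ _ _ m _)).
- rewrite [ecost exp_b]/= expnS.
  have : (1 <= n.+1 ^ r)%N by rewrite expn_gt0.
  move: (n.+1 ^ r)%N (accum_cost k E) => p q; nia.
- move=> m' [H1 H2]; split=> // i.
  rewrite H1; congr (_ + _).
  by rewrite [RHS]big_listsS.
- move=> x m1 y _ [H1 H2]; split=> [i|a z aj av].
    by rewrite update_neq ?H1 // /tbl /var; lia.
  rewrite update_neq ?H2 //; exact: nvar.
- move=> x m1 _ [H1 H2]; apply: eval_b => //; first exact: ltnW.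
  by rewrite H2 // => [|i _]; rewrite /tbl /var; lia.
- move=> x m1 xb [H1 H2] m1x.
  have em1 : env_in (rcons pre x) m1.
    move=> i; rewrite size_rcons nth_rcons ltnS leq_eqVlt => /predU1P[->|ip].
      by rewrite ltnn eqxx m1x.
    rewrite ip H2 ?em // => [|i' i'p]; rewrite /tbl /var; lia.
  have hm1 : holds n ts m1 := frame_holds (leqnn _) H2 hm.
  have := IH (rcons pre x) m1; rewrite size_rcons => /(_ _ _ hm1 em1) H3.
  apply: (runs_conseq _ _ (H3 _ _ _)) => //.
  + move=> m2 [H4 H5]; split.
      rewrite H5 ?m1x // => [|i ip]; rewrite /tbl /var; lia.
    split=> [i|a z aj av].
      rewrite H4 H1 -[in X in _ = X]addn1 iotaD big_cat big_seq1 add0n /= addrA.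
      by congr (_ + _); apply: eq_bigr => w _; rewrite cat_rcons.
    by rewrite H5 ?H2 // => i ip; apply: av; apply: ltnW.
  + by rewrite addSnnS.
  + by rewrite all_rcons xb.
  (* The x finished blocks have used at most x (n + 1)^r of the reserved additions; as x <= n, one
     more block fits. *)
  + move=> i; rewrite H1.
    have := mW i; rewrite expnS.
    have : (absz (\sum_(y <- iota 0 x) \sum_(w <- words n.+1 r) term (pre ++ y :: w) i)%R
             <= x * (n.+1 ^ r * X))%N.
      rewrite -[X in (_ <= X * _)%N](size_iota 0 x); apply: absz_sum_le => y.
      rewrite mem_iota /= add0n => yx; rewrite -[X in (_ <= X * _)%N]size_words.
      apply: absz_sum_le => w ww; apply: absz_term; rewrite -spr.
      apply: words_cat; first by rewrite mem_words eqxx.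
      by apply: words_cons => //; apply: ltn_trans xb.
    have : (x.+1 * (n.+1 ^ r * X) <= n.+1 * n.+1 ^ r * X)%N by rewrite -mulnA leq_mul2r xb orbT.
    by rewrite mulSn; lia.
- split=> [i|a x _ _ //]; by rewrite big_nil addr0.
Qed.
End Nest.

Definition fresh (ts : seq table) (m : memory) : Prop :=
  forall j i, (size ts <= j)%N -> m (tbl j) i = 0.

Definition good (n K : nat) (ts : seq table) (m : memory) : Prop :=
  [/\ holds n ts m, bounded n K ts & fresh ts m].

Definition stmt_exp (K : nat) (s : stmt) : nat :=
  (out_ar s + sum_ar s + K * tsize (rhs s) + K)%N.

Definition stmt_cost (s : stmt) : nat := (accum_cost (out_ar s) (rhs s) + 60)%N.

Definition keeps (m m' : memory) : Prop := forall a x, (a < 4)%N -> m' a x = m a x.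

Lemma bounded_rcons n K K' ts T : (K <= K')%N -> bounded n K ts ->
  (T.1 <= K')%N -> (forall y, y \in words n.+1 T.1 -> absz (T.2 y) <= n.+1 ^ K')%N ->
  bounded n K' (rcons ts T).
Proof.
move=> KK' bK T1 T2 j; rewrite size_rcons nth_rcons ltnS leq_eqVlt => /predU1P[->|jts].
  by rewrite ltnn eqxx.
rewrite jts; have [H1 H2] := bK j jts; split; first exact: leq_trans H1 KK'.
by move=> y yw; apply: leq_trans (H2 y yw) _; apply: leq_pexp2l.
Qed.

Lemma runs_stmt W n K ts s m : (0 < n)%N -> (0 < K)%N -> good n K ts m ->
  wf (unzip1 ts) (out_ar s + sum_ar s) (rhs s) -> (n.+1 ^ stmt_exp K s <= W)%N ->
  runs W (comp_stmt (size ts) s) m (stmt_cost s * n.+1 ^ (out_ar s + sum_ar s)) (fun m' =>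
    good n (stmt_exp K s) (rcons ts (sem_stmt n ts s)) m' /\ keeps m m').
Proof.
move=> n0 K0 [hm bm fm]; case: s => k r0 E /= wE; rewrite /stmt_exp /= => leW.
have b1 : (1 < n.+1)%N by [].
have Ks : (0 < K * tsize E)%N by rewrite muln_gt0 K0 tsize_gt0.
have expW x : (x <= k + r0 + K * tsize E + K)%N -> (n.+1 ^ x <= W)%N.
  by move=> lex; apply: leq_trans leW; rewrite leq_exp2l.
have := @runs_nest W n K ts k r0 E n0 _ _ K0 bm wE _ (k + r0)%N [::] m erefl erefl hm.
move=> H; apply: (runs_conseq _ _ (H _ _ _ _ _)) => //.
- by rewrite /stmt_cost /=; lia.
- move=> m' /= [H1 H2]; split; last first.
    by move=> a x a4; apply: H2 => [|i _]; rewrite /tbl /var; lia.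
  split.
  + have [h0 h1] := frame_holds (leqnn _) H2 hm; split=> // j y.
    rewrite size_rcons nth_rcons ltnS leq_eqVlt => /predU1P[->|jts]; last first.
      by rewrite jts; apply: h1.
    rewrite ltnn eqxx /= => yw.
    (* The cell of [y] starts at zero and, [num] being injective, receives only the terms of words
       with prefix [y]. *)
    rewrite H1 fm // add0r big_lists_cat (bigD1_seq y) ?uniq_words //=.
    have take_w u v : u \in words n.+1 k -> take k (u ++ v) = u.
      by rewrite mem_words => /andP[/eqP su _]; rewrite -su take_size_cat.
    rewrite [X in _ + X]big1_seq ?addr0 => [|u /andP[uy uw]]; last first.
      have {}uw : u \in words n.+1 k by [].
      apply: big1 => v _; rewrite take_w // ifN //.
      by apply: contra uy => /eqP/(num_inj uw yw) ->.
    by apply: eq_bigr => v _; rewrite take_w // eqxx.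
  + apply: (bounded_rcons _ bm) => //=; [lia|lia|].
    move=> y yw; apply: (@leq_trans (n.+1 ^ r0 * n.+1 ^ (K * tsize E))%N).
      rewrite -size_words; apply: absz_sum_le => x xw; apply: absz_sem => //.
        by have := words_cat yw xw; rewrite mem_words => /andP[].
      by have := words_cat yw xw; rewrite mem_words => /andP[/eqP ->].
    by rewrite -expnD leq_exp2l //; lia.
  + move=> j i; rewrite size_rcons => jts; rewrite H2 ?fm //.
    * exact: ltnW.
    * by rewrite /tbl; lia.
    * by move=> i' _; rewrite /tbl /var; lia.
- apply: leq_trans (expW 2%N _); last lia.
  by rewrite expnS expn1; nia.
- by apply: expW; lia.
- by apply: expW; lia.
- by move=> i; rewrite fm //= add0n -expnD; apply: expW; lia.
Qed.

Fixpoint comp_prog (j : nat) (ss : seq stmt) : cmd :=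
  if ss is s :: ss' then Seq (comp_stmt j s) (comp_prog j.+1 ss') else Skip.

Fixpoint sem_prog (n : nat) (ts : seq table) (ss : seq stmt) : seq table :=
  if ss is s :: ss' then sem_prog n (rcons ts (sem_stmt n ts s)) ss' else ts.

Fixpoint wf_prog (ar : seq nat) (ss : seq stmt) : bool :=
  if ss is s :: ss' then
    wf ar (out_ar s + sum_ar s) (rhs s) && wf_prog (rcons ar (out_ar s)) ss'
  else true.

Fixpoint prog_exp (K : nat) (ss : seq stmt) : nat :=
  if ss is s :: ss' then prog_exp (stmt_exp K s) ss' else K.

Definition prog_cost (ss : seq stmt) : nat := (sumn (map stmt_cost ss)).+1.

Lemma prog_exp_ge K ss : (K <= prog_exp K ss)%N.
Proof.
by elim: ss K => //= s ss IH K; apply: leq_trans (IH _); rewrite /stmt_exp leq_addl.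
Qed.

Lemma runs_prog W n K D ts ss m : (0 < n)%N -> (0 < K)%N -> good n K ts m ->
  wf_prog (unzip1 ts) ss -> (n.+1 ^ prog_exp K ss <= W)%N ->
  all (fun s => out_ar s + sum_ar s <= D)%N ss ->
  runs W (comp_prog (size ts) ss) m (prog_cost ss * n.+1 ^ D) (fun m' =>
    good n (prog_exp K ss) (sem_prog n ts ss) m' /\ keeps m m').
Proof.
move=> n0; elim: ss K ts m => [|s ss IH] K ts m K0 gm.
  move=> _ leW _; exists m, 1%N; split=> //; first by constructor.
  by rewrite mul1n expn_gt0.
move=> /= /andP[ws wss] leW /andP[sD ssD].
have sW : (n.+1 ^ stmt_exp K s <= W)%N.
  by apply: leq_trans leW; rewrite leq_exp2l // prog_exp_ge.
have := runs_stmt n0 K0 gm ws sW => H1.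
have := runs_seq H1 => H2.
apply: (runs_conseq (k := stmt_cost s * n.+1 ^ (out_ar s + sum_ar s) + prog_cost ss * n.+1 ^ D) _ _ (H2 _ _ _ _)).
- rewrite /prog_cost /= -addnS mulnDl; apply: leq_add; last by [].
  by rewrite leq_mul2l leq_exp2l // sD orbT.
- by move=> m'; apply.
- move=> m1 [gm1 km1].
  have := IH (stmt_exp K s) (rcons ts (sem_stmt n ts s)) m1.
  rewrite size_rcons => H.
  apply: (runs_conseq _ _ (H _ _ _ _ _)) => //.
  + move=> m2 [gm2 km2]; split=> // a x a4; by rewrite km2 ?km1.
  + by rewrite /stmt_exp; lia.
  + by move: wss; rewrite /unzip1 map_rcons.
Qed.

(** * Products of tables by matrix multiplication *)

(** Hence the same list of cells is both the N x M factor and the M x N factor. *)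
Lemma row_major_mkseq (p q : nat) (g : nat -> int) :
  row_major (\matrix_(i < p, j < q) g (i * q + j)%N) = mkseq g (p * q).
Proof.
rewrite /row_major.
transitivity [seq g (i * q + j)%N | i <- iota 0 p, j <- iota 0 q].
  rewrite -!val_enum_ord allpairs_mapl allpairs_mapr.
  by apply: eq_allpairs => // i j; rewrite mxE.
rewrite /mkseq; elim: p => // p IH.
rewrite -[in LHS]addn1 iotaD allpairs_cat IH /= cats0 add0n mulSn addnC iotaD map_cat.
congr cat; rewrite add0n -[X in _ = map g (iota X _)]addn0 iotaDl -map_comp.
by apply: eq_map => i.
Qed.

Definition exp_pow (k : nat) : expr := iter k (fun e => Bin Mul e exp_b) (Cst 1).

Lemma eval_pow W n m k : (0 < n)%N -> (n.+1 < W)%N -> m 0%N 0%N = n%:Z ->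
  (n.+1 ^ k <= W)%N -> eval W m (exp_pow k) = Some (n.+1 ^ k)%:Z.
Proof.
move=> n0 bW m0; elim: k => [|k IH] kW.
  by rewrite /= word_some //; apply: leq_trans bW.
have kW' : (n.+1 ^ k <= W)%N by apply: leq_trans kW; rewrite leq_exp2l.
rewrite [LHS](_ : _ = if eval W m (exp_pow k) is Some x then
  if eval W m exp_b is Some y then word W (x * y) else None else None) //.
by rewrite (IH kW') (eval_b n0 (ltnW bW) m0) -PoszM expnSr word_some // absz_nat -expnSr.
Qed.

(** Two copies, as the arrays passed to a call must be distinct and may be overwritten by it. *)
Definition copy_cmd (f q : nat) : cmd :=
  let v := Get (var 0) (Cst 0) in
  for_ (var 0) (exp_pow q) (Seq (Set_ 2 v (Get (tbl f) v)) (Set_ 3 v (Get (tbl f) v))).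

Lemma runs_copy W n f q m (g : nat -> int) : (0 < n)%N -> (n.+1 < W)%N -> m 0%N 0%N = n%:Z ->
  (n.+1 ^ q < W)%N ->
  (forall i, (i < n.+1 ^ q)%N -> m (tbl f) i = g i /\ (absz (g i) <= W)%N) ->
  (forall i, m 2%N i = 0) -> (forall i, m 3%N i = 0) ->
  runs W (copy_cmd f q) m ((2 * ecost (exp_pow q) + 60) * n.+1 ^ q) (fun m' =>
    [/\ forall i, m' 2%N i = if (i < n.+1 ^ q)%N then g i else 0,
        forall i, m' 3%N i = if (i < n.+1 ^ q)%N then g i else 0 &
        forall (a : nat) x, a != 2%N -> a != 3%N -> a != var 0 -> m' a x = m a x]).
Proof.
move=> n0 bW m0 qW mg m2 m3.
pose I x (m' : memory) :=
    [/\ forall i, m' 2%N i = if (i < x)%N then g i else 0,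
        forall i, m' 3%N i = if (i < x)%N then g i else 0 &
        forall (a : nat) x, a != 2%N -> a != 3%N -> a != var 0 -> m' a x = m a x].
have H := @runs_for W (var 0) (exp_pow q)
  (let v := Get (var 0) (Cst 0) in
   Seq (Set_ 2 v (Get (tbl f) v)) (Set_ 3 v (Get (tbl f) v)))
  (n.+1 ^ q) 12 I qW.
apply: (runs_conseq _ _ (H _ _ _ m _)).
- have : (1 <= n.+1 ^ q)%N by rewrite expn_gt0.
  move: (n.+1 ^ q)%N (ecost _) => x y; nia.
- by move=> m'.
- move=> x m1 y _ [H1 H2 H3]; split=> [i|i|a z a2 a3 av].
  + by rewrite update_neq.
  + by rewrite update_neq.
  + by rewrite update_neq // H3.
- move=> x m1 _ [H1 H2 H3]; apply: eval_pow => //; last exact: ltnW.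
  by rewrite H3.
- move=> x m1 xq [H1 H2 H3] m1x.
  have xW : (x <= W)%N by apply: leq_trans (ltnW xq) (ltnW qW).
  have [mgx gW] := mg x xq.
  have ev m' : m' (var 0) 0%N = x%:Z -> eval W m' (Get (var 0) (Cst 0)) = Some x%:Z.
    by move=> m'x; rewrite /= /word /= m'x /= xW.
  have ev2 m' : m' (var 0) 0%N = x%:Z -> m' (tbl f) x = g x ->
      eval W m' (Get (tbl f) (Get (var 0) (Cst 0))) = Some (g x).
    move=> m'x m'f.
    rewrite [LHS](_ : _ = if eval W m' (Get (var 0) (Cst 0)) is Some (Posz i) then
      word W (m' (tbl f) i) else None) //.
    by rewrite ev // m'f word_some.
  have f2 : tbl f != 2%N by rewrite /tbl; lia.
  have f3 : tbl f != 3%N by rewrite /tbl; lia.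
  have fv : tbl f != var 0 by rewrite /tbl /var; lia.
  pose m2' := update m1 2 x (g x).
  have m2x : m2' (var 0) 0%N = x%:Z by rewrite /m2' update_neq.
  apply: (@runs_seq _ _ _ _ 6 6 (fun m' => m' = m2')).
    apply: runs_set; [exact: ev|apply: ev2|] => //.
    by rewrite H3.
  move=> _ ->; apply: runs_set; [exact: ev|apply: ev2|] => //.
    by rewrite /m2' update_neq // H3.
  rewrite update_neq //; split=> //; split=> [i|i|a z a2 a3 av].
  + rewrite update_neq // /m2' update_arr H1 [(i < x.+1)%N]ltnS.
    by rewrite [(i <= x)%N]leq_eqVlt; case: eqP => [->|].
  + rewrite update_arr /m2' update_neq // H2 [(i < x.+1)%N]ltnS.
    by rewrite [(i <= x)%N]leq_eqVlt; case: eqP => [->|].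
  + by rewrite /m2' !update_neq // H3.
- split=> [i|i|//]; [exact: m2|exact: m3].
Qed.

Lemma words_take b k1 k2 y : y \in words b (k1 + k2) -> take k1 y \in words b k1.
Proof.
rewrite !mem_words => /andP[/eqP sy /allP ally]; rewrite size_takel ?sy ?leq_addr // eqxx.
by apply/allP => x /mem_take /ally.
Qed.

Lemma words_drop b k1 k2 y : y \in words b (k1 + k2) -> drop k1 y \in words b k2.
Proof.
rewrite !mem_words => /andP[/eqP sy /allP ally]; rewrite size_drop sy addKn eqxx.
by apply/allP => x /mem_drop /ally.
Qed.

Definition mul_table (n q l : nat) (g : seq nat -> int) : table :=
  (((q - l) + (q - l))%N, fun y =>
     \sum_(i <- words n.+1 l) g (take (q - l) y ++ i) * g (i ++ drop (q - l) y)).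

(** Array 0 of the callee holds the dimensions at entry and the product at exit. The fresh table [j]
    plays both roles, so the product is in place after the call. *)
Definition mm_cmd (P : cmd) (f q l j : nat) : cmd :=
  Seq (copy_cmd f q)
    (Seq (Set_ (tbl j) (Cst 0) (exp_pow (q - l)))
       (Seq (Set_ (tbl j) (Cst 1) (exp_pow l))
          (Call [:: tbl j; 2; 3] P))).

(** With N, M and the entries at most (n + 1)^K, their sum is at most (n + 1)^(K + 2); this gives
    the word bound of the callee. The entries of the product need l + 2K <= 3K. *)
Definition mm_exp (Km K : nat) : nat := (Km + (K + 2) * Km + 3 * K + 2)%N.

Definition mm_cost (q l : nat) : nat :=
  (2 * ecost (exp_pow q) + 60 + ecost (exp_pow (q - l)) + ecost (exp_pow l) + 8)%N.

Definition multiplies (R : realType) (P : cmd) (Km : nat) (cost : nat -> nat -> R) : Prop :=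
  forall (N M H : nat) (A : 'M[int]_(N, M)) (B : 'M[int]_(M, N)),
    (0 < N)%N -> (0 < M)%N -> (M <= N)%N ->
    (forall i j, (absz (A i j) <= H)%N) ->
    (forall i j, (absz (B i j) <= H)%N) ->
    exists (m' : memory) (k : nat),
      [/\ exec (Km * (N + M + H) ^ Km)
            P (load [:: [:: N%:Z; M%:Z]; row_major A; row_major B]) m' k,
          forall i j : 'I_N, m' 0%N (i * N + j)%N = (A *m B) i j
        & k%:R <= cost N M].

Section MatrixProduct.
Variables (R : realType) (P : cmd) (Km : nat) (cost : nat -> nat -> R).
Hypothesis HP : multiplies P Km cost.

(** Not phrased with [runs], since the cost of the product is a real number. The hypothesis on [l]
    makes the left factor at least as tall as it is wide. *)
Lemma run_mm W n K ts f q l m : (0 < n)%N -> (0 < K)%N -> good n K ts m ->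
  (f < size ts)%N -> (nth table0 ts f).1 = q -> (l <= q - l)%N ->
  (forall i, m 2%N i = 0) -> (forall i, m 3%N i = 0) ->
  (n.+1 ^ mm_exp Km K <= W)%N ->
  exists m' k, [/\ exec W (mm_cmd P f q l (size ts)) m m' k,
    good n (mm_exp Km K) (rcons ts (mul_table n q l (nth table0 ts f).2)) m' &
    k%:R <= (mm_cost q l * n.+1 ^ q)%:R + cost (n.+1 ^ (q - l)) (n.+1 ^ l) ].
Proof.
move=> n0 K0 [hm bm fm] fts fq lq m2 m3 leW.
have b1 : (1 < n.+1)%N by [].
have [qK gK] := bm f fts; rewrite fq in qK gK.
set gt := (nth table0 ts f).2 in gK *.
have expW x : (x <= mm_exp Km K)%N -> (n.+1 ^ x <= W)%N.
  by move=> lex; apply: leq_trans leW; rewrite leq_exp2l.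
have lq' : (l <= q)%N by lia.
pose g i := m (tbl f) i.
have gE y : y \in words n.+1 q -> g (num n.+1 y) = gt y.
  by rewrite -fq => yw; case: hm => _ /(_ f y fts yw).
have gb i : (i < n.+1 ^ q)%N -> (absz (g i) <= n.+1 ^ K)%N.
  by move=> /num_surj[y yw ->]; rewrite gE // gK.
have bW : (n.+1 < W)%N.
  by apply: leq_trans (expW 2%N _); rewrite /mm_exp; [rewrite expnS expn1; nia|lia].
have m_n : m 0%N 0%N = n%:Z by case: hm.
set N := (n.+1 ^ (q - l))%N; set M := (n.+1 ^ l)%N.
have NM : (N * M = n.+1 ^ q)%N by rewrite -expnD subnK.
have [m1 [k1 [E1 k1k [H2 H3 H4]]]] : runs W (copy_cmd f q) m ((2 * ecost (exp_pow q) + 60) * n.+1 ^ q) (fun m' =>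
    [/\ forall i, m' 2%N i = if (i < n.+1 ^ q)%N then g i else 0,
        forall i, m' 3%N i = if (i < n.+1 ^ q)%N then g i else 0 &
        forall (a : nat) x, a != 2%N -> a != 3%N -> a != var 0 -> m' a x = m a x]).
  apply: runs_copy => //.
    by apply: leq_trans (expW q.+1 _); rewrite ?ltn_exp2l // /mm_exp; lia.
  by move=> i iq; split=> //; apply: leq_trans (gb i iq) (expW _ _); rewrite /mm_exp; lia.
have tblj a : (tbl a != 2%N) && (tbl a != 3%N) && (tbl a != var 0) by rewrite /tbl /var; lia.
have tblm1 a x : m1 (tbl a) x = m (tbl a) x.
  by case/andP: (tblj a) => /andP[h1 h2] h3; rewrite H4.
have m1n : m1 0%N 0%N = n%:Z by rewrite H4.
have NW : (N <= W)%N by apply: expW; rewrite /mm_exp; lia.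
have MW : (M <= W)%N by apply: expW; rewrite /mm_exp; lia.
have b1W : (1 <= W)%N by apply: leq_trans bW.
pose m2' := update m1 (tbl (size ts)) 0 N%:Z.
pose m3' := update m2' (tbl (size ts)) 1 M%:Z.
pose A : 'M[int]_(N, M) := \matrix_(i < N, j < M) g (i * M + j)%N.
pose B : 'M[int]_(M, N) := \matrix_(i < M, j < N) g (i * N + j)%N.
have idx_lt p r (i : 'I_p) (j : 'I_r) : (i * r + j < p * r)%N.
  have := ltn_ord i; have := ltn_ord j; move: (nat_of_ord i) (nat_of_ord j) => x y; nia.
have [m4 [k4 [E4 H5 k4c]]] : exists (m' : memory) (k : nat),
      [/\ exec (Km * (N + M + n.+1 ^ K) ^ Km)
            P (load [:: [:: N%:Z; M%:Z]; row_major A; row_major B]) m' k,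
          forall i j : 'I_N, m' 0%N (i * N + j)%N = (A *m B) i j
        & k%:R <= cost N M].
  apply: HP; rewrite ?expn_gt0 ?leq_exp2l //.
    by move=> i j; rewrite mxE gb // -NM.
  by move=> i j; rewrite mxE gb // -NM [(N * M)%N]mulnC.
(* Past its first two cells the array of the dimensions is still zero, so the callee starts from a
   properly loaded input. *)
have enterE : call_enter [:: tbl (size ts); 2; 3]%N m3' =
    load [:: [:: N%:Z; M%:Z]; row_major A; row_major B].
  rewrite !row_major_mkseq [(M * N)%N]mulnC NM.
  apply/funext => a; apply/funext => x; rewrite /call_enter /load.
  have tbl23 : (3 != tbl (size ts))%N && (2 != tbl (size ts))%N by rewrite /tbl; lia.
  case/andP: tbl23 => t3 t2.
  case: a => [|[|[|a]]] /=; last by rewrite !nth_nil.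
  - rewrite /m3' /m2' !update_arr; case: x => [|[|x]] //=.
    by rewrite tblm1 fm // nth_nil.
  - rewrite /m3' /m2' !update_neq // H2; case: ltnP => xq; first by rewrite nth_mkseq.
    by rewrite nth_default // size_mkseq.
  - rewrite /m3' /m2' !update_neq // H3; case: ltnP => xq; first by rewrite nth_mkseq.
    by rewrite nth_default // size_mkseq.
have WP : (Km * (N + M + n.+1 ^ K) ^ Km <= W)%N.
  apply: leq_trans (expW (Km + (K + 2) * Km)%N _); last by rewrite /mm_exp; lia.
  rewrite expnD [(n.+1 ^ (_ * _))%N]expnM; apply: leq_mul; first exact/ltnW/ltn_expl.
  have [->//|Km0] := posnP Km; rewrite leq_exp2r // addn2 !expnS.
  have NK : (N <= n.+1 ^ K)%N by rewrite leq_exp2l //; lia.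
  have MK : (M <= n.+1 ^ K)%N by rewrite leq_exp2l //; lia.
  by move: NK MK; move: (n.+1 ^ K)%N => B' NK MK; nia.
exists (call_leave [:: tbl (size ts); 2; 3]%N m3' m4).
eexists; split.
- apply: ExecSeq E1 _; apply: ExecSeq.
    apply: ExecSet; first by rewrite /= word_some.
    exact: (eval_pow n0 bW m1n NW).
  apply: ExecSeq.
    apply: ExecSet; first by rewrite /= word_some.
    by apply: (eval_pow (k := l) n0 bW _ MW); rewrite update_neq ?m1n // /tbl; lia.
  rewrite -/N -/M -/m2' -/m3'; apply: ExecCall; first by rewrite /= !inE /tbl; lia.
  by rewrite enterE; apply: exec_le WP E4.
- have ltN y : y \in words n.+1 (q - l) -> (num n.+1 y < N)%N by apply: num_lt.
  have leave_tbl a x : (a != size ts)%N ->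
      call_leave [:: tbl (size ts); 2; 3]%N m3' m4 (tbl a) x = m (tbl a) x.
    move=> ats; rewrite /call_leave ifN; last by rewrite !inE /tbl; lia.
    by rewrite /m3' /m2' !update_neq ?tblm1 // /tbl; lia.
  split.
  + split.
      rewrite /call_leave ifN; last by rewrite !inE /tbl; lia.
      by rewrite /m3' /m2' !update_neq // /tbl; lia.
    move=> a y; rewrite size_rcons nth_rcons ltnS leq_eqVlt => /predU1P[->|ats]; last first.
      by rewrite ats leave_tbl; [case: hm => _; apply|lia].
    rewrite ltnn eqxx /= => yw.
    rewrite /call_leave mem_head /= eqxx.
    rewrite -{1}(cat_take_drop (q - l) y).
    have y1 : take (q - l) y \in words n.+1 (q - l).
      exact: words_take yw.
    have y2 : drop (q - l) y \in words n.+1 (q - l).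
      exact: words_drop yw.
    rewrite num_cat; have := y2; rewrite mem_words => /andP[/eqP -> _].
    rewrite (H5 (Ordinal (ltN _ y1)) (Ordinal (ltN _ y2))) mxE.
    transitivity (\sum_(j < n.+1 ^ l) (g (num n.+1 (take (q - l) y) * M + j)%N *
                                      g (j * N + num n.+1 (drop (q - l) y))%N)).
      by apply: eq_bigr => j _; rewrite ?mxE.
    rewrite -(sum_num n.+1 l (fun j => g (num n.+1 (take (q - l) y) * M + j)%N *
                                      g (j * N + num n.+1 (drop (q - l) y))%N)).
    rewrite big_seq [RHS]big_seq; apply: eq_bigr => w ww.
    have sw : size w = l by move: ww; rewrite mem_words => /andP[/eqP].
    have sd : size (drop (q - l) y) = (q - l)%N.
      by move: y2; rewrite mem_words => /andP[/eqP].
    rewrite -gE; last by rewrite -[q in words _ q](subnK lq'); apply: words_cat.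
    rewrite -gE; last by rewrite -[q in words _ q](subnKC lq'); apply: words_cat.
    by rewrite !num_cat sw sd.
  + apply: (bounded_rcons _ bm) => /=; [rewrite /mm_exp; lia|rewrite /mm_exp; lia|].
    move=> y yw.
    have y1 : take (q - l) y \in words n.+1 (q - l).
      exact: words_take yw.
    have y2 : drop (q - l) y \in words n.+1 (q - l).
      exact: words_drop yw.
    apply: (@leq_trans (n.+1 ^ l * (n.+1 ^ K * n.+1 ^ K))%N).
      rewrite -size_words; apply: absz_sum_le => w ww; rewrite abszM; apply: leq_mul.
        by apply: gK; rewrite -[q in words _ q](subnK lq'); apply: words_cat.
      by apply: gK; rewrite -[q in words _ q](subnKC lq'); apply: words_cat.
    by rewrite -!expnD leq_exp2l // /mm_exp; lia.
  + move=> a x; rewrite size_rcons => ats; rewrite leave_tbl; last lia.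
    by rewrite fm // ltnW.
-  have c3 : (k1 + ((ecost (Cst 0) + ecost (exp_pow (q - l))).+1 +
     ((ecost (Cst 1) + ecost (exp_pow l)).+1 + (3 + k4).+1)) <= mm_cost q l * n.+1 ^ q + k4)%N.
    have : (1 <= n.+1 ^ q)%N by rewrite expn_gt0.
    move: k1k; rewrite /mm_cost /= ?[ecost (Cst _)]/=.
    move: (n.+1 ^ q)%N (ecost (exp_pow q)) (ecost (exp_pow (q - l))) (ecost (exp_pow l)).
    by move=> x y z u; nia.
  apply: le_trans (_ : (mm_cost q l * n.+1 ^ q + k4)%N%:R <= _).
    by rewrite ler_nat.
  by rewrite natrD lerD2l.
Qed.
End MatrixProduct.

(** * Reading the family *)

Definition input_index (s : nat) : expr :=
  horner_exp [seq Get 1 (Bin Add (Bin Mul (Get (var 0) (Cst 0)) (Cst s%:Z)) (Cst j%:Z)) | j <- iota 0 s].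

Definition input_cmd (s : nat) : cmd :=
  for_ (var 0) (Get 0 (Cst 3)) (Set_ (tbl 0) (input_index s) (Cst 1)).

(** Only the listed order of a member is marked, not its s! rearrangements, so that a tuple of
    members corresponds to a single word. *)
Definition member_table (s : nat) (L : seq (seq nat)) : table := (s, fun y => (y \in L)%:Z).

Lemma nth_flatten_const (X : Type) (x0 : X) s (L : seq (seq X)) i j :
  all (fun l => size l == s) L -> (j < s)%N -> (i < size L)%N ->
  nth x0 (flatten L) (i * s + j) = nth x0 (nth [::] L i) j.
Proof.
move=> + js; elim: L i => // l L IH [|i] /= /andP[/eqP sl sL] iL.
  by rewrite nth_cat sl js.
rewrite nth_cat sl mulSn ifN; last by rewrite -leqNgt; lia.
by rewrite -addnA addKn; apply: IH.
Qed.

Lemma nth_inj_seq (X : Type) (x0 : X) (s1 s2 : seq X) k :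
  size s1 = k -> size s2 = k -> (forall i, (i < k)%N -> nth x0 s1 i = nth x0 s2 i) -> s1 = s2.
Proof. by move=> z1 z2 H; apply: (eq_from_nth (x0 := x0)); rewrite z1 ?z2. Qed.

Lemma runs_input W n s t (L : seq (seq 'I_n)) : (0 < n)%N -> (0 < s)%N ->
  let L' := map (map val) L in
  all (fun l => size l == s) L -> uniq L' -> (n.+1 ^ (2 * s + 3) <= W)%N ->
  runs W (input_cmd s) (family_input s t L) ((ecost (input_index s) + 30) * n.+1 ^ s) (fun m' =>
    good n s [:: member_table s L'] m' /\ keeps (family_input s t L) m').
Proof.
move=> n0 s0 L' sL uL leW; set m := family_input s t L.
have b1 : (1 < n.+1)%N by [].
have expW x : (x <= 2 * s + 3)%N -> (n.+1 ^ x <= W)%N.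
  by move=> lex; apply: leq_trans leW; rewrite leq_exp2l.
have sL' : all (fun l => size l == s) L'.
  by rewrite all_map; apply: sub_all sL => l /=; rewrite size_map.
have L'w l : l \in L' -> l \in words n.+1 s.
  move=> lL'; rewrite mem_words (allP sL' l lL') /=.
  case/mapP: lL' => l0 _ ->; rewrite all_map; apply/allP => x _ /=.
  by apply: ltn_trans (ltn_ord x) _.
(* Distinct members are distinct words of length [s]; this bounds the number of rounds. *)
have sizeL : (size L <= n.+1 ^ s)%N.
  rewrite -size_words -(size_map (map val) L); exact: uniq_leq_size.
have sb : (s < n.+1 ^ s)%N by apply: ltn_expl.
have W3 : (4 <= W)%N.
  by apply: leq_trans (expW 2%N _); [rewrite expnS expn1; nia|lia].
have W1 : (size L * s + s < W)%N.
  apply: leq_trans (expW (s + s + 2)%N _); last lia.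
  rewrite !expnD; move: sizeL sb; move: (n.+1 ^ s)%N => p; rewrite expnS expn1 => h1 h2.
  have : (size L * s <= p * p)%N by apply: leq_mul => //; apply: ltnW.
  have : (p * p * 4 <= p * p * (n.+1 * n.+1))%N by rewrite leq_mul2l; apply/orP; right; nia.
  nia.
have bW : (n.+1 <= W)%N by rewrite -[X in (X <= _)%N]expn1; apply: expW; lia.
have m_n : m 0%N 0%N = n%:Z by [].
pose I x (m' : memory) := (forall i, m' (tbl 0) i = (i \in map (num n.+1) (take x L'))%:Z) /\
  (forall (a : nat) i, a != tbl 0 -> a != var 0 -> m' a i = m a i).
have NW : (size L < W)%N by move: W1; nia.
have H := @runs_for W (var 0) (Get 0 (Cst 3)) (Set_ (tbl 0) (input_index s) (Cst 1)) (size L)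
  (ecost (input_index s) + 2) I NW.
apply: (runs_conseq _ _ (H _ _ _ m _)).
- have : (1 <= n.+1 ^ s)%N by rewrite expn_gt0.
  move: sizeL; move: (n.+1 ^ s)%N (ecost _) (size L) => x y z /=; nia.
- move=> m' [H1 H2]; split; last by move=> a x a4; rewrite H2 // /tbl /var; lia.
  have sizeL' : size L = size L' by rewrite size_map.
  split.
  + split=> [|j y]; first by rewrite H2.
    rewrite ltnS leqn0 => /eqP -> yw.
    rewrite H1 sizeL' take_size /=; congr ((nat_of_bool _)%:Z).
    apply/mapP/idP => [[l lL' /(num_inj yw (L'w _ lL')) ->] //|yL'].
    by exists y.
  + move=> j; rewrite ltnS leqn0 => /eqP -> /=; split=> // y _.
    by case: (y \in L') => //; rewrite expn_gt0.
  + move=> j i /= j0; rewrite H2; [|rewrite /tbl; lia|rewrite /tbl /var; lia].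
    by rewrite /m /family_input /load [nth [::] _ _]nth_default ?nth_nil // /tbl /=; lia.
- move=> x m1 y _ [H1 H2]; split=> [i|a i a1 a2]; first by rewrite update_neq.
  by rewrite update_neq ?H2.
- move=> x m1 _ [H1 H2].
  rewrite [LHS](_ : _ = if word W 3 is Some (Posz i) then word W (m1 0%N i) else None) //.
  have -> : word W 3 = Some (Posz 3) by rewrite word_some //; apply: leq_trans W3.
  by rewrite H2 // word_some // ltnW.
- move=> x m1 xL [H1 H2] m1x.
  have xW : (x <= W)%N by apply: leq_trans (ltnW xL) (ltnW NW).
  have m1n : m1 0%N 0%N = n%:Z by rewrite H2.
  have xL' : (x < size L')%N by rewrite size_map.
  pose l := nth [::] L' x.
  have lL' : l \in L' by apply: mem_nth.
  have ev_i : eval W m1 (input_index s) = Some (num n.+1 l)%:Z.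
    apply: (eval_horner n0 bW m1n _ (L'w _ lL')); last by apply: expW; lia.
      have sl : size l = s by apply/eqP; apply: (allP sL').
      apply: (@nth_inj_seq _ None _ _ s); rewrite ?size_map ?size_iota // => j js.
      rewrite (nth_map (Cst 0)) ?size_map ?size_iota //.
      rewrite (nth_map 0%N) ?size_iota // nth_iota // add0n (nth_map 0%N) ?sl //.
      have h1 : (x * s + j < W)%N.
        by apply: leq_ltn_trans W1; move: xL js; nia.
      have h2 : (x * s <= W)%N by lia.
      rewrite [LHS](_ : _ = if (if (if eval W m1 (Get (var 0) (Cst 0)) is Some y then
         if word W s%:Z is Some z then word W (y * z) else None else None) is Some y then
         if word W j%:Z is Some z then word W (y + z) else None else None) is Some (Posz i)
         then word W (m1 1%N i) else None) //.
      have -> : eval W m1 (Get (var 0) (Cst 0)) = Some x%:Z by rewrite /= m1x word_some.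
      rewrite word_some; last by rewrite absz_nat; nia.
      rewrite -PoszM word_some // word_some; last by rewrite absz_nat; lia.
      rewrite -PoszD word_some; last by rewrite absz_nat ltnW.
      rewrite H2 // /m /family_input /load /=.
      have -> : [seq (nat_of_ord y)%:Z | y <- flatten L] = map Posz (flatten L').
        by rewrite /L' -map_flatten -map_comp.
      have -> : nth 0 (map Posz (flatten L')) (x * s + j) = (nth 0%N l j)%:Z.
        have [lt|ge] := ltnP (x * s + j) (size (flatten L')).
          by rewrite (nth_map 0%N) // (nth_flatten_const _ sL').
        rewrite nth_default ?size_map // -(nth_flatten_const _ sL') //.
        by rewrite nth_default.
      rewrite word_some // absz_nat.
      have := L'w _ lL'; rewrite mem_words => /andP[_ /all_nthP] /(_ 0%N j).
      by rewrite sl => /(_ js) lt; apply: leq_trans (ltnW lt) bW.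
  have ev_1 : eval W m1 (Cst 1) = Some 1 by rewrite /= word_some //; apply: leq_trans W3.
  apply: (runs_conseq (k := (ecost (input_index s) + ecost (Cst 1)).+1) _ _ (runs_set ev_i ev_1 _)) => [|m' H3|].
  + by rewrite /=; lia.
  + exact: H3.
  + split; first by rewrite update_neq.
    split=> [i|a i a1 a2]; last by rewrite update_neq // H2.
    rewrite update_arr H1 (take_nth [::]) // map_rcons mem_rcons inE.
    by case: eqP.
- split=> [i|//]; rewrite take0 /= /m /family_input /load /tbl.
  by rewrite nth_default ?nth_nil.
Qed.

(** * The counting identity *)

Definition inter_size (a b : seq nat) : nat := count (mem b) a.

Definition mixed_size (a b c : seq nat) : nat :=
  count (fun x => (x \in a) (+) (x \in b)) c.

Definition sgn_in (a : seq nat) (x : nat) : int := if x \in a then -1 else 1.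

(* [4 * (i + 1 - w)] is twice the difference of [|A + B + C| = 3q - 2w] and its value
   at [w = i + 1]. *)
Definition vanish (p w : nat) : int := \prod_(i < p) (4 * (i.+1%:Z - w%:Z)).

Lemma vanish_eq0 p w : (0 < w)%N -> (w <= p)%N -> vanish p w = 0.
Proof.
case: w => // w _ wp; rewrite /vanish (bigD1 (Ordinal wp)) //=.
by rewrite subrr mulr0 mul0r.
Qed.

Lemma vanish0_neq0 p : vanish p 0 != 0.
Proof. by apply/prodf_neq0 => i _; rewrite subr0. Qed.

Lemma count_iota_mem n (P : pred nat) a : uniq a -> all (fun x => x < n)%N a ->
  count (fun x => (x \in a) && P x) (iota 0 n) = count P a.
Proof.
move=> ua lta.
have pa : perm_eq [seq x <- iota 0 n | x \in a] a.
  apply: uniq_perm => //; first exact/filter_uniq/iota_uniq.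
  move=> x; rewrite mem_filter mem_iota /= add0n.
  by case xa: (x \in a) => //=; apply: (allP lta).
rewrite -(permP pa) count_filter; apply: eq_count => x /=; exact: andbC.
Qed.

(** For bits, (1 - 2a)(1 - 2b)(1 - 2c) = 1 - 2(a + b + c) + 4(ab + c (a xor b)). Summed over the
    ground set, the last bracket becomes w; so the sum of the triple signs is affine in w. *)
Lemma sum_sgn_in_seq (s a b c : seq nat) :
  \sum_(x <- s) sgn_in a x * sgn_in b x * sgn_in c x =
  (size s)%:Z - 2 * ((count (mem a) s)%:Z + (count (mem b) s)%:Z + (count (mem c) s)%:Z)
  + 4 * ((count (fun x => (x \in a) && (x \in b)) s)%:Z +
         (count (fun x => (x \in c) && ((x \in a) (+) (x \in b))) s)%:Z).
Proof.
elim: s => [|x s IH]; first by rewrite big_nil.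
rewrite big_cons IH /= /sgn_in !PoszD.
by case: (x \in a); case: (x \in b); case: (x \in c) => /=; lia.
Qed.

Lemma sum_sgn_in n q (a b c : seq nat) :
  uniq a -> uniq b -> uniq c -> all (fun x => x < n)%N a -> all (fun x => x < n)%N b ->
  all (fun x => x < n)%N c -> size a = q -> size b = q -> size c = q ->
  \sum_(x <- iota 0 n) sgn_in a x * sgn_in b x * sgn_in c x =
  n%:Z - 6 * q%:Z + 4 * (inter_size a b + mixed_size a b c)%:Z.
Proof.
move=> ua ub uc la lb lc sa sb sc; rewrite sum_sgn_in_seq size_iota.
have cE (s : seq nat) : uniq s -> all (fun x => x < n)%N s -> count (mem s) (iota 0 n) = size s.
  move=> us ls; rewrite -[RHS]count_predT -(count_iota_mem predT us ls).
  by apply: eq_count => x /=; rewrite andbT.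
rewrite !cE // sa sb sc (count_iota_mem _ ua la) (count_iota_mem _ uc lc).
by rewrite -/(inter_size a b) -/(mixed_size a b c); lia.
Qed.

Lemma mixed_size_le a b c : (mixed_size a b c <= size c)%N.
Proof. exact: count_size. Qed.

(** Although w treats the three sets differently, w = 0 is the symmetric condition: once A and B are
    disjoint, their symmetric difference is their union. *)
Lemma uniq_cat3 (a b c : seq nat) : uniq a -> uniq b -> uniq c ->
  uniq (a ++ b ++ c) = (inter_size a b + mixed_size a b c == 0)%N.
Proof.
move=> ua ub uc; rewrite addn_eq0 !cat_uniq ua ub uc /= andbT has_cat negb_or.
have cnt0 (P : pred nat) s : (count P s == 0)%N = ~~ has P s by rewrite has_count lt0n negbK.
rewrite /inter_size /mixed_size !cnt0 has_sym.
case ab: (has (mem b) a) => //=; rewrite -negb_or -has_predU; congr negb.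
apply: eq_has => x /=.
have : ~~ ((x \in a) && (x \in b)).
  by apply: contraFN ab => /andP[xa xb]; apply/hasP; exists x.
by case: (x \in a); case: (x \in b).
Qed.

(** Distributivity. Here the degree of Phi becomes the length of the words Z. *)
Lemma sum_prod_words b p (G : nat -> nat -> int) :
  \sum_(z <- words b p) \prod_(i < p) G i (nth 0%N z i) =
  \prod_(i < p) \sum_(x <- iota 0 b) G i x.
Proof.
elim: p G => [|p IH] G; first by rewrite big_lists0 !big_ord0.
rewrite [LHS]big_listsS big_ord_recl big_distrl /=; apply: eq_bigr => x _.
rewrite -(IH (fun i => G i.+1)) big_distrr /=; apply: eq_bigr => z _.
by rewrite big_ord_recl.
Qed.

Section Triples.
Variables (n q : nat) (f : seq nat -> int).
Hypothesis f_supp : forall a, a \in words n.+1 q -> f a != 0 ->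
  uniq a && all (fun x => x < n)%N a.

Let Wq := words n.+1 q.

(** Under a sum weighted by [f], only repetition-free words without the dummy element matter. *)
Lemma big_supp (F G : seq nat -> int) :
  (forall a, a \in Wq -> uniq a -> all (fun x => x < n)%N a -> size a = q -> F a = G a) ->
  \sum_(a <- Wq) f a * F a = \sum_(a <- Wq) f a * G a.
Proof.
move=> FG; rewrite big_seq [RHS]big_seq; apply: eq_bigr => a aW.
have [->|fa] := eqVneq (f a) 0; first by rewrite !mul0r.
have /andP[ua la] := f_supp aW fa; rewrite FG //.
by move: aW; rewrite mem_words => /andP[/eqP].
Qed.

(* Chosen so that the sum of [weight_coef i x * (-1)^[x in A + B + C]] over x = 0, ..., n
   is the i-th factor of [vanish]. *)
Definition weight_coef (i x : nat) : int :=
  if x == n then n%:Z - 6 * q%:Z + 4 * i.+1%:Z else -1.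

Definition transform (z : seq nat) : int :=
  \sum_(a <- Wq) f a * \prod_(x <- z) sgn_in a x.

(** Each affine factor of [vanish] is a weighted sum over letters of products of three signs.
    Expanding the product of the factors over words [z] separates the signs of a, b and c, and for
    fixed [z] the sum over the triples is a cube. *)
Lemma sum_transform p :
  \sum_(z <- words n.+1 p) (\prod_(i < p) weight_coef i (nth 0%N z i)) * transform z ^+ 3 =
  \sum_(a <- Wq) f a * \sum_(b <- Wq) f b * \sum_(c <- Wq) f c *
    vanish p (inter_size a b + mixed_size a b c).
Proof.
have prodE a z : z \in words n.+1 p ->
    \prod_(x <- z) sgn_in a x = \prod_(i < p) sgn_in a (nth 0%N z i).
  by rewrite mem_words => /andP[/eqP <- _]; rewrite (big_nth 0%N) big_mkord.
transitivity (\sum_(z <- words n.+1 p) \sum_(a <- Wq) f a * \sum_(b <- Wq) f b *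
    \sum_(c <- Wq) f c * \prod_(i < p) (weight_coef i (nth 0%N z i) *
     (sgn_in a (nth 0%N z i) * sgn_in b (nth 0%N z i) * sgn_in c (nth 0%N z i)))).
  rewrite big_seq [RHS]big_seq; apply: eq_bigr => z zw.
  rewrite !exprS expr0 mulr1 [transform z in X in _ * (X * _)]/transform.
  rewrite big_distrl big_distrr /=; apply: eq_bigr => a _.
  rewrite [transform z in X in _ * (_ * (X * _))]/transform.
  rewrite big_distrl /= !big_distrr /=; apply: eq_bigr => b _.
  rewrite /transform !big_distrr /=; apply: eq_bigr => c _.
  rewrite !(prodE _ _ zw) !big_split /=.
  move: (\prod_(i < p) _) (\prod_(i < p) _) (\prod_(i < p) _) (\prod_(i < p) _).
  by move=> x1 x2 x3 x4; ring.
rewrite exchange_big /=.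
under eq_bigr => a _ do rewrite -big_distrr /=.
apply: big_supp => a aW ua la sa; rewrite exchange_big /=.
under eq_bigr => b _ do rewrite -big_distrr /=.
apply: big_supp => b bW ub lb sb; rewrite exchange_big /=.
under eq_bigr => c _ do rewrite -big_distrr /=.
apply: big_supp => c cW uc lc sc.
rewrite (sum_prod_words _ _ (fun i x => weight_coef i x * (sgn_in a x * sgn_in b x * sgn_in c x))).
apply: eq_bigr => i _; rewrite -[in iota 0 n.+1]addn1 iotaD big_cat big_seq1 add0n /=.
(* The letter [n] lies in none of the three words, so its weight enters unsigned, as the constant
   term. *)
have ltnF s : all (fun x => x < n)%N s -> sgn_in s n = 1.
  by rewrite /sgn_in; case: ifP => // ns /allP /(_ n ns); rewrite ltnn.
rewrite !ltnF // mulr1 mulr1 {2}/weight_coef eqxx.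
transitivity (- (\sum_(x <- iota 0 n) sgn_in a x * sgn_in b x * sgn_in c x)
              + (n%:Z - 6 * q%:Z + 4 * i.+1%:Z)).
  congr (_ + _); last by rewrite mulr1.
  rewrite -sumrN !big_seq; apply: eq_bigr => x; rewrite mem_iota add0n /= => xn.
  by rewrite /weight_coef ltn_eqF // mulN1r.
by rewrite (sum_sgn_in (q := q)) //; lia.
Qed.
End Triples.

(** * Rearrangements and common subwords *)

Lemma count_uniq_words b l (S : seq nat) : uniq S -> all (fun x => x < b)%N S ->
  count (fun w => uniq w && all (mem S) w) (words b l) = (size S ^_ l)%N.
Proof.
elim: l S => [|l IH] S uS lS; first by [].
rewrite -sum1_count [LHS]big_mkcond [LHS]big_listsS /=.
transitivity (\sum_(x <- iota 0 b | x \in S) (size S).-1 ^_ l)%N.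
  rewrite [RHS]big_mkcond; apply: eq_bigr => x _.
  case xS: (x \in S); last by apply: big1 => w _; rewrite andbF.
  rewrite -(size_rem xS) -(IH (rem x S)) ?rem_uniq //; last first.
    by apply/allP => y /mem_rem; apply: (allP lS).
  rewrite -sum1_count [RHS]big_mkcond; apply: eq_bigr => w _; congr (if _ then _ else _).
  rewrite -andbA andbCA; congr andb; elim: w => //= y w IHw.
  rewrite inE negb_or mem_rem_uniq // inE.
  rewrite -IHw eq_sym; case: (y == x) => //=; case: (y \in S) => //=; by rewrite andbF.
rewrite big_const_seq iter_addn_0 ffactnS mulnC; congr (_ * _)%N.
rewrite -[RHS]count_predT -(count_iota_mem predT uS lS).
by apply: eq_count => x /=; rewrite andbT.
Qed.

(** The common elements of two packings may stand anywhere; over all rearrangements, each word of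
    [l] of them occurs as a suffix of the first and as a prefix of the second. *)
Definition symmetrize (q : nat) (f : seq nat -> int) (y : seq nat) : int :=
  \sum_(s <- permutations (iota 0 q)) f (map (nth 0%N y) s).

Lemma perm_words a y b k : perm_eq a y -> y \in words b k -> a \in words b k.
Proof.
by move=> pay; rewrite !mem_words (perm_size pay) (perm_all _ pay).
Qed.

(** If [i] is a repetition-free word in the letters of [a], the completions [x] are the r! orderings
    of the remaining letters; otherwise there are none. *)
Lemma count_perm_cat b r (a i : seq nat) : uniq a -> all (fun x => x < b)%N a ->
  size a = (r + size i)%N ->
  count (fun x => perm_eq a (x ++ i)) (words b r) =
  if uniq i && all (mem a) i then r`! else 0%N.
Proof.
move=> ua la sa; case: ifP => [/andP[ui ia]|nia]; last first.
  apply/eqP; rewrite eqn0Ngt -has_count -all_predC; apply/allP => x _ /=.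
  apply: contraFN nia => pa; have := ua; rewrite (perm_uniq pa) cat_uniq => /and3P[_ _ ->].
  by apply/allP => y yi; rewrite /= (perm_mem pa) mem_cat yi orbT.
pose a' := [seq x <- a | x \notin i].
have pa : perm_eq a (a' ++ i).
  apply: uniq_perm => // [|x].
    rewrite cat_uniq filter_uniq // ui andbT; apply/hasPn => x xi.
    by rewrite /= mem_filter xi.
  rewrite mem_cat mem_filter; case xi: (x \in i) => /=; last by rewrite orbF.
  exact: (allP ia).
have sa' : size a' = r.
  by have := perm_size pa; rewrite sa size_cat => /eqP; rewrite eqn_add2r => /eqP.
rewrite -sa' -(@size_permutations _ a') ?filter_uniq // -size_filter; apply: perm_size.
apply: uniq_perm; [exact/filter_uniq/uniq_words|exact: permutations_uniq|].
move=> x; rewrite mem_filter mem_permutations (permPl pa) perm_cat2r perm_sym.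
case xa': (perm_eq x a') => //=; apply: perm_words xa' _.
rewrite mem_words sa' eqxx; apply/allP => y; rewrite mem_filter => /andP[_]; exact: (allP la).
Qed.

Lemma sum_swap (I J : Type) (s1 : seq I) (s2 : seq J) (F : J -> int) (G : I -> J -> int) :
  \sum_(i <- s1) \sum_(j <- s2) F j * G i j = \sum_(j <- s2) F j * \sum_(i <- s1) G i j.
Proof. by rewrite exchange_big; apply: eq_bigr => j _; rewrite -big_distrr. Qed.

Lemma sum_mulrB (J : Type) (s : seq J) (F G1 G2 : J -> int) :
  \sum_(j <- s) F j * G1 j - \sum_(j <- s) F j * G2 j = \sum_(j <- s) F j * (G1 j - G2 j).
Proof. by rewrite -sumrB; apply: eq_bigr => j _; rewrite mulrBr. Qed.

Section Symmetrize.
Variables (n q : nat) (f : seq nat -> int).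
Hypothesis f_supp : forall a, a \in words n.+1 q -> f a != 0 ->
  uniq a && all (fun x => x < n)%N a.
Let Wq := words n.+1 q.

(** If [y] is repetition-free, position permutations and rearrangements correspond bijectively.
    Otherwise the permutations overcount, but both sides vanish because [f] does. *)
Lemma symmetrizeE y : y \in Wq ->
  symmetrize q f y = \sum_(a <- Wq) f a * (perm_eq a y)%:R.
Proof.
move=> yW; have sy : size y = q by move: yW; rewrite mem_words => /andP[/eqP].
have nthP s : s \in permutations (iota 0 q) -> perm_eq (map (nth 0%N y) s) y.
  by rewrite mem_permutations => ps; apply/(perm_iotaP 0%N); exists s; rewrite ?sy.
transitivity (\sum_(a <- Wq | perm_eq a y) f a); last first.
  by rewrite big_mkcond /=; apply: eq_bigr => a _; case: ifP; rewrite ?mulr1 ?mulr0.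
have [uy|nuy] := boolP (uniq y); last first.
  have f0 a : a \in Wq -> perm_eq a y -> f a = 0.
    move=> aW pay; apply/eqP; apply: contraNT nuy => /(f_supp aW) /andP[ua _].
    by rewrite -(perm_uniq pay).
  rewrite /symmetrize big_seq big1 => [|s /nthP ps]; last by apply: f0 => //; apply: perm_words yW.
  by rewrite big_seq_cond big1 // => a /andP[aW]; apply: f0.
rewrite /symmetrize -(big_map (map (nth 0%N y)) predT f) -[RHS]big_filter.
apply: perm_big; apply: uniq_perm.
- rewrite map_inj_in_uniq ?permutations_uniq // => s1 s2 s1p s2p e.
  have K s : s \in permutations (iota 0 q) -> map (index^~ y) (map (nth 0%N y) s) = s.
    rewrite mem_permutations => ps; rewrite -map_comp -[RHS]map_id; apply/eq_in_map => i is_.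
    by rewrite /= index_uniq // sy; have := perm_mem ps i; rewrite is_ mem_iota add0n.
  by rewrite -(K s1) // e K.
- by apply/filter_uniq/uniq_words.
- move=> a; rewrite mem_filter; apply/mapP/andP => [[s /nthP ps ->]|[pay aW]].
    by split=> //; apply: perm_words yW.
  have [s ps ->] := perm_iotaP 0%N pay.
  by exists s => //; rewrite mem_permutations -sy.
Qed.

Variable l : nat.
Hypothesis lq : (l <= q)%N.
Let r := (q - l)%N.

(* Here [l + u] is the size of the intersection of A and B; the division compensates
   for the [(l + u) ^_ l] choices of the common subword, and the value 0 at [u = 0]
   leaves the pairs with an intersection of size l to the other sum. *)
Definition level_coef (u m : nat) : int :=
  if u == 0%N then 0 else (q`! %/ (l + u) ^_ l)%N%:Z * vanish (q + l) (l + u + m).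

Variable H : seq nat -> seq nat -> int.
Hypothesis HE : forall x y, x \in words n.+1 r -> y \in words n.+1 r -> uniq x -> uniq y ->
  all (fun x => x < n)%N x -> all (fun x => x < n)%N y ->
  H x y = \sum_(c <- Wq) f c * level_coef (inter_size x y) (mixed_size x y c).

(** [i] is any repetition-free word of length [l] over the common letters; then [x] and [y] order
    what is left of [a] and [b]. *)
Lemma count_triples a b : a \in Wq -> b \in Wq -> uniq a -> uniq b ->
  \sum_(x <- words n.+1 r) \sum_(y <- words n.+1 r) \sum_(i <- words n.+1 l)
    (perm_eq a (x ++ i))%:R * (perm_eq b (i ++ y))%:R =
  (inter_size a b ^_ l * (r`! * r`!))%N%:R :> int.
Proof.
under eq_bigr => x _ do rewrite exchange_big /=.
rewrite exchange_big /=.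
rewrite !mem_words => /andP[/eqP sa la] /andP[/eqP sb lb] ua ub.
transitivity (\sum_(i <- words n.+1 l) (uniq i && all (mem [seq x <- a | x \in b]) i)%:R * (r`! * r`!)%N%:R : int).
  rewrite big_seq [RHS]big_seq; apply: eq_bigr => i; rewrite mem_words => /andP[/eqP si _].
  have natsum (P : pred (seq nat)) : \sum_(x <- words n.+1 r) (P x)%:R = (count P (words n.+1 r))%:R :> int.
    rewrite -sum1_count natr_sum [RHS]big_mkcond; apply: eq_bigr => x _; by case: (P x).
  under eq_bigr => x _ do rewrite -big_distrr /=.
  rewrite -big_distrl /= natsum count_perm_cat ?sa ?si /r ?subnK //.
  rewrite (eq_bigr (fun y => (perm_eq b (y ++ i))%:R)); last first.
    by move=> y _; rewrite ![perm_eq b _]perm_sym perm_catC.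
  rewrite natsum count_perm_cat ?sb ?si ?subnK // -natrM -natrM; congr (_%:R).
  have -> : all (mem [seq x <- a | x \in b]) i = all (mem a) i && all (mem b) i.
    by rewrite -all_predI; apply: eq_all => x /=; rewrite mem_filter andbC.
  by case: (uniq i) => //=; case: (all (mem a) i) => //=; case: (all (mem b) i); rewrite ?mul1n ?muln0.
rewrite -big_distrl [RHS]natrM; congr (_ * _).
have -> : inter_size a b = size [seq x <- a | x \in b] by rewrite size_filter.
rewrite -(@count_uniq_words n.+1 l) ?filter_uniq //; last first.
  by apply/allP => x; rewrite mem_filter => /andP[_]; apply: (allP la).
rewrite -sum1_count natr_sum [RHS]big_mkcond; apply: eq_bigr => x _; by case: (_ && _).
Qed.

(** The division is exact: the falling factorial divides w!, which divides q! as w <= q. Truncated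
    subtraction sends all w <= l to level 0, where the coefficient is 0. *)
Lemma level_coefE w m : (w <= q)%N ->
  level_coef (w - l) m * (w ^_ l)%N%:R =
  if (l < w)%N then q`!%:R * vanish (q + l) (w + m) else 0.
Proof.
move=> wq; rewrite /level_coef subn_eq0; case: (leqP w l) => wl; first by rewrite mul0r.
rewrite subnKC ?(ltnW wl) //.
rewrite mulrAC -[(_ %/ _)%N%:Z]natz -natrM divnK //.
rewrite -(bin_fact wq) dvdn_mull // dvdn_mulr // -(ffact_fact (ltnW wl)); exact: dvdn_mulr.
Qed.

(** For fixed a and b all admissible (x, y, i) contribute the same amount: the letters of [i] lie in
    both words, so deleting them lowers the intersection by exactly [l] and leaves the symmetric
    difference unchanged. What remains is their number. *)
Lemma sum_symmetrize :
  \sum_(x <- words n.+1 r) \sum_(y <- words n.+1 r)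
    (\sum_(i <- words n.+1 l) symmetrize q f (x ++ i) * symmetrize q f (i ++ y)) * H x y =
  (q`! * (r`! * r`!))%N%:R * \sum_(a <- Wq) f a * \sum_(b <- Wq) f b * \sum_(c <- Wq) f c *
    (if (l < inter_size a b)%N then vanish (q + l) (inter_size a b + mixed_size a b c) else 0).
Proof.
have lqK : (l + r)%N = q by rewrite subnKC.
have rqK : (r + l)%N = q by rewrite subnK.
transitivity (\sum_(x <- words n.+1 r) \sum_(y <- words n.+1 r) \sum_(i <- words n.+1 l)
  \sum_(a <- Wq) f a * (\sum_(b <- Wq) f b * ((perm_eq a (x ++ i))%:R * (perm_eq b (i ++ y))%:R * H x y))).
  rewrite big_seq [RHS]big_seq; apply: eq_bigr => x xw.
  rewrite big_seq [RHS]big_seq; apply: eq_bigr => y yw.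
  rewrite big_distrl /= big_seq [RHS]big_seq; apply: eq_bigr => i iw.
  have xi : x ++ i \in Wq by rewrite /Wq -rqK; apply: words_cat.
  have iy : i ++ y \in Wq by rewrite /Wq -lqK; apply: words_cat.
  rewrite (symmetrizeE xi) (symmetrizeE iy) !big_distrl /=; apply: eq_bigr => a _.
  rewrite [in RHS]big_distrr /= big_distrr /= big_distrl /=; apply: eq_bigr => b _.
  by rewrite !mulrA [f a * _ * _]mulrAC.
transitivity (\sum_(a <- Wq) f a * (\sum_(b <- Wq) f b *
  (\sum_(x <- words n.+1 r) \sum_(y <- words n.+1 r) \sum_(i <- words n.+1 l)
     (perm_eq a (x ++ i))%:R * (perm_eq b (i ++ y))%:R * H x y))).
  under eq_bigr => x _ do under eq_bigr => y _ do rewrite sum_swap.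
  under eq_bigr => x _ do rewrite sum_swap.
  rewrite sum_swap; apply: eq_bigr => a _; congr (_ * _).
  under eq_bigr => x _ do under eq_bigr => y _ do rewrite sum_swap.
  under eq_bigr => x _ do rewrite sum_swap.
  by rewrite sum_swap.
rewrite mulr_sumr; under [RHS]eq_bigr => a _ do rewrite mulrCA.
apply: (big_supp f_supp) => a aW ua la sa.
rewrite mulr_sumr; under [RHS]eq_bigr => b _ do rewrite mulrCA.
apply: (big_supp f_supp) => b bW ub lb sb.
rewrite mulr_sumr; under [RHS]eq_bigr => c _ do rewrite mulrCA.
transitivity ((\sum_(c <- Wq) f c * level_coef (inter_size a b - l) (mixed_size a b c)) *
  (inter_size a b ^_ l * (r`! * r`!))%N%:R).
  rewrite -count_triples // big_distrr /= big_seq [RHS]big_seq; apply: eq_bigr => x xw.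
  rewrite big_distrr /= big_seq [RHS]big_seq; apply: eq_bigr => y yw.
  rewrite big_distrr /= big_seq [RHS]big_seq; apply: eq_bigr => i iw.
  have [pa|] := boolP (perm_eq a (x ++ i)); last by rewrite !(mul0r, mulr0).
  have [pb|] := boolP (perm_eq b (i ++ y)); last by rewrite !(mul0r, mulr0).
  have si : size i = l by move: iw; rewrite mem_words => /andP[/eqP].
  have := ua; rewrite (perm_uniq pa) cat_uniq => /and3P[ux /hasPn ix ui].
  have := ub; rewrite (perm_uniq pb) cat_uniq => /and3P[_ /hasPn yi uy].
  have := la; rewrite (perm_all _ pa) all_cat => /andP[lx li].
  have := lb; rewrite (perm_all _ pb) all_cat => /andP[_ ly].
  rewrite !mul1r mulr1 HE //; apply: eq_bigr => c _; congr (_ * level_coef _ _).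
    rewrite /inter_size (permP pa) count_cat.
    have -> : count (mem b) i = l.
      rewrite -si -[RHS]count_predT; apply: eq_in_count => z zi.
      by rewrite /= (perm_mem pb) mem_cat zi.
    rewrite addnK; apply: eq_in_count => z zx /=.
    by rewrite (perm_mem pb) mem_cat; case zi: (z \in i) => //; have := ix z zi; rewrite /= zx.
  apply: eq_count => z /=; rewrite (perm_mem pa) (perm_mem pb) !mem_cat.
  case zi: (z \in i); last by rewrite orbF.
  have := ix z zi => /negbTE /= ->; case zy: (z \in y) => //.
  by have := yi z zy; rewrite /= zi.
rewrite mulr_suml; apply: eq_bigr => c _; rewrite -mulrA; congr (_ * _).
rewrite natrM mulrA level_coefE; last by rewrite -sa; apply: count_size.
case: ifP => _; last by rewrite mul0r mulr0.
by rewrite [in RHS]natrM mulrAC.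
Qed.

(** The factor q! r! r! is the multiplicity produced by the corrected sum; the first sum is scaled
    to match instead of dividing. [vanish (q + l) 0] is the value of Phi on disjoint triples. *)
Lemma triple_identity :
  (q`! * (r`! * r`!))%N%:R * \sum_(z <- words n.+1 (q + l))
     (\prod_(i < q + l) weight_coef n q i (nth 0%N z i)) * transform n q f z ^+ 3 -
  \sum_(x <- words n.+1 r) \sum_(y <- words n.+1 r)
    (\sum_(i <- words n.+1 l) symmetrize q f (x ++ i) * symmetrize q f (i ++ y)) * H x y =
  ((q`! * (r`! * r`!))%N%:R * vanish (q + l) 0) *
  \sum_(a <- Wq) f a * \sum_(b <- Wq) f b * \sum_(c <- Wq) f c * (uniq (a ++ b ++ c))%:R.
Proof.
rewrite sum_symmetrize (sum_transform f_supp) -mulrBr -mulrA; congr (_ * _).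
rewrite mulr_sumr sum_mulrB; under [RHS]eq_bigr => a _ do rewrite mulrCA.
apply: (big_supp f_supp) => a aW ua la sa.
rewrite mulr_sumr sum_mulrB; under [RHS]eq_bigr => b _ do rewrite mulrCA.
apply: (big_supp f_supp) => b bW ub lb sb.
rewrite mulr_sumr sum_mulrB; under [RHS]eq_bigr => c _ do rewrite mulrCA.
apply: (big_supp f_supp) => c cW uc lc sc.
(* If |A /\ B| > l the two terms cancel. Otherwise w <= q + l, and only w = 0 is not a root. *)
rewrite uniq_cat3 //; case: ltnP => li.
  by rewrite subrr; case: eqP => [|_]; [lia|rewrite mulr0].
rewrite subr0; case: eqP => [->|w0]; first by rewrite mulr1.
rewrite mulr0 vanish_eq0 ?lt0n; [by []|exact/eqP|].
by rewrite addnC leq_add // -sc mixed_size_le.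
Qed.
End Symmetrize.

(** * Expressions for the terms of the identity *)

Definition tsum (es : seq tex) : tex := foldr (TB Add) (TC 0) es.
Definition tprod (es : seq tex) : tex := foldr (TB Mul) (TC 1) es.
Definition teq (E1 E2 : tex) : tex := TB Mul (TB Leq E1 E2) (TB Leq E2 E1).

Lemma sem_tsum n ts env es : sem n ts env (tsum es) = \sum_(e <- es) sem n ts env e.
Proof. by elim: es => [|e es IH]; rewrite ?big_nil ?big_cons //= IH. Qed.

Lemma sem_tprod n ts env es : sem n ts env (tprod es) = \prod_(e <- es) sem n ts env e.
Proof. by elim: es => [|e es IH]; rewrite ?big_nil ?big_cons //= IH. Qed.

Lemma sem_teq n ts env E1 E2 :
  sem n ts env (teq E1 E2) = (sem n ts env E1 == sem n ts env E2)%:R.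
Proof.
rewrite /=; case: (ltgtP (sem n ts env E1) (sem n ts env E2)) => h //=.
Qed.

Lemma wf_tsum ar nv es : wf ar nv (tsum es) = all (wf ar nv) es.
Proof. by elim: es => //= e es ->. Qed.

Lemma wf_tprod ar nv es : wf ar nv (tprod es) = all (wf ar nv) es.
Proof. by elim: es => //= e es ->. Qed.

(** * Marginals, and their use for sums of products over coordinates *)

Definition matches (n y x : nat) : bool := (y == n) || (y == x).

(** Intermediate stage of Yates' algorithm: [n] is a wildcard in the first [i] coordinates and an
    ordinary letter in the others. Stage 0 is [f], stage [q] the full table of marginals. *)
Definition marginal (n q i : nat) (f : seq nat -> int) (y : seq nat) : int :=
  \sum_(c <- words n.+1 q) f c * \prod_(j < q)
    (if (j < i)%N then matches n (nth 0%N y j) (nth 0%N c j)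
     else nth 0%N y j == nth 0%N c j)%:R.

Lemma eq_words b k y c : y \in words b k -> c \in words b k ->
  (y == c) = [forall j : 'I_k, nth 0%N y j == nth 0%N c j].
Proof.
rewrite !mem_words => /andP[/eqP sy _] /andP[/eqP sc _].
apply/eqP/forallP => [-> j //|H]; apply: (@nth_inj_seq _ 0%N _ _ k) => // i ik.
exact/eqP/(H (Ordinal ik)).
Qed.

Lemma prod_bool_nat (I : finType) (P : pred I) :
  \prod_(i : I) (P i)%:R = [forall i, P i]%:R :> int.
Proof.
case: forallP => [H|H]; first by rewrite big1 // => i _; rewrite H.
have /forallPn[i nPi] : ~~ [forall i, P i] by apply/forallP.
by rewrite (bigD1 i) //= (negbTE nPi) mul0r.
Qed.

Lemma marginal0 n q f y : y \in words n.+1 q -> marginal n q 0 f y = f y.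
Proof.
move=> yw; rewrite /marginal (bigD1_seq y) ?uniq_words //=.
rewrite [X in _ * X + _]big1 => [|j _]; last by rewrite eqxx.
rewrite mulr1 big1_seq ?addr0 // => c /andP[cy cw].
by rewrite prod_bool_nat -(eq_words yw cw) eq_sym (negbTE cy) mulr0.
Qed.

Definition set_coord (q i x : nat) (y : seq nat) : seq nat :=
  mkseq (fun j => if j == i then x else nth 0%N y j) q.

Lemma marginalS n q i f y : y \in words n.+1 q -> (i < q)%N ->
  marginal n q i.+1 f y =
  if nth 0%N y i == n then \sum_(x <- iota 0 n.+1) marginal n q i f (set_coord q i x y)
  else marginal n q i f y.
Proof.
move=> yw iq; case: eqP => yi.
  rewrite exchange_big /=; rewrite /marginal big_seq [RHS]big_seq; apply: eq_bigr => c cw.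
  rewrite -big_distrr /=; congr (_ * _).
  rewrite (bigD1 (Ordinal iq)) //= ltnSn /matches yi eqxx mul1r.
  rewrite (eq_bigr (fun x => (x == nth 0%N c i)%:R * \prod_(j < q | j != Ordinal iq)
    (if (j < i)%N then matches n (nth 0%N y j) (nth 0%N c j)
     else nth 0%N y j == nth 0%N c j)%:R)).
    rewrite -big_distrl /= (_ : \sum_(x <- _) _ = 1).
      rewrite mul1r; apply: eq_bigr => j ji; rewrite ltnS leq_eqVlt.
      by rewrite (_ : (j == i :> nat) = false) //; apply: negbTE; apply: contra ji => /eqP e; apply/eqP/val_inj.
    have cI : nth 0%N c i \in iota 0 n.+1.
      rewrite mem_iota add0n; move: cw; rewrite mem_words => /andP[/eqP sc /all_nthP]; apply.
      by rewrite sc.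
    rewrite (bigD1_seq (nth 0%N c i) cI (iota_uniq _ _)) /=.
    by rewrite eqxx big1 ?addr0 // => x /negbTE ->.
  move=> x _; rewrite (bigD1 (Ordinal iq)) //= ltnn nth_mkseq // eqxx; congr (_ * _).
  apply: eq_bigr => j ji; rewrite !nth_mkseq //.
  by rewrite (_ : (j == i :> nat) = false) //; apply: negbTE; apply: contra ji => /eqP e; apply/eqP/val_inj.
apply: eq_bigr => c _; congr (_ * _); apply: eq_bigr => j _.
rewrite ltnS leq_eqVlt; case: eqP => [->|//]; rewrite ltnn /= /matches.
by rewrite (introF eqP yi).
Qed.

(** The condition n <= y_i selects wildcards, for which all values x of the summed variable [TV q]
    contribute. The other branch must be counted once only and is restricted to x = 0. The previous
    stage is table i + 1. *)
Definition yates_stmt (q i : nat) : stmt :=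
  Stmt q 1 (TB Add
    (TB Mul (TB Leq TN (TV i)) (TT i.+1 [seq Some (if j == i then q else j) | j <- iota 0 q]))
    (TB Mul (TB Mul (TB Leq (TB Add (TV i) (TC 1)) TN) (TB Leq (TV q) (TC 0)))
       (TT i.+1 [seq Some j | j <- iota 0 q]))).

Definition agrees (n k : nat) (T : table) (g : seq nat -> int) : Prop :=
  T.1 = k /\ forall y, y \in words n.+1 k -> T.2 y = g y.

Lemma sem_yates n q i f ts : (i < q)%N ->
  agrees n q (nth table0 ts i.+1) (marginal n q i f) ->
  agrees n q (sem_stmt n ts (yates_stmt q i)) (marginal n q i.+1 f).
Proof.
move=> iq [_ H]; split=> // y yw /=.
have sy : size y = q by move: yw; rewrite mem_words => /andP[/eqP].
have ltn_y : (nth 0%N y i <= n)%N.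
  by move: yw; rewrite mem_words => /andP[_ /all_nthP]; apply; rewrite sy.
rewrite [LHS]big_listsS; under eq_bigr => x _ do rewrite big_lists0.
have E1 x : [seq aval n (y ++ [:: x]) o | o <- [seq Some (if j == i then q else j) | j <- iota 0 q]] =
    set_coord q i x y.
  rewrite -map_comp; apply/eq_in_map => j; rewrite mem_iota /= add0n => jq.
  by case: eqP => [_|_]; rewrite nth_cat sy ?ltnn ?subnn ?jq.
have E2 x : [seq aval n (y ++ [:: x]) o | o <- [seq Some j | j <- iota 0 q]] = y.
  by rewrite map_aval_iota ?size_cat ?sy ?leq_addr // -sy take_size_cat.
have nth_i x : nth 0%N (y ++ [:: x]) i = nth 0%N y i by rewrite nth_cat sy iq.
have nth_q x : nth 0%N (y ++ [:: x]) q = x by rewrite nth_cat sy ltnn subnn.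
have set_w x : x \in iota 0 n.+1 -> set_coord q i x y \in words n.+1 q.
  rewrite mem_iota add0n /= => xn; rewrite mem_words size_mkseq eqxx /=.
  apply/(all_nthP 0%N) => j; rewrite size_mkseq => jq; rewrite nth_mkseq //.
  case: eqP => // _; move: yw; rewrite mem_words => /andP[_ /all_nthP]; apply; by rewrite sy.
rewrite marginalS //; case: eqP => yi.
  rewrite big_seq [RHS]big_seq; apply: eq_bigr => x xn.
  rewrite nth_i nth_q E1 E2 yi H ?set_w // lexx mul1r.
  by rewrite [(n%:Z + 1 <= n%:Z)](_ : _ = false) ?mul0r ?addr0 //; lia.
have lt_y : (nth 0%N y i < n)%N by rewrite ltn_neqAle ltn_y andbT; apply/eqP.
rewrite (bigD1_seq 0%N _ (iota_uniq _ _)) ?mem_iota //=.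
rewrite big1_seq => [|x /andP[x0 _]].
  rewrite nth_i nth_q E1 E2 (H y yw) addr0.
  have -> : (0%N%:Z <= 0 :> int) = true by [].
  have -> : (n%:Z <= (nth 0%N y i)%:Z) = false by lia.
  have -> : ((nth 0%N y i)%:Z + 1 <= n%:Z) = true by lia.
  by rewrite mul0r add0r !mul1r.
rewrite nth_i nth_q.
have -> : (n%:Z <= (nth 0%N y i)%:Z) = false by lia.
have -> : (x%:Z <= 0) = false by lia.
by rewrite mul0r mulr0 mul0r addr0.
Qed.

(* Expands, over all choices of one option (index atom, coefficient, increment of k)
   for each coordinate, a sum of [f] against a product of functions of the coordinates. *)
Fixpoint contract (g : nat) (opts : seq (option nat * tex * nat)) (leaf : nat -> tex)
    (fuel : nat) (pre : seq (option nat)) (k : nat) : tex :=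
  if fuel is fuel'.+1 then
    tsum [seq TB Mul o.1.2 (contract g opts leaf fuel' (rcons pre o.1.1) (k + o.2)) | o <- opts]
  else TB Mul (leaf k) (TT g pre).

Lemma wf_contract ar nv g opts leaf fuel pre k :
  (g < size ar)%N -> (fuel + size pre)%N = nth 0%N ar g -> all (wf_atom nv) pre ->
  all (fun o => wf_atom nv o.1.1 && wf ar nv o.1.2) opts -> (forall i, wf ar nv (leaf i)) ->
  wf ar nv (contract g opts leaf fuel pre k).
Proof.
move=> gs + + wo wl; elim: fuel pre k => [|fuel IH] pre k sp wp.
  by rewrite /= wl gs wp -sp eqxx.
rewrite [contract _ _ _ _ _ _]/= wf_tsum all_map; apply: sub_all wo => o /andP[w1 w2] /=.
by rewrite w2 IH // ?size_rcons ?all_rcons ?w1 // -sp addSnnS.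
Qed.

Lemma eq_sum_all (T : Type) (P : pred T) (s : seq T) (F G : T -> int) :
  all P s -> (forall x, P x -> F x = G x) -> \sum_(x <- s) F x = \sum_(x <- s) G x.
Proof.
move=> + FG; elim: s => [|x s IH]; first by rewrite !big_nil.
by rewrite !big_cons /= => /andP[Px /IH ->]; rewrite FG.
Qed.

Section Contract.
Variables (n q : nat) (f : seq nat -> int) (ts : seq table) (g : nat) (env : seq nat).
Hypothesis f_supp : forall a, a \in words n.+1 q -> f a != 0 ->
  uniq a && all (fun x => x < n)%N a.
Hypothesis gE : agrees n q (nth table0 ts g) (marginal n q q f).
Hypothesis env_b : all (fun x => x < n.+1)%N env.
Variables (opts : seq (option nat * tex * nat)) (leaf : nat -> tex).
Hypothesis wf_opts : all (fun o => wf_atom (size env) o.1.1) opts.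
Variables (theta : nat -> int) (eta : nat -> nat).
Hypothesis optsE : forall (x k : nat) (F : nat -> int), (x < n)%N ->
  \sum_(o <- opts) sem n ts env o.1.2 * (matches n (aval n env o.1.1) x)%:R * F (k + o.2)%N =
  theta x * F (k + eta x)%N.

(** A coordinate with value x turns the sum over its options into the factor [theta x] and adds
    [eta x] to [k]. Testing [optsE] on arbitrary [F] is what allows the rest of the expansion, leaf
    included, to stand for [F]. *)
Lemma sem_contract fuel pre k : (fuel + size pre)%N = q -> all (wf_atom (size env)) pre ->
  sem n ts env (contract g opts leaf fuel pre k) =
  \sum_(c <- words n.+1 q) f c *
    ((\prod_(j < size pre) (matches n (nth 0%N (map (aval n env) pre) j) (nth 0%N c j))%:R) *
     (\prod_(x <- drop (size pre) c) theta x) *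
     sem n ts env (leaf (k + \sum_(x <- drop (size pre) c) eta x)%N)).
Proof.
elim: fuel pre k => [|fuel IH] pre k sp wp.
  have [_ gv] := gE.
  rewrite /= gv; last by rewrite -sp; apply: words_aval.
  rewrite mulrC /marginal big_distrl /= big_seq [RHS]big_seq; apply: eq_bigr => c.
  rewrite mem_words => /andP[/eqP sc _].
  rewrite drop_oversize ?sc -?sp // !big_nil addn0 mulr1 -mulrA; congr (_ * (_ * _)).
  by apply: eq_bigr => j _; rewrite ltn_ord.
rewrite [contract _ _ _ _ _ _]/= sem_tsum big_map.
transitivity (\sum_(o <- opts) \sum_(c <- words n.+1 q) f c *
  (sem n ts env o.1.2 *
    ((\prod_(j < size pre) (matches n (nth 0%N (map (aval n env) pre) j) (nth 0%N c j))%:R) *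
     (matches n (aval n env o.1.1) (nth 0%N c (size pre)))%:R *
     (\prod_(x <- drop (size pre).+1 c) theta x) *
     sem n ts env (leaf (k + o.2 + \sum_(x <- drop (size pre).+1 c) eta x)%N)))).
  apply: (eq_sum_all wf_opts) => o wo.
  rewrite [sem _ _ _ (TB _ _ _)]/= IH ?size_rcons ?all_rcons ?wo ?addnS //.
  rewrite big_distrr /=; apply: eq_bigr => c _; rewrite mulrCA; congr (_ * (_ * (_ * _ * _))).
  rewrite big_ord_recr /= map_rcons nth_rcons size_map ltnn eqxx; congr (_ * _).
  by apply: eq_bigr => j _; rewrite nth_rcons size_map ltn_ord.
rewrite sum_swap; apply: (big_supp f_supp) => c cw uc lc sc.
have pc : (size pre < size c)%N by rewrite sc -sp addSn ltnS leq_addl.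
rewrite (drop_nth 0%N pc) !big_cons.
set x := nth 0%N c (size pre).
have xn : (x < n)%N by apply: (all_nthP 0%N lc).
pose F i := sem n ts env (leaf (i + \sum_(x <- drop (size pre).+1 c) eta x)%N).
have := optsE k F xn; rewrite addnA -/(F (k + eta x)%N) => H.
transitivity ((\prod_(j < size pre) (matches n (nth 0%N (map (aval n env) pre) j) (nth 0%N c j))%:R) *
  (\prod_(x <- drop (size pre).+1 c) theta x) * (theta x * F (k + eta x)%N)).
  rewrite -H big_distrr /=; apply: eq_bigr => o _; rewrite /F.
  ring.
rewrite -/(F _).
ring.
Qed.
End Contract.

Lemma sem_mul n ts env E1 E2 :
  sem n ts env (TB Mul E1 E2) = sem n ts env E1 * sem n ts env E2.
Proof. by []. Qed.

Lemma sem_sub n ts env E1 E2 :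
  sem n ts env (TB Defs.Sub E1 E2) = sem n ts env E1 - sem n ts env E2.
Proof. by []. Qed.

Lemma sem_const n ts env c : sem n ts env (TC c) = c.
Proof. by []. Qed.

Lemma sem_teq_var n ts env i j :
  sem n ts env (teq (TV i) (TV j)) = (nth 0%N env i == nth 0%N env j)%:R.
Proof. by rewrite sem_teq. Qed.

(** * Tables of packings and of symmetrized packings *)

Definition packed_stmt (s t q : nat) : stmt :=
  Stmt q 0 (TB Mul
    (tprod [seq tprod [seq TB Defs.Sub (TC 1) (teq (TV j) (TV i)) | j <- iota 0 i] | i <- iota 0 q])
    (tprod [seq TT 0 [seq Some j | j <- iota (i * s) s] | i <- iota 0 t])).

(** Here [t] is the number of members in one packing, a third of the length of the tuples. *)
Definition packed (L : seq (seq nat)) (s t : nat) (y : seq nat) : int :=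
  (uniq y)%:R * \prod_(i <- iota 0 t) (take s (drop (i * s) y) \in L)%:R.

Definition symmetrize_stmt (q : nat) : stmt :=
  Stmt q 0 (tsum [seq TT 1 [seq Some j | j <- p] | p <- permutations (iota 0 q)]).

Lemma sem_stmt0 n ts k E y :
  (sem_stmt n ts (Stmt k 0 E)).2 y = sem n ts y E.
Proof. by rewrite /sem_stmt /= big_seq1 cats0. Qed.

Lemma uniqE (y : seq nat) :
  \prod_(i <- iota 0 (size y)) \prod_(j <- iota 0 i)
     (1 - (nth 0%N y j == nth 0%N y i)%:R) = (uniq y)%:R :> int.
Proof.
case: (boolP (uniq y)) => [uy|/(uniqPn 0%N)[i [j [ij js e]]]].
  rewrite big_seq big1 // => i; rewrite mem_iota add0n /= => iy.
  rewrite big_seq big1 // => j; rewrite mem_iota add0n /= => ji.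
  by rewrite nth_uniq // ?(ltn_trans ji) // ltn_eqF // subr0.
rewrite (bigD1_seq j) ?iota_uniq ?mem_iota //= (bigD1_seq i) ?iota_uniq ?mem_iota //=.
by rewrite e eqxx subrr !mul0r.
Qed.

Lemma sem_packed n s t L ts : agrees n s (nth table0 ts 0) (fun y => (y \in L)%:R) ->
  agrees n (t * s) (sem_stmt n ts (packed_stmt s t (t * s))) (packed L s t).
Proof.
move=> [_ H]; split=> // y yw; rewrite sem_stmt0.
have := yw; rewrite mem_words => /andP[/eqP sy _].
rewrite sem_mul !sem_tprod !big_map /packed; congr (_ * _).
  rewrite -uniqE sy; apply: eq_bigr => i _; rewrite sem_tprod big_map.
  by apply: eq_bigr => j _; rewrite sem_sub sem_teq_var.
rewrite big_seq [RHS]big_seq; apply: eq_bigr => i; rewrite mem_iota add0n /= => it.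
have -> : [seq aval n y o | o <- [seq Some j | j <- iota (i * s) s]] = take s (drop (i * s) y).
  have sd : (s <= size (drop (i * s) y))%N by rewrite size_drop sy -mulnBl leq_pmull // subn_gt0.
  rewrite -map_comp; apply: (@nth_inj_seq _ 0%N _ _ s); rewrite ?size_map ?size_iota ?size_takel //.
  by move=> j js; rewrite (nth_map 0%N) ?size_iota // nth_iota // nth_take // nth_drop.
apply: H; apply: (words_take (k2 := (t * s - i * s - s)%N)).
rewrite (_ : s + _ = t * s - i * s)%N; last by rewrite subnKC // -mulnBl leq_pmull // subn_gt0.
apply: (words_drop (k1 := (i * s)%N)); rewrite subnKC // leq_mul2r (ltnW it) orbT //.
Qed.

Lemma wf_packed s t ar : (0 < size ar)%N -> nth 0%N ar 0 = s ->
  wf ar (t * s + 0) (rhs (packed_stmt s t (t * s))).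
Proof.
move=> sar ar0; rewrite addn0 /= !wf_tprod !all_map; apply/andP; split.
  apply/allP => i; rewrite mem_iota add0n /= => it.
  rewrite wf_tprod all_map; apply/allP => j; rewrite mem_iota add0n /= => ji.
  by rewrite it (ltn_trans ji it).
apply/allP => i; rewrite mem_iota add0n /= => it.
rewrite sar size_map size_iota ar0 eqxx all_map; apply/allP => j; rewrite mem_iota /= => /andP[_ h].
by apply: leq_trans h _; rewrite addnC -mulSn leq_mul2r it orbT.
Qed.

Lemma sem_symmetrize n q f ts : agrees n q (nth table0 ts 1) f ->
  agrees n q (sem_stmt n ts (symmetrize_stmt q)) (symmetrize q f).
Proof.
move=> [_ H]; split=> // y yw; rewrite sem_stmt0 sem_tsum big_map /symmetrize.
rewrite big_seq [RHS]big_seq; apply: eq_bigr => p; rewrite mem_permutations => pp.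
rewrite [LHS]/= -map_comp H //.
have := yw; rewrite !mem_words size_map (perm_size pp) size_iota eqxx /= => /andP[/eqP sy /all_nthP H'].
rewrite all_map; apply/allP => i; rewrite (perm_mem pp) mem_iota add0n /= => iq.
by apply: H'; rewrite sy.
Qed.

Lemma wf_symmetrize q ar : (1 < size ar)%N -> nth 0%N ar 1 = q ->
  wf ar (q + 0) (rhs (symmetrize_stmt q)).
Proof.
move=> sar arq; rewrite addn0 /= wf_tsum all_map; apply/allP => p; rewrite mem_permutations => pp /=.
rewrite sar size_map (perm_size pp) size_iota arq eqxx all_map; apply/allP => i.
by rewrite (perm_mem pp) mem_iota add0n.
Qed.

Lemma wf_yates q i ar : (i.+1 < size ar)%N -> nth 0%N ar i.+1 = q -> (i < q)%N ->
  wf ar (q + 1) (rhs (yates_stmt q i)).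
Proof.
move=> sar arq iq; rewrite addn1 /= sar !size_map size_iota arq eqxx !all_map ltnS (ltnW iq) ltnSn /=.
apply/andP; split; apply/allP => j; rewrite mem_iota add0n /= => jq.
  by case: ifP => _; rewrite ltnS // ltnW.
by rewrite ltnS ltnW.
Qed.

(** * Signs and weighted counts as bounded numbers of table entries *)

Definition below_n (i : nat) : tex := TB Leq (TB Add (TV i) (TC 1)) TN.

Lemma sem_below_n n ts env i : sem n ts env (below_n i) = (nth 0%N env i < n)%N%:R.
Proof.
rewrite /=; have -> : ((nth 0%N env i)%:Z + 1 <= n%:Z) = (nth 0%N env i < n)%N by lia.
by case: (_ < _)%N.
Qed.

(* By [prod_sign_expand]; the last factor discards the dummy element. *)
Definition sign_coef (k : nat) : tex :=
  TB Mul (TC (-2)) (TB Mul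
    (tprod [seq TB Defs.Sub (TC 1) (TB Mul (TC 2) (teq (TV j) (TV k))) | j <- iota 0 k])
    (below_n k)).

Definition sign_opts (p : nat) : seq (option nat * tex * nat) :=
  (None, TC 1, 0%N) :: [seq (Some k, sign_coef k, 0%N) | k <- iota 0 p].

(** Telescoping over partial products: the k-th factor changes the product only if z_k = x, and
    there the preceding factors depend on [z] alone. The result is linear in the indicators of z_k =
    x, also if [z] has repetitions. *)
Lemma prod_sign_expand (z : nat -> nat) x p :
  \prod_(j <- iota 0 p) (1 - 2 * (z j == x)%:R) =
  1 + \sum_(k <- iota 0 p) - 2 * (\prod_(j <- iota 0 k) (1 - 2 * (z j == z k)%:R)) * (z k == x)%:R :> int.
Proof.
elim: p => [|p IH]; first by rewrite !big_nil addr0.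
rewrite -addn1 iotaD add0n !big_cat !big_seq1 /= addrA -IH.
case: eqP => [->|_]; last by rewrite !mulr0 subr0 addr0 mulr1.
set P := \prod_(j <- _) _; ring.
Qed.

Lemma prod_sgn_in (c : seq nat) y : uniq c ->
  \prod_(x <- c) (1 - 2 * (y == x)%:R) = sgn_in c y.
Proof.
rewrite /sgn_in; elim: c => [|x c IH]; first by rewrite big_nil.
rewrite big_cons /= inE => /andP[xc /IH ->]; case: eqP => [->|_].
  by rewrite (negbTE xc).
by rewrite mulr0 subr0 mul1r.
Qed.

Section Evaluation.
Variables (n q : nat) (f : seq nat -> int) (ts : seq table) (g : nat).
Hypothesis f_supp : forall a, a \in words n.+1 q -> f a != 0 ->
  uniq a && all (fun x => x < n)%N a.
Hypothesis gE : agrees n q (nth table0 ts g) (marginal n q q f).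

(** A variable equal to [n] would act as a wildcard; the extra factor leaves exact matches only. *)
Lemma matches_below (a x : nat) : (x < n)%N ->
  (a < n)%N%:R * (matches n a x)%:R = ((a < n)%N && (a == x))%:R :> int.
Proof.
by move=> xn; rewrite /matches; case: (ltngtP a n) => [an|an|->] /=; rewrite ?mul0r ?mul1r.
Qed.

Definition transform_tex (p : nat) : tex := contract g (sign_opts p) (fun=> TC 1) q [::] 0.

(** A contraction in which a letter x of c contributes the sign of x against [z] and nothing is
    counted; exchanging the two products regroups the signs by the letters of [z]. *)
Lemma sem_transform p z : z \in words n.+1 p ->
  sem n ts z (transform_tex p) = transform n q f z.
Proof.
move=> zw; have := zw; rewrite mem_words => /andP[/eqP sz lz].
rewrite /transform_tex.
have wo : all (fun o => wf_atom (size z) o.1.1) (sign_opts p).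
  rewrite /sign_opts /= all_map; apply/allP => k; rewrite mem_iota add0n /= sz.
  by [].
have oE (x k : nat) (F : nat -> int) : (x < n)%N ->
  \sum_(o <- sign_opts p) sem n ts z o.1.2 * (matches n (aval n z o.1.1) x)%:R * F (k + o.2)%N =
  \prod_(y <- z) (1 - 2 * (y == x)%:R) * F (k + 0)%N.
move=> xn; rewrite /sign_opts big_cons big_map.
  transitivity (1 * (matches n n x)%:R * F (k + 0)%N +
    \sum_(j <- iota 0 p) sem n ts z (sign_coef j) * (matches n (nth 0%N z j) x)%:R * F (k + 0)%N) => //.
  have -> : (matches n n x)%:R = 1 :> int by rewrite /matches eqxx.
  rewrite !mul1r addn0.
  have -> : \prod_(y <- z) (1 - 2 * (y == x)%:R) = \prod_(j <- iota 0 p) (1 - 2 * (nth 0%N z j == x)%:R) :> int.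
    by rewrite [LHS](big_nth 0%N) /index_iota subn0 sz.
  rewrite (prod_sign_expand (nth 0%N z)) mulrDl mul1r; congr (_ + _).
  rewrite big_distrl; apply: eq_bigr => j _; congr (_ * _).
  rewrite /sign_coef !sem_mul sem_below_n sem_tprod big_map !sem_const.
  have -> : \prod_(i <- iota 0 j) sem n ts z (TB Defs.Sub (TC 1) (TB Mul (TC 2) (teq (TV i) (TV j)))) =
      \prod_(i <- iota 0 j) (1 - 2 * (nth 0%N z i == nth 0%N z j)%:R).
    by apply: eq_bigr => i _; rewrite sem_sub sem_mul sem_teq_var.
  rewrite -!mulrA matches_below //; congr (_ * (_ * _)).
  by case: eqP => [->|_]; rewrite ?andbF ?xn.
rewrite (sem_contract f_supp gE lz _ wo oE) ?addn0 //.
apply: (big_supp f_supp) => c cw uc lc sc.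
  rewrite big_ord0 mul1r drop0 mulr1 exchange_big /=; apply: eq_bigr => y _.
  exact: prod_sgn_in.
Qed.

Lemma wf_transform_tex p ar : (g < size ar)%N -> nth 0%N ar g = q ->
  wf ar p (transform_tex p).
Proof.
move=> gs arg; apply: wf_contract => //; first by rewrite arg addn0.
rewrite /= all_map; apply/allP => k; rewrite mem_iota add0n /= => kp.
rewrite kp /= andbT wf_tprod all_map; apply/allP => j; rewrite mem_iota add0n /= => jk.
by rewrite kp (ltn_trans jk kp).
Qed.

(** The 1 inside the constant offsets the -1 subtracted from every letter. *)
Definition weight_tex (i : nat) : tex :=
  TB Defs.Sub (TB Mul (TB Leq TN (TV i)) (TB Add TN (TC (1 - 6 * q%:Z + 4 * i.+1%:Z)))) (TC 1).

Definition spectrum_stmt (p : nat) : stmt :=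
  Stmt 0 p (TB Mul (tprod [seq weight_tex i | i <- iota 0 p])
    (TB Mul (transform_tex p) (TB Mul (transform_tex p) (transform_tex p)))).

Lemma sem_spectrum p :
  (sem_stmt n ts (spectrum_stmt p)).2 [::] =
  \sum_(z <- words n.+1 p) (\prod_(i < p) weight_coef n q i (nth 0%N z i)) * transform n q f z ^+ 3.
Proof.
rewrite /sem_stmt [LHS]/= big_seq [RHS]big_seq; apply: eq_bigr => z zw.
rewrite /= (sem_transform zw) sem_tprod big_map.
rewrite -expr2 -exprS -(big_mkord xpredT (fun i => weight_coef n q i (nth 0%N z i))) /index_iota subn0.
congr (_ * _); rewrite big_seq [RHS]big_seq; apply: eq_bigr => i; rewrite mem_iota add0n /= => ip.
have : (nth 0%N z i <= n)%N.
  by move: zw; rewrite mem_words => /andP[/eqP sz /all_nthP]; apply; rewrite sz.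
rewrite /weight_coef leq_eqVlt; case: eqP => [-> _|_ /= lt]; first by rewrite lexx; lia.
have -> : (n%:Z <= (nth 0%N z i)%:Z) = false by lia.
by rewrite mul0r.
Qed.

Lemma wf_spectrum p ar : (g < size ar)%N -> nth 0%N ar g = q ->
  wf ar (0 + p) (rhs (spectrum_stmt p)).
Proof.
move=> gs arg; rewrite add0n [rhs _]/= [wf _ _ _]/= !wf_transform_tex // wf_tprod all_map !andbT.
by apply/allP => i; rewrite mem_iota add0n /= => ->.
Qed.

Variable l : nat.
Let r := (q - l)%N.

Definition once_coef (v k : nat) : tex :=
  TB Mul (TB Leq (tsum [seq teq (TV j) (TV k) | j <- iota 0 v]) (TC 1)) (below_n k).

(** With e the indicator that a letter occurs exactly once among the [v] variables, the options
    encode F(k + e) = F(k) + e (F(k + 1) - F(k)). *)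
Definition once_opts (v : nat) : seq (option nat * tex * nat) :=
  (None, TC 1, 0%N) :: ([seq (Some k, once_coef v k, 1%N) | k <- iota 0 v] ++
    [seq (Some k, TB Mul (TC (-1)) (once_coef v k), 0%N) | k <- iota 0 v]).

Definition inter_tex : tex :=
  tsum [seq tsum [seq teq (TV i) (TV j) | j <- iota r r] | i <- iota 0 r].

(** [k] is known when the expression is built, whereas the size of the intersection is found at run
    time by comparison with all its possible values; the coefficients are thus constants of the
    program. *)
Definition level_tex (k : nat) : tex :=
  tsum [seq TB Mul (teq inter_tex (TC u%:Z)) (TC (level_coef q l u k)) | u <- iota 0 r.+1].

Definition mixed_tex : tex := contract g (once_opts (r + r)) level_tex q [::] 0.

Lemma wf_mixed_tex ar : (g < size ar)%N -> nth 0%N ar g = q ->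
  wf ar (r + r) mixed_tex.
Proof.
have wo k : (k < r + r)%N -> wf ar (r + r) (once_coef (r + r) k).
  move=> kr; rewrite /= kr wf_tsum all_map !andbT; apply/allP => j; rewrite mem_iota add0n /= => jr.
  by rewrite jr kr.
move=> gs arg; apply: wf_contract => //; first by rewrite arg addn0.
  rewrite [all _ _]/= all_cat !all_map; apply/andP; split; apply/allP => k; rewrite mem_iota add0n => kr.
    by apply/andP; split; [exact: kr|exact: (wo _ kr)].
  by apply/andP; split; [exact: kr|exact: (wo _ kr)].
move=> k; rewrite /level_tex wf_tsum all_map; apply/allP => u _ /=.
have wi : wf ar (r + r) inter_tex.
  rewrite /inter_tex wf_tsum all_map; apply/allP => i; rewrite mem_iota add0n => ir.
  rewrite /= wf_tsum all_map; apply/allP => j; rewrite mem_iota => /andP[_ jr] /=.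
  by rewrite jr !(leq_trans ir (leq_addr _ _)).
by rewrite wi.
Qed.

Lemma count_mem_nth (v : seq nat) a :
  \sum_(j <- iota 0 (size v)) (nth 0%N v j == a)%:R = (count_mem a v)%:R :> int.
Proof.
transitivity (\sum_(x <- v) (x == a)%:R : int).
  by rewrite [RHS](big_nth 0%N) /index_iota subn0.
rewrite -sum1_count natr_sum [RHS]big_mkcond; apply: eq_bigr => x _ /=; by case: (x == a).
Qed.

(** A letter lies in the symmetric difference of two repetition-free words if and only if it occurs
    exactly once in their concatenation. *)
Lemma sem_mixed x y : x \in words n.+1 r -> y \in words n.+1 r -> uniq x -> uniq y ->
  sem n ts (x ++ y) mixed_tex =
  \sum_(c <- words n.+1 q) f c * level_coef q l (inter_size x y) (mixed_size x y c).
Proof.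
move=> xw yw ux uy; set v := x ++ y.
have vw : v \in words n.+1 (r + r) by apply: words_cat.
have := vw; rewrite mem_words => /andP[/eqP sv lv].
have sx : size x = r by move: xw; rewrite mem_words => /andP[/eqP].
have sy : size y = r by move: yw; rewrite mem_words => /andP[/eqP].
rewrite /mixed_tex.
have wo : all (fun o => wf_atom (size v) o.1.1) (once_opts (r + r)).
  rewrite /once_opts [all _ _]/= all_cat !all_map sv.
  by apply/andP; split; apply/allP => k; rewrite mem_iota add0n.
have oE (z k : nat) (F : nat -> int) : (z < n)%N ->
  \sum_(o <- once_opts (r + r)) sem n ts v o.1.2 * (matches n (aval n v o.1.1) z)%:R * F (k + o.2)%N =
  1 * F (k + (count_mem z v == 1%N))%N.
move=> zn; rewrite /once_opts big_cons big_cat !big_map /=.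
  rewrite [matches _ _ _]/(_ || _) eqxx /= mulr1 mul1r addn0 mul1r.
  transitivity (F k + (\sum_(j <- iota 0 (r + r)) sem n ts v (once_coef (r + r) j) * (matches n (nth 0%N v j) z)%:R) * (F (k + 1)%N - F k)).
    congr (_ + _); rewrite mulrBr !big_distrl /= -sumrN; congr (_ + _).
    by apply: eq_bigr => j _; rewrite !mulN1r !mulNr.
  have -> : \sum_(j <- iota 0 (r + r)) sem n ts v (once_coef (r + r) j) * (matches n (nth 0%N v j) z)%:R = (count_mem z v == 1%N)%:R.
    transitivity (\sum_(j <- iota 0 (r + r)) (nth 0%N v j == z)%:R * (count_mem z v <= 1)%N%:R : int).
      apply: eq_bigr => j _; rewrite /once_coef sem_mul sem_below_n -mulrA matches_below //.
      have -> : sem n ts v (TB Leq (tsum [seq teq (TV i) (TV j) | i <- iota 0 (r + r)]) (TC 1)) =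
          (count_mem (nth 0%N v j) v <= 1)%N%:R.
        rewrite [LHS]/= -/(sem n ts v (tsum _)) sem_tsum big_map.
        have -> : \sum_(i <- iota 0 (r + r)) sem n ts v (teq (TV i) (TV j)) = (count_mem (nth 0%N v j) v)%:R.
          by rewrite -count_mem_nth sv; apply: eq_bigr => i _; rewrite sem_teq_var.
        by rewrite natz lez_nat natz.
      rewrite mulrC; case: eqP => [->|_]; rewrite ?zn ?andbF ?mul0r //.
    rewrite -big_distrl /= -sv count_mem_nth -natrM.
    by case: (count_mem z v) => [|[|m]]; rewrite ?muln0.
  by case: (count_mem z v == 1%N); rewrite /= ?addn1 ?addn0; ring.
rewrite (sem_contract f_supp gE lv _ wo oE) ?addn0 //.
apply: (big_supp f_supp) => c cw uc lc sc.
  rewrite big_ord0 mul1r drop0 big1 // mul1r add0n.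
  have -> : (\sum_(z <- c) (count_mem z v == 1))%N = mixed_size x y c.
    rewrite /mixed_size -sum1_count [RHS]big_mkcond; apply: eq_bigr => z _ /=.
    rewrite count_cat !count_uniq_mem //.
    by case: (z \in x); case: (z \in y).
  have interE : sem n ts v inter_tex = (inter_size x y)%:R.
    rewrite /inter_tex sem_tsum big_map.
    transitivity (\sum_(z <- x) (z \in y)%:R : int); last first.
      rewrite /inter_size -sum1_count natr_sum [RHS]big_mkcond; apply: eq_bigr => z _ /=.
      by case: (z \in y).
    rewrite [RHS](big_nth 0%N) /index_iota subn0 sx.
    rewrite big_seq [RHS]big_seq; apply: eq_bigr => i; rewrite mem_iota add0n /= => ir.
    rewrite sem_tsum big_map -(count_uniq_mem _ uy) -count_mem_nth sy.
    rewrite -[X in iota X r]addn0 iotaDl big_map; apply: eq_bigr => j _.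
    rewrite sem_teq_var /v !nth_cat sx ir ltnNge leq_addr /= addKn.
    by rewrite eq_sym.
  have levE u w : sem n ts v (TB Mul (teq inter_tex (TC u%:Z)) (TC w)) =
      (inter_size x y == u)%:R * w.
    by rewrite sem_mul sem_teq interE !sem_const [(inter_size x y)%:R]natz eqz_nat.
  rewrite /level_tex sem_tsum big_map.
  have ir : inter_size x y \in iota 0 r.+1.
    by rewrite mem_iota add0n ltnS -sx count_size.
  under eq_bigr => u _ do rewrite levE.
  rewrite (bigD1_seq _ ir (iota_uniq _ _)) /= eqxx mul1r big1 ?addr0 // => u ur.
  by rewrite eq_sym (negbTE ur) mul0r.
Qed.

End Evaluation.

(** * The program *)

Lemma size_sem_prog n ts ss : size (sem_prog n ts ss) = (size ts + size ss)%N.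
Proof.
elim: ss ts => [|s ss IH] ts; first by rewrite addn0.
by rewrite /= IH size_rcons addSnnS.
Qed.

Lemma sem_prog_cat n ts s1 s2 :
  sem_prog n ts (s1 ++ s2) = sem_prog n (sem_prog n ts s1) s2.
Proof. by elim: s1 ts => /=. Qed.

Lemma nth_sem_prog n ts ss j : (j < size ts)%N ->
  nth table0 (sem_prog n ts ss) j = nth table0 ts j.
Proof.
elim: ss ts => [//|s ss IH] ts jts.
by rewrite /= IH ?size_rcons ?ltnS ?(ltnW jts) // nth_rcons jts.
Qed.

Lemma unzip1_sem_prog n ts ss :
  unzip1 (sem_prog n ts ss) = unzip1 ts ++ map out_ar ss.
Proof.
elim: ss ts => [|s ss IH] ts; first by rewrite cats0.
by rewrite /= IH /unzip1 map_rcons cat_rcons.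
Qed.

Lemma wf_prog_cat ar s1 s2 :
  wf_prog ar (s1 ++ s2) = wf_prog ar s1 && wf_prog (ar ++ map out_ar s1) s2.
Proof.
elim: s1 ar => [|s s1 IH] ar; first by rewrite cats0.
by rewrite /= IH cat_rcons andbA.
Qed.

Section Program.
Variables (s t l : nat).
Let q := (t * s)%N.
Let r := (q - l)%N.

Definition pre_prog : seq stmt :=
  packed_stmt s t q :: [seq yates_stmt q i | i <- iota 0 q] ++ [:: symmetrize_stmt q].

(* The tables are numbered as follows: 0 the members of the family, 1 the packings,
   1 + i the marginals in the first i coordinates, q + 2 the symmetrized packings,
   q + 3 the matrix product. *)
Definition mixed_stmt : stmt :=
  Stmt 0 (r + r) (TB Mul (TT q.+3 [seq Some j | j <- iota 0 (r + r)]) (mixed_tex q q.+1 l)).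

Definition scale : int := (q`! * (r`! * r`!))%N%:R.

(** The division is exact by [triple_identity]; tables q + 4 and q + 5 hold its two sums. *)
Definition answer_stmt : stmt :=
  Stmt 0 0 (TB Div (TB Defs.Sub (TB Mul (TC scale) (TT q.+4 [::])) (TT q.+1.+4 [::]))
                   (TC (scale * vanish (q + l) 0))).

Definition post_prog : seq stmt := [:: spectrum_stmt q q.+1 (q + l); mixed_stmt; answer_stmt].

Lemma out_ar_pre : map out_ar pre_prog = nseq q.+2 q.
Proof.
have yE : [seq out_ar x | x <- [seq yates_stmt q i | i <- iota 0 q]] = nseq q q.
  rewrite -map_comp; apply: (@nth_inj_seq _ 0%N _ _ q); rewrite ?size_map ?size_iota ?size_nseq //.
  by move=> i iq; rewrite (nth_map 0%N) ?size_iota // nth_nseq iq.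
rewrite /pre_prog map_cons map_cat yE [map out_ar [:: _]]/= -[out_ar _]/q.
by rewrite -[[:: q]]/(nseq 1 q) -nseqD addn1.
Qed.

Lemma wf_pre : wf_prog [:: s] pre_prog.
Proof.
rewrite -[pre_prog]/([:: packed_stmt s t q] ++ ([seq yates_stmt q i | i <- iota 0 q] ++ [:: symmetrize_stmt q])).
rewrite !wf_prog_cat; apply/and3P; split.
- by rewrite [wf_prog _ _]/= andbT; apply: wf_packed.
- have H k a ar : size ar = a.+2 -> nth 0%N ar a.+1 = q -> (a + k <= q)%N ->
      wf_prog ar [seq yates_stmt q i | i <- iota a k].
    elim: k a ar => [//|k IH] a ar sar arq akq.
    rewrite -[iota a k.+1]/(a :: iota a.+1 k) map_cons -[wf_prog _ _]/(wf _ _ _ && wf_prog _ _).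
    apply/andP; split.
      by apply: (@wf_yates q a ar); rewrite ?sar //; lia.
    by apply: IH; rewrite ?size_rcons ?sar // ?nth_rcons ?sar ?ltnn ?eqxx //; lia.
  by apply: H; rewrite ?add0n.
- by rewrite -[wf_prog _ _]/(wf _ _ _ && true) andbT; apply: (@wf_symmetrize q).
Qed.

Lemma wf_post ar : size ar = q.+4 -> nth 0%N ar q.+1 = q -> nth 0%N ar q.+3 = (r + r)%N ->
  wf_prog ar post_prog.
Proof.
move=> sar ar1 ar3.
rewrite /post_prog -[wf_prog _ _]/([&& wf _ _ _, wf _ _ _, wf _ _ _ & true]).
rewrite -[out_ar (spectrum_stmt q q.+1 (q + l))]/0%N -[out_ar mixed_stmt]/0%N.
have s1 : size (rcons ar 0%N) = q.+1.+4 by rewrite size_rcons sar.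
have s2 : size (rcons (rcons ar 0%N) 0%N) = q.+2.+4 by rewrite size_rcons s1.
apply/and4P; split=> //.
- by apply: (@wf_spectrum q q.+1); rewrite ?sar //; lia.
- rewrite add0n -[wf _ _ _]/(_ && _); apply/andP; split.
    rewrite s1 size_map size_iota nth_rcons sar.
    rewrite (_ : q.+3 < q.+4)%N // ar3 eqxx (_ : q.+3 < q.+1.+4)%N /=; last lia.
    by rewrite all_map; apply/allP => j; rewrite mem_iota.
  have a1 : nth 0%N (rcons ar 0%N) q.+1 = q.
    by rewrite nth_rcons sar (_ : q.+1 < q.+4)%N //; lia.
  have a2 : (q.+1 < size (rcons ar 0%N))%N by rewrite s1; lia.
  exact: (@wf_mixed_tex q q.+1 l (rcons ar 0%N) a2 a1).
- have e1 : (q.+4 < q.+2.+4)%N by rewrite !ltnS leqW.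
  have e2 : (q.+1.+4 < q.+2.+4)%N by rewrite !ltnS.
  have e3 : (q.+4 < q.+1.+4)%N by rewrite !ltnS.
  have a1 : nth 0%N (rcons (rcons ar 0%N) 0%N) q.+4 = 0%N.
    by rewrite !nth_rcons size_rcons sar e3 ltnn eqxx.
  have a2 : nth 0%N (rcons (rcons ar 0%N) 0%N) q.+1.+4 = 0%N.
    by rewrite nth_rcons size_rcons sar ltnn eqxx.
  apply/andP; split; last by [].
  apply/andP; split; last first.
    by apply/and3P; split; [rewrite s2|rewrite a2|].
  by apply/andP; split; last by apply/and3P; split; [rewrite s2|rewrite a1|].
Qed.

Variables (n : nat) (L : seq (seq nat)).
Hypothesis s_gt0 : (0 < s)%N.
Hypothesis lq : (l <= q)%N.
Hypothesis L_lt : all (all (fun x => x < n)%N) L.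

Lemma packed_supp a : a \in words n.+1 q -> packed L s t a != 0 ->
  uniq a && all (fun x => x < n)%N a.
Proof.
rewrite mem_words /packed => /andP[/eqP sa _]; rewrite mulf_eq0 negb_or => /andP[].
case: (uniq a) => // _ prod0; apply/(all_nthP 0%N) => i; rewrite sa => iq.
have it : (i %/ s < t)%N by rewrite ltn_divLR.
have bL : take s (drop (i %/ s * s) a) \in L.
  apply: contraNT prod0 => nL.
  by rewrite (bigD1_seq (i %/ s)%N) ?iota_uniq ?mem_iota //= (negbTE nL) mul0r.
have si : (i %% s < s)%N by rewrite ltn_pmod.
have sd : (s <= size (drop (i %/ s * s) a))%N.
  by rewrite size_drop sa -mulnBl leq_pmull // subn_gt0.
have := all_nthP 0%N (allP L_lt _ bL) (i %% s)%N; rewrite size_takel // => /(_ si).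
by rewrite nth_take // nth_drop -divn_eq.
Qed.

Definition pre_tables : seq table := sem_prog n [:: member_table s L] pre_prog.

Definition all_tables : seq table :=
  sem_prog n (rcons pre_tables (mul_table n q l (nth table0 pre_tables q.+2).2)) post_prog.

Lemma size_pre_tables : size pre_tables = q.+3.
Proof. by rewrite size_sem_prog -(size_map out_ar) out_ar_pre size_nseq. Qed.

Let f := packed L s t.

Lemma yates_tables k : (k <= q)%N ->
  let ts := sem_prog n [:: member_table s L] (packed_stmt s t q :: [seq yates_stmt q i | i <- iota 0 k]) in
  agrees n q (nth table0 ts k.+1) (marginal n q k f).
Proof.
elim: k => [|k IH] kq ts.
  have [H1 H2] : agrees n q (sem_stmt n [:: member_table s L] (packed_stmt s t q)) f.
    by apply: sem_packed; split=> // y _; rewrite natz.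
  rewrite -[nth table0 ts 1]/(sem_stmt n [:: member_table s L] (packed_stmt s t q)).
  by split=> // y yw; rewrite H2 // marginal0.
have := IH (ltnW kq); rewrite /ts -addn1 iotaD map_cat -cat_cons sem_prog_cat.
set ts' := sem_prog _ _ _ => /=; rewrite !addn1 add0n => H.
have sts' : size ts' = k.+2 by rewrite size_sem_prog /= size_map size_iota.
rewrite nth_rcons sts' ltnn eqxx; exact: sem_yates.
Qed.

Lemma agrees_f : agrees n q (nth table0 pre_tables 1) f.
Proof.
rewrite /pre_tables -[pre_prog]/([:: packed_stmt s t q] ++ ([seq yates_stmt q i | i <- iota 0 q] ++ [:: symmetrize_stmt q])).
rewrite sem_prog_cat nth_sem_prog //.
have [H1 H2] := yates_tables (leq0n q); split=> // y yw.
by rewrite -[LHS]/((nth table0 (sem_prog n [:: member_table s L] [:: packed_stmt s t q]) 1).2 y) H2 // marginal0.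
Qed.

Lemma agrees_marginal : agrees n q (nth table0 pre_tables q.+1) (marginal n q q f).
Proof.
rewrite /pre_tables -[pre_prog]/((packed_stmt s t q :: [seq yates_stmt q i | i <- iota 0 q]) ++ [:: symmetrize_stmt q]).
rewrite sem_prog_cat nth_sem_prog; first exact: yates_tables.
by rewrite size_sem_prog /= size_map size_iota.
Qed.

Lemma agrees_symmetrize : agrees n q (nth table0 pre_tables q.+2) (symmetrize q f).
Proof.
have := agrees_f; rewrite /pre_tables -[pre_prog]/((packed_stmt s t q :: [seq yates_stmt q i | i <- iota 0 q]) ++ [:: symmetrize_stmt q]).
rewrite sem_prog_cat.
set ts' := sem_prog n _ (packed_stmt s t q :: _).
have sts' : size ts' = q.+2 by rewrite size_sem_prog /= size_map size_iota.
rewrite nth_sem_prog ?sts' // => H.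
rewrite -[sem_prog _ _ _]/(rcons ts' (sem_stmt n ts' (symmetrize_stmt q))).
by rewrite nth_rcons sts' ltnn eqxx; apply: sem_symmetrize.
Qed.
Lemma sem_mixed_stmt ts :
  nth table0 ts q.+3 = mul_table n q l (nth table0 pre_tables q.+2).2 ->
  (sem_stmt n ts mixed_stmt).2 [::] =
  \sum_(x <- words n.+1 r) \sum_(y <- words n.+1 r)
    (\sum_(i <- words n.+1 l) symmetrize q f (x ++ i) * symmetrize q f (i ++ y)) *
    sem n ts (x ++ y) (mixed_tex q q.+1 l).
Proof.
move=> mE.
rewrite -[LHS]/(\sum_(v <- words n.+1 (r + r)) sem n ts v (rhs mixed_stmt)) big_lists_cat.
rewrite big_seq [RHS]big_seq; apply: eq_bigr => x xw.
rewrite big_seq [RHS]big_seq; apply: eq_bigr => y yw.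
have sx : size x = r by move: xw; rewrite mem_words => /andP[/eqP].
have sy : size y = r by move: yw; rewrite mem_words => /andP[/eqP].
rewrite /mixed_stmt -[rhs _]/(TB Mul _ _) sem_mul; congr (_ * _).
rewrite -[LHS]/((nth table0 ts q.+3).2 _) mE map_aval_iota ?size_cat ?sx ?sy // take_oversize ?size_cat ?sx ?sy //.
rewrite -[LHS]/(\sum_(i <- words n.+1 l) _).
rewrite take_size_cat // drop_size_cat //.
have [_ H] := agrees_symmetrize.
rewrite big_seq [RHS]big_seq; apply: eq_bigr => i iw.
rewrite !H //.
  by rewrite -[q in words _ q](subnKC lq); apply: words_cat.
by rewrite -[q in words _ q](subnK lq); apply: words_cat.
Qed.

Lemma answerE :
  (nth table0 all_tables q.+2.+4).2 [::] =
  \sum_(a <- words n.+1 q) f a * \sum_(b <- words n.+1 q) f b *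
    \sum_(c <- words n.+1 q) f c * (uniq (a ++ b ++ c))%:R.
Proof.
set ts0 := rcons pre_tables (mul_table n q l (nth table0 pre_tables q.+2).2).
set ts1 := rcons ts0 (sem_stmt n ts0 (spectrum_stmt q q.+1 (q + l))).
set ts2 := rcons ts1 (sem_stmt n ts1 mixed_stmt).
have -> : all_tables = rcons ts2 (sem_stmt n ts2 answer_stmt) by [].
have s0 : size ts0 = q.+4 by rewrite size_rcons size_pre_tables.
have s1 : size ts1 = q.+1.+4 by rewrite size_rcons s0.
have s2 : size ts2 = q.+2.+4 by rewrite size_rcons s1.
have n0 j : (j < q.+3)%N -> nth table0 ts0 j = nth table0 pre_tables j.
  by move=> jq; rewrite nth_rcons size_pre_tables jq.
have n1 j : (j < q.+4)%N -> nth table0 ts1 j = nth table0 ts0 j.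
  by move=> jq; rewrite nth_rcons s0 jq.
have n2 j : (j < q.+1.+4)%N -> nth table0 ts2 j = nth table0 ts1 j.
  by move=> jq; rewrite nth_rcons s1 jq.
rewrite nth_rcons s2 ltnn eqxx sem_stmt0.
have fs := packed_supp.
have g0 : agrees n q (nth table0 ts0 q.+1) (marginal n q q f).
  by rewrite n0; [exact: agrees_marginal|lia].
have g1 : agrees n q (nth table0 ts1 q.+1) (marginal n q q f).
  by rewrite n1 //; lia.
have m1 : nth table0 ts1 q.+3 = mul_table n q l (nth table0 pre_tables q.+2).2.
  by rewrite n1 // nth_rcons size_pre_tables ltnn eqxx.
have z1 : (nth table0 ts2 q.+4).2 [::] = \sum_(z <- words n.+1 (q + l))
    (\prod_(i < q + l) weight_coef n q i (nth 0%N z i)) * transform n q f z ^+ 3.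
  rewrite n2 // nth_rcons s0 ltnn eqxx; exact: (sem_spectrum fs g0).
have z2 : (nth table0 ts2 q.+1.+4).2 [::] =
  \sum_(x <- words n.+1 r) \sum_(y <- words n.+1 r)
    (\sum_(i <- words n.+1 l) symmetrize q f (x ++ i) * symmetrize q f (i ++ y)) *
    sem n ts1 (x ++ y) (mixed_tex q q.+1 l).
  rewrite nth_rcons s1 ltnn eqxx; exact: sem_mixed_stmt.
rewrite -[LHS]/((scale * (nth table0 ts2 q.+4).2 [::] - (nth table0 ts2 q.+1.+4).2 [::]) %/ (scale * vanish (q + l) 0))%Z.
rewrite z1 z2.
have -> := triple_identity fs lq (H := fun x y => sem n ts1 (x ++ y) (mixed_tex q q.+1 l)).
  rewrite mulKz // mulf_neq0 ?vanish0_neq0 // /scale pnatr_eq0 -lt0n !muln_gt0 !fact_gt0 //.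
by move=> x y xw yw ux uy _ _; apply: sem_mixed.
Qed.
End Program.

(** * Packings and tuples of disjoint sets *)

(** All members having the same length [s], a word is the concatenation of at most one list of
    members. *)
Lemma sum_packed_blocks b s t (L : seq (seq nat)) (phi : seq nat -> int) :
  uniq L -> all (mem (words b s)) L ->
  \sum_(a <- words b (t * s)) (\prod_(i <- iota 0 t) (take s (drop (i * s) a) \in L)%:R) * phi a =
  \sum_(w <- lists L t) phi (flatten w).
Proof.
move=> uL Lw; elim: t phi => [|t IH] phi.
  by rewrite mul0n !big_lists0 big_nil mul1r.
rewrite mulSn big_lists_cat big_listsS.
transitivity (\sum_(x <- words b s) (x \in L)%:R * \sum_(w <- lists L t) phi (x ++ flatten w)).
  rewrite big_seq [RHS]big_seq; apply: eq_bigr => x xw.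
  have sx : size x = s by move: xw; rewrite mem_words => /andP[/eqP].
  rewrite -(IH (fun a => phi (x ++ a))) big_distrr /=; apply: eq_bigr => a _.
  rewrite big_cons mul0n drop0 take_size_cat // -mulrA; congr (_ * (_ * _)).
  rewrite -[iota 1 t]/(iota (1 + 0) t) iotaDl big_map; apply: eq_bigr => i _.
  by rewrite mulSn drop_cat sx ltnNge leq_addr /= addKn.
rewrite (eq_bigr (fun x => if x \in L then \sum_(w <- lists L t) phi (x ++ flatten w) else 0)); last first.
  by move=> x _; case: (x \in L); rewrite ?mul1r ?mul0r.
rewrite -big_mkcond -big_filter; apply: perm_big; apply: uniq_perm => //.
  exact/filter_uniq/uniq_words.
by move=> x; rewrite mem_filter; case xL: (x \in L) => //=; apply: (allP Lw).
Qed.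

Lemma sum_packed b s t (L : seq (seq nat)) (phi : seq nat -> int) :
  uniq L -> all (mem (words b s)) L ->
  \sum_(a <- words b (t * s)) packed L s t a * phi a =
  \sum_(w <- lists L t) (uniq (flatten w))%:R * phi (flatten w).
Proof.
move=> uL Lw; rewrite -(sum_packed_blocks t (fun a => (uniq a)%:R * phi a) uL Lw).
by apply: eq_bigr => a _; rewrite /packed mulrAC mulrC mulrA.
Qed.

(** Parts of a repetition-free word are repetition-free, so the last indicator absorbs those of the
    three packings. *)
Lemma sum_packed3 b s t (L : seq (seq nat)) : uniq L -> all (mem (words b s)) L ->
  \sum_(x <- words b (t * s)) packed L s t x * \sum_(y <- words b (t * s)) packed L s t y *
    \sum_(z <- words b (t * s)) packed L s t z * (uniq (x ++ y ++ z))%:R =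
  (count (fun w => uniq (flatten w)) (lists L (t + (t + t))))%:R.
Proof.
move=> uL Lw; rewrite -sum1_count natr_sum [RHS]big_mkcond [RHS]big_lists_cat.
rewrite sum_packed //; apply: eq_bigr => u _; rewrite big_lists_cat sum_packed // big_distrr /=.
apply: eq_bigr => v _; rewrite sum_packed // !big_distrr /=; apply: eq_bigr => w _.
rewrite !flatten_cat; case: ifP => [h|_]; last by rewrite !mulr0.
move: (h); rewrite cat_uniq => /and3P[-> _]; rewrite cat_uniq => /and3P[-> _ ->].
by rewrite !mul1r.
Qed.

Lemma uniq_flatten (T : eqType) (ls : seq (seq T)) :
  uniq (flatten ls) = all uniq ls && pairwise (fun a b : seq T => ~~ has (mem a) b) ls.
Proof.
elim: ls => //= a ls IH; rewrite cat_uniq IH.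
have -> : has (mem a) (flatten ls) = ~~ all (fun b => ~~ has (mem a) b) ls.
  by elim: ls {IH} => //= b ls IH; rewrite has_cat IH; case: has.
rewrite negbK; case: (uniq a) => //=; case: (all _ ls) => //=; by rewrite andbF.
Qed.

Lemma count_lists_perm (T : eqType) (A B : seq T) t (P : pred (seq T)) :
  uniq A -> perm_eq A B -> count P (lists A t) = count P (lists B t).
Proof.
move=> uA pAB; apply/permP/uniq_perm; rewrite ?uniq_lists //; first by rewrite -(perm_uniq pAB).
by move=> w; rewrite !mem_lists; congr andb; apply: eq_all => x; apply: perm_mem.
Qed.

Lemma card_disjoint_tuples n t (F : {set {set 'I_n}}) :
  #|disjoint_tuples t F| =
  count (pairwise (fun A B : {set 'I_n} => [disjoint A & B])) (lists (enum F) t).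
Proof.
rewrite cardE -(size_map val) -size_filter; apply: perm_size; apply: uniq_perm.
- by rewrite map_inj_uniq ?enum_uniq //; apply: val_inj.
- by apply/filter_uniq/uniq_lists/enum_uniq.
have pwE (S : t.-tuple {set 'I_n}) : S \in disjoint_tuples t F =
    (pairwise (fun A B : {set 'I_n} => [disjoint A & B]) S) && all (mem (enum F)) S.
  rewrite inE andbC; congr andb.
    apply/idP/(pairwiseP finset.set0) => [H i j|H].
      rewrite !inE size_tuple => ti tj ij.
      move: (forallP (forallP H (Ordinal ti)) (Ordinal tj)); rewrite /= ij /=.
      by rewrite !(tnth_nth finset.set0).
    apply/forallP => i; apply/forallP => j; apply/implyP => ij.
    by rewrite !(tnth_nth finset.set0) H // inE size_tuple ltn_ord.
  apply/forallP/allP => [H A /tnthP[i ->]|H i]; first by rewrite /= mem_enum H.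
  by have := H _ (mem_tnth i S); rewrite /= mem_enum.
move=> w; rewrite mem_filter mem_lists.
apply/mapP/and3P => [[S]|[pw /eqP sw wF]].
  by rewrite mem_enum pwE => /andP[h1 h2] ->; rewrite size_tuple.
by exists (Tuple (introT eqP sw)) => //; rewrite mem_enum pwE /= pw.
Qed.

Lemma disjoint_seq_sets n (a b : seq 'I_n) :
  [disjoint [set x in a]%SET & [set x in b]%SET] = ~~ has (mem a) b.
Proof.
apply/pred0P/hasPn => [H x xb|H x]; first by have /= := H x; rewrite !inE xb andbT => ->.
by rewrite /= !inE; apply/negP => /andP[xa /H]; rewrite /= xa.
Qed.

Lemma count_disjoint_tuples n t (F : {set {set 'I_n}}) (L : seq (seq 'I_n)) :
  lists_family L F ->
  #|disjoint_tuples t F| =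
  count (fun w => uniq (flatten w)) (lists (map (map val) L) t).
Proof.
move=> [uL pL]; rewrite card_disjoint_tuples.
have pF : perm_eq (enum F) [seq [set x in l]%SET | l <- L] by rewrite perm_sym.
rewrite (count_lists_perm t _ (enum_uniq _) pF).
rewrite !map_lists !count_map; apply: eq_in_count => w; rewrite mem_lists => /andP[_ wL] /=.
rewrite -map_flatten map_inj_uniq; last exact: val_inj.
rewrite uniq_flatten pairwise_map (_ : all uniq w) /=; last first.
  by apply/allP => a /(allP wL) aL; apply: (allP uL).
by apply: eq_pairwise => a b; apply: disjoint_seq_sets.
Qed.

Lemma lists_family_uniq n (F : {set {set 'I_n}}) (L : seq (seq 'I_n)) :
  lists_family L F -> uniq (map (map val) L).
Proof.
move=> [_ pL]; have uL : uniq [seq [set x in l]%SET | l <- L] by rewrite (perm_uniq pL) enum_uniq.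
rewrite map_inj_uniq; last exact/inj_map/val_inj.
exact: map_uniq uL.
Qed.

Lemma lists_family_size n s (F : {set {set 'I_n}}) (L : seq (seq 'I_n)) :
  lists_family L F -> (forall S, S \in F -> #|S| = s) -> all (fun l => size l == s) L.
Proof.
move=> [uL pL] Fs; apply/allP => l lL.
have : [set x in l]%SET \in F.
  by rewrite -mem_enum -(perm_mem pL) map_f.
by move=> /Fs <-; rewrite cardsE; apply/eqP/esym/card_uniqP/(allP uL).
Qed.

(** * Running time *)

(** The answer is moved to cell 0 of array 0 only at the end, since until then this cell holds [n],
    on which all table addresses depend. *)
Definition count_cmd (P : cmd) (s t l : nat) : cmd :=
  let q := (t * s)%N in
  Seq (input_cmd s)
    (Seq (comp_prog 1 (pre_prog s t))
       (Seq (mm_cmd P q.+2 q l q.+3)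
          (Seq (comp_prog q.+4 (post_prog s t l))
             (Set_ 0 (Cst 0) (Get (tbl q.+2.+4) (Cst 0)))))).

(** The loop depths of a pass of Yates' algorithm, of the sum over Z, and of the sum over (x, y). *)
Definition table_dim (q l : nat) : nat := maxn q.+1 (maxn (q + l) (q - l + (q - l))).

(** Word bounds must have the form K n^K with one K; from n + 1 <= 2n and E <= 2^E, the value K =
    2^E does. *)
Lemma expn_word n E : (0 < n)%N -> (n.+1 ^ E <= 2 ^ E * n ^ (2 ^ E))%N.
Proof.
move=> n0; apply: (@leq_trans ((2 * n) ^ E)); first by case: E => // E; rewrite leq_exp2r //; lia.
by rewrite expnMn leq_mul2l leq_pexp2l ?orbT // ltnW // ltn_expl.
Qed.

Section Run.
Variables (R : realType) (P : cmd) (Km : nat) (cost : nat -> nat -> R).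
Hypothesis HP : multiplies P Km cost.
Variables (s t l : nat).
Hypothesis s_gt0 : (0 < s)%N.
Hypothesis t_gt0 : (0 < t)%N.
Let q := (t * s)%N.
Hypothesis lr : (l <= q - l)%N.
Let D := table_dim q l.

Definition exp_pre : nat := prog_exp s (pre_prog s t).
Definition exp_mm : nat := mm_exp Km exp_pre.
Definition exp_post : nat := prog_exp exp_mm (post_prog s t l).
Definition exp_total : nat := (2 * s + 3 + exp_post)%N.

Definition cost_total : nat :=
  (ecost (input_index s) + 30 + prog_cost (pre_prog s t) + mm_cost q l +
   prog_cost (post_prog s t l) + 4)%N.

Lemma run_count n (F : {set {set 'I_n}}) (L : seq (seq 'I_n)) :
  (0 < n)%N -> (forall S, S \in F -> #|S| = s) -> lists_family L F ->
  exists (m' : memory) (k : nat),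
    [/\ exec (2 ^ exp_total * n ^ (2 ^ exp_total)) (count_cmd P s t l)
          (family_input s (t + (t + t)) L) m' k,
        m' 0%N 0%N = #|disjoint_tuples (t + (t + t)) F|%:Z
      & k%:R <= (cost_total * n.+1 ^ D)%:R + cost (n.+1 ^ (q - l)) (n.+1 ^ l)].
Proof.
move=> n0 Fs LF; set W := (_ * _)%N.
have sizeL := lists_family_size LF Fs; have uL := lists_family_uniq LF.
set L' := map (map val) L in uL.
have sq : (s <= q)%N by rewrite leq_pmull.
have lq : (l <= q)%N by lia.
have b1 : (1 < n.+1)%N by [].
have expW x : (x <= exp_total)%N -> (n.+1 ^ x <= W)%N.
  by move=> lex; apply: leq_trans (expn_word _ n0); rewrite leq_exp2l.
have pre_s : (s <= exp_pre)%N by apply: prog_exp_ge.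
have mm_pre : (exp_pre <= exp_mm)%N by rewrite /exp_mm /mm_exp; lia.
have post_mm : (exp_mm <= exp_post)%N by apply: prog_exp_ge.
have qD : (q.+1 <= D)%N by rewrite leq_maxl.
have powD x c : (x <= D)%N -> (c * n.+1 ^ x <= c * n.+1 ^ D)%N.
  by move=> xD; rewrite leq_mul2l leq_exp2l // xD orbT.
have Lw : all (mem (words n.+1 s)) L'.
  rewrite all_map; apply/allP => w wL /=; rewrite mem_words size_map (allP sizeL w wL) /=.
  by rewrite all_map; apply/allP => x _ /=; apply: ltn_trans (ltn_ord x) _.
have Ll : all (all (fun x => x < n)%N) L'.
  by rewrite all_map; apply/allP => w _ /=; rewrite all_map; apply/allP => x _ /=; apply: ltn_ord.
have [m1 [k1 [E1 k1c [g1 keep1]]]] : runs W (input_cmd s) (family_input s (t + (t + t)) L)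
    ((ecost (input_index s) + 30) * n.+1 ^ s) (fun m' =>
    good n s [:: member_table s L'] m' /\ keeps (family_input s (t + (t + t)) L) m').
  by apply: runs_input => //; apply: expW; rewrite /exp_total; lia.
have [m2 [k2 [E2 k2c [g2 keep2]]]] : runs W (comp_prog 1 (pre_prog s t)) m1
    (prog_cost (pre_prog s t) * n.+1 ^ D) (fun m' =>
    good n exp_pre (pre_tables s t n L') m' /\ keeps m1 m').
  apply: (runs_prog n0 s_gt0 g1) => //; first exact: wf_pre.
    by apply: expW; rewrite /exp_total -/exp_pre; lia.
  rewrite /pre_prog /= all_cat all_map addn0 /= addn0 ltnW //=; apply/andP; split=> //.
    by apply/allP => i _ /=; rewrite addn1.
have init0 a x : (1 < a)%N -> family_input s (t + (t + t)) L a x = 0.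
  by move=> a1; rewrite /family_input /load [nth [::] _ _]nth_default ?nth_nil.
have [m3 [k3 [E3 g3 k3c]]] : exists m' k, [/\ exec W (mm_cmd P q.+2 q l q.+3) m2 m' k,
    good n exp_mm (rcons (pre_tables s t n L') (mul_table n q l (nth table0 (pre_tables s t n L') q.+2).2)) m' &
    k%:R <= (mm_cost q l * n.+1 ^ q)%:R + cost (n.+1 ^ (q - l)) (n.+1 ^ l) ].
  have sz := size_pre_tables s t n L'; rewrite -/q in sz.
  have exp0 : (0 < exp_pre)%N by apply: leq_trans pre_s.
  have := run_mm HP n0 exp0 g2 (f := q.+2) (q := q) (l := l); rewrite sz; apply=> //.
  - by have [] := agrees_symmetrize s t n L'.
  - by move=> i; rewrite keep2 // keep1 // init0.
  - by move=> i; rewrite keep2 // keep1 // init0.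
  - by apply: expW; rewrite /exp_total -/exp_mm; lia.
have [m4 [k4 [E4 k4c [g4 _]]]] : runs W (comp_prog q.+4 (post_prog s t l)) m3
    (prog_cost (post_prog s t l) * n.+1 ^ D) (fun m' =>
    good n exp_post (all_tables s t l n L') m' /\ keeps m3 m').
  have sz := size_pre_tables s t n L'; rewrite -/q in sz.
  have -> : q.+4 = size (rcons (pre_tables s t n L') (mul_table n q l (nth table0 (pre_tables s t n L') q.+2).2)).
    by rewrite size_rcons sz.
  have exp0 : (0 < exp_mm)%N by apply: leq_trans mm_pre; apply: leq_trans pre_s.
  apply: (runs_prog n0 exp0 g3).
  - have arE : unzip1 (pre_tables s t n L') = s :: nseq q.+2 q.
      by rewrite unzip1_sem_prog out_ar_pre.
    rewrite /unzip1 map_rcons -/(unzip1 _) arE.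
    have hx : size (s :: nseq q.+2 q) = q.+3 by rewrite /= size_nseq.
    have lt1 : (q.+1 < q.+3)%N by rewrite !ltnS leqnSn.
    have lt2 : (q < q.+2)%N by rewrite ltnS leqnSn.
    apply: wf_post; first by rewrite size_rcons hx.
      by rewrite nth_rcons hx lt1 -[nth _ _ _]/(nth 0%N (nseq q.+2 q) q) nth_nseq lt2.
    by rewrite nth_rcons hx ltnn eqxx.
  - by apply: expW; rewrite /exp_total -/exp_post; lia.
  - by rewrite /= !add0n andbT /D /table_dim !leq_max !leqnn !orbT.
have sz : size (all_tables s t l n L') = q.+3.+4.
  by rewrite size_sem_prog size_rcons size_pre_tables addn3.
have ar0 : (nth table0 (all_tables s t l n L') q.+2.+4).1 = 0%N.
  by rewrite /all_tables /= !nth_rcons !size_rcons size_pre_tables ltnn eqxx.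
have [[_ H] bnd _] := g4.
have jlt : (q.+2.+4 < size (all_tables s t l n L'))%N by rewrite sz ltnS leqnn.
have nilw : [::] \in words n.+1 (nth table0 (all_tables s t l n L') q.+2.+4).1 by rewrite ar0.
have ansv : m4 (tbl q.+2.+4) 0%N = (nth table0 (all_tables s t l n L') q.+2.+4).2 [::] := H _ _ jlt nilw.
have ansE : m4 (tbl q.+2.+4) 0%N = #|disjoint_tuples (t + (t + t)) F|%:Z.
  by rewrite ansv answerE // sum_packed3 // (count_disjoint_tuples _ LF) natz.
have b_ans : (absz (m4 (tbl q.+2.+4) 0%N) <= W)%N.
  rewrite ansv; have [_ /(_ _ nilw) h] := bnd _ jlt.
  by apply: leq_trans h (expW _ _); rewrite /exp_total -/exp_post; lia.
eexists; eexists; split.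
- apply: ExecSeq E1 _; apply: ExecSeq E2 _; apply: ExecSeq E3 _; apply: ExecSeq E4 _.
  apply: (@ExecSet _ _ _ _ _ 0%N (m4 (tbl q.+2.+4) 0%N)).
    by rewrite /= word_some.
  by rewrite /= word_some //= word_some.
- by rewrite update_eq ansE.
- have c1 := leq_trans k1c (powD s _ (leq_trans sq (ltnW qD))).
  have b0 : (1 <= n.+1 ^ D)%N by rewrite expn_gt0.
  have c3 := powD q (mm_cost q l) (ltnW qD).
  apply: le_trans (_ : (k1 + k2 + k4 + 4)%N%:R + k3%:R <= _).
    by rewrite -natrD ler_nat [ecost (Cst _)]/= [ecost (Get _ _)]/=; lia.
  have le3 : (mm_cost q l * n.+1 ^ q)%:R <= (mm_cost q l * n.+1 ^ D)%:R :> R by rewrite ler_nat.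
  have le124 : (k1 + k2 + k4 + 4)%N%:R <=
      ((ecost (input_index s) + 30 + prog_cost (pre_prog s t) + prog_cost (post_prog s t l) + 4) * n.+1 ^ D)%N%:R :> R.
    rewrite ler_nat; move: c1 k2c k4c b0; move: (n.+1 ^ D)%N => B.
    move: (ecost _) (prog_cost _) (prog_cost _) => x1 x2 x3; nia.
  have -> : (cost_total * n.+1 ^ D)%N%:R = ((ecost (input_index s) + 30 + prog_cost (pre_prog s t) + prog_cost (post_prog s t l) + 4) * n.+1 ^ D)%N%:R + (mm_cost q l * n.+1 ^ D)%:R :> R.
    rewrite -natrD -mulnDl /cost_total; congr (_ * _)%N%:R.
    move: (ecost _) (prog_cost _) (prog_cost _) (mm_cost _ _) => z1 z2 z3 z4; lia.
  move: k3c le3 le124; lra.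
Qed.
End Run.

(** * The balance of the exponents *)

Section Exponents.
Variable R : realType.

(** [y] is the intended ratio l / q. The bound y <= 1/2 keeps the product thin, y >= 1/3 says 2 (1 -
    y) <= 1 + y for the pairs (x, y), and the last bound says that the product is no slower than the
    sum over Z. *)
Lemma exponent_choice (omega alpha : R) (y := 1 / 2 - 3 * tau omega alpha)
    (b := beta omega alpha) :
  2 <= omega -> omega < 2 + 3728 / 10 ^+ 4 + 639 / 10 ^+ 7 ->
  3 / 10 < alpha -> alpha <= 3 - omega ->
  [/\ 1 / 3 <= y, y <= 1 / 2, 0 <= b, alpha * b <= 2 &
      (1 - y) * (2 - alpha * b) + y * b <= 1 + y].
Proof.
move=> w2 w3 a3 aw.
have w4 : omega < 24 / 10.
  apply: lt_le_trans w3 _; rewrite !exprS expr0 mulr1; lra.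
clear w3; have a1 : alpha <= 1 by lra.
have b0 : 0 <= b.
  rewrite /b /beta; case: eqP => // a1'.
  by rewrite divr_ge0 //; lra.
have ab1 : alpha * b <= 1.
  rewrite /b /beta; case: eqP => [_|/eqP a1']; first by rewrite mulr0; lra.
  have d0 : 0 < 1 - alpha by rewrite subr_gt0 lt_neqAle a1' a1.
  rewrite mulrA ler_pdivrMr //; nra.
have [ah|ah] := leP alpha (1 / 2).
  have d0 : 0 < 1 - alpha by lra.
  have bd : b * (1 - alpha) = omega - 2.
    rewrite /b /beta ifN; last by apply/eqP => a1'; move: ah; rewrite a1'; lra.
    by rewrite divfK //; lra.
  (* A sixth of the denominator of [tau], by 1 + omega = (omega - 2) + 3; positive because alpha <=
     1/2 and omega < 2.4. *)
  have G0 : 0 < 3 * (1 - alpha) - (omega - 2) * (1 + alpha).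
    nra.
  set G := 3 * (1 - alpha) - _ in G0.
  have tauE : tau omega alpha = (3 - omega) * (1 - alpha) / (6 * G).
    rewrite /tau ifT //; congr (_ / _); rewrite /G; ring.
  have yG : y * G = (1 - alpha * b) * (1 - alpha).
    rewrite /y tauE.
    have -> : (1 / 2 - 3 * ((3 - omega) * (1 - alpha) / (6 * G))) * G =
      G / 2 - (3 - omega) * (1 - alpha) / 2 by field; lra.
    rewrite /G; nra.
  have tau0 : 0 <= tau omega alpha by rewrite tauE divr_ge0 // ?mulr_ge0 // ltW //; lra.
  (* This reduces to (omega - 2) (1 + alpha) <= 3 (omega - 2) (1 - alpha), which holds for alpha <=
     1/2. *)
  have tau1 : tau omega alpha <= 1 / 18.
    rewrite tauE ler_pdivrMr; last by lra.
    rewrite /G; nra.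
  split=> //; [rewrite /y; lra|rewrite /y; lra|lra|].
  (* Cancelling 1 - alpha from [yG] gives y (3 - b (1 + alpha)) = 1 - alpha b, the last bound with
     equality. *)
  have GE : G = (3 - b * (1 + alpha)) * (1 - alpha) by rewrite /G -bd; ring.
  have : y * (3 - b * (1 + alpha)) = 1 - alpha * b.
    apply: (mulIf (x := 1 - alpha)); first by rewrite lt0r_neq0.
    by rewrite -mulrA -GE yG.
  move: (y) (alpha) (b) => y' a' b'; nra.
have tauE : tau omega alpha = 1 / 18 by rewrite /tau ifN // -ltNge.
have yE : y = 1 / 3 by rewrite /y tauE; lra.
rewrite yE; split=> //; [lra|lra|].
(* At y = 1/3 the slack of the last bound is a third of this product. *)
have : 0 <= b * (2 * alpha - 1) by rewrite mulr_ge0 //; lra.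
move: (alpha) (b) => a' b'; lra.
Qed.

Lemma powR_succ_le (n : nat) (X e : R) : (0 < n)%N -> 0 <= X -> X <= e ->
  n.+1%:R `^ X <= 2 `^ X * n%:R `^ e.
Proof.
move=> n0 X0 Xe; apply: (@le_trans _ _ ((2 * n)%N%:R `^ X)).
  by apply: ge0_ler_powR; rewrite ?nnegrE ?ler0n // ler_nat; lia.
rewrite natrM powRM ?ler0n //; apply: ler_wpM2l; first exact: powR_ge0.
by apply: ler_powR => //; rewrite ler1n.
Qed.

Lemma expn_succ_le (n D : nat) (e : R) : (0 < n)%N -> D%:R <= e ->
  (n.+1 ^ D)%N%:R <= 2 `^ D%:R * n%:R `^ e.
Proof.
move=> n0 De; rewrite natrX -powR_mulrn ?ler0n //.
exact: powR_succ_le.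
Qed.
End Exponents.

Unset Implicit Arguments.

Theorem theorem4 (R : realType) :
  exists2 c : R, 0 <= c &
    forall omega alpha : R,
      omega = limit_omega R -> alpha = limit_alpha R ->
      2 <= omega -> omega < 2 + 3728 / 10 ^+ 4 + 639 / 10 ^+ 7 ->
      3 / 10 < alpha -> alpha <= 3 - omega ->
      (alpha = 1 <-> omega = 2) ->
      rect_mulmx_thin omega alpha -> rect_mulmx_fat omega ->
      forall s t : nat, (0 < s)%N -> (0 < t)%N -> (3 %| t)%N ->
        counting_time s t
          (fun n => n%:R `^ ((1 / 2 - tau omega alpha) * s%:R * t%:R + c)).
Proof.
(* Rounding y q down to [l] raises the exponents of the product and of the pairs by at most 2; the
   value 3 absorbs this. *)
exists 3 => // omega alpha _ _ w2 w3 a3 aw _ thin _ s t' s0 t0 /dvdnP[t t'E]; subst t'.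
have [y1 y2 b0 ab yb] := exponent_choice w2 w3 a3 aw.
set y := 1 / 2 - 3 * tau omega alpha in y1 y2 yb.
set b := beta omega alpha in b0 ab yb.
have [P [Km [Cm HP]]] := thin.
have t_gt0 : (0 < t)%N by move: t0; rewrite muln_gt0 => /andP[].
clear w3.
pose q := (t * s)%N; pose x := y * q%:R; pose l := Num.truncn x.
have q0 : 0 <= q%:R :> R by rewrite ler0n.
have x0 : 0 <= x by rewrite mulr_ge0 //; lra.
have lx : l%:R <= x by rewrite truncn_le.
have xl : x < l%:R + 1 by rewrite natr1 truncnS_gt.
have x2 : x <= q%:R / 2 by rewrite /x; move: (q%:R) q0 => Q Q0; nra.
have x3 : q%:R / 3 <= x by rewrite /x; move: (q%:R) q0 => Q Q0; nra.
have ll : (l + l <= q)%N by rewrite -(ler_nat R) natrD; lra.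
have lr : (l <= q - l)%N by rewrite leq_subRL // (leq_trans _ ll) ?leq_addr.
have rE : (q - l)%:R = q%:R - l%:R :> R by rewrite natrB // (leq_trans _ ll) ?leq_addr.
pose e := (1 / 2 - tau omega alpha) * s%:R * (t * 3)%:R + 3.
(* The tuple length being 3t, (1/2 - tau) 3q = q + (1/2 - 3 tau) q. *)
have eE : e = q%:R + x + 3 by rewrite /e /x /y /q !natrM; field.
pose X := (q - l)%:R * (2 - alpha * b) + l%:R * b.
have X0 : 0 <= X.
  by rewrite addr_ge0 // mulr_ge0 //; lra.
have Xe : X <= e.
  rewrite eE /X rE.
  have h1 : (q%:R - l%:R) * (2 - alpha * b) <= (q%:R - x + 1) * (2 - alpha * b).
    by apply: ler_wpM2r; lra.
  have h2 : l%:R * b <= x * b by apply: ler_wpM2r.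
  have h3 : (q%:R - x) * (2 - alpha * b) + x * b <= q%:R + x.
    have -> : (q%:R - x) * (2 - alpha * b) + x * b = q%:R * ((1 - y) * (2 - alpha * b) + y * b).
      by rewrite /x; ring.
    have -> : q%:R + x = q%:R * (1 + y) by rewrite /x; ring.
    exact: ler_wpM2l.
  have ab0 : 0 <= alpha * b by rewrite mulr_ge0 //; lra.
  move: h1 h2 h3; lra.
have De : (table_dim q l)%:R <= e.
  rewrite eE /table_dim; case: (leqP q.+1 _) => _; last by rewrite -natr1; lra.
  by case: (leqP (q + l)%N _) => _; rewrite natrD ?rE; lra.
have re : (2 * (q - l))%:R <= e by rewrite eE natrM rE; lra.
pose cost (N M : nat) : R := Cm * (N%:R `^ (2 - alpha * b) * M%:R `^ b + N%:R ^+ 2).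
pose E := exp_total Km s t l.
exists (count_cmd P s t l), (2 ^ E)%N,
  ((cost_total s t l)%:R * 2 `^ (table_dim q l)%:R + `|Cm| * (2 `^ X + 2 `^ (2 * (q - l))%:R)).
move=> n F L n0 Fs LF.
have [m' [k [E1 ans kc]]] := run_count (cost := cost) HP s0 t_gt0 lr n0 Fs LF.
have tE : (t + (t + t))%N = (t * 3)%N by rewrite !mulnS muln0 addn0.
rewrite tE in E1 ans; exists m', k; split=> //.
apply: le_trans kc _; rewrite -/e mulrDl; apply: lerD.
  rewrite natrM -mulrA; apply: ler_wpM2l; first exact: ler0n.
  exact: expn_succ_le.
(* The constant of the multiplication program comes without a sign, hence the absolute value. *)
rewrite /cost; apply: le_trans (ler_norm _) _; rewrite normrM -mulrA; apply: ler_wpM2l => //.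
rewrite ger0_norm; last by rewrite addr_ge0 ?exprn_ge0 ?ler0n // mulr_ge0 // powR_ge0.
rewrite mulrDl; apply: lerD; last first.
  by rewrite -natrX -expnM mulnC; apply: expn_succ_le.
apply: le_trans (powR_succ_le n0 X0 Xe).
rewrite !natrX -!powR_mulrn ?ler0n // -!powRrM /X powRD //.
by apply/implyP => _; rewrite pnatr_eq0.
Qed.
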